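(* Let $M$ be a non-compact simply connected Riemannian surface. (a) Let $H\in\mathcal{C}^\infty(M)$ be such that $\inf_M|H|>\frac12\mathrm{Ch}(M)$. Then, for any $\tau\in\mathcal{C}^\infty(M)$, the space $\mathbb{E}^3(M,\tau)$ admits no entire graphs with mean curvature $H$. (b) Let $\tau\in\mathcal{C}^\infty(M)$ be such that $\inf_M|\tau|>\frac12\mathrm{Ch}(M)$. Then the spacetime $\mathbb{L}^3(M,\tau)$ admits neither complete spacelike surfaces nor entire spacelike graphs.
   Context: Cheeger constant: for a non-compact Riemannian surface $M$ without boundary, $$\mathrm{Ch}(M)=\inf\left\{\frac{\mathrm{Length}(\partial D)}{\mathrm{Area}(D)}: D\subset M\text{ open and regular}\right\}\ge 0,$$ where an open subset $D\subset M$ is regular if it is relatively compact and its boundary is a smooth curve. Spaces: $M$ is conformally parametrized as $M=(\Omega,\delta^{-2}(dx^2+dy^2))$, where $\Omega\subseteq\mathbb{R}^2$ is open and star-shaped with respect to the origin (e.g. a disk or the whole plane) and $\delta\in\mathcal{C}^\infty(\Omega)$ is positive. For $\tau\in\mathcal{C}^\infty(M)$, the Calabi potential is $$\mathbf{C}_{\delta,\tau}(x,y)=2\int_0^1 t\,\frac{\tau(tx,ty)}{\delta(tx,ty)^2}\,dt .$$ $\mathbb{E}^3(M,\tau)$ (with $\epsilon=1$, Riemannian) and $\mathbb{L}^3(M,\tau)$ (with $\epsilon=-1$, Lorentzian) denote $\Omega\times\mathbb{R}$, with coordinates $(x,y,z)$, endowed with the metric $$\frac{1}{\delta^2}(dx^2+dy^2)+\epsilon\left(dz+\epsilon\,\mathbf{C}_{\delta,\tau}(y\,dx-x\,dy)\right)^2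 .$$ The function $\tau$ is called the bundle curvature. An entire graph is a surface $\{(x,y,u(x,y)):(x,y)\in\Omega\}$ with $u\in\mathcal{C}^2(\Omega)$. Its mean curvature $H$ in $\mathbb{E}^3(M,\tau)$, viewed as a function on $M$, is (with respect to the upward-pointing unit normal) given by $$2H=\delta^2\left(\partial_x\left(\frac{\alpha}{\omega}\right)+\partial_y\left(\frac{\beta}{\omega}\right)\right),$$ $\alpha=u_x+y\,\mathbf{C}_{\delta,\tau}$, $\beta=u_y-x\,\mathbf{C}_{\delta,\tau}$, $\omega=\sqrt{1+\delta^2(\alpha^2+\beta^2)}$. A surface in $\mathbb{L}^3(M,\tau)$ is spacelike if its induced metric is Riemannian, and a spacelike surface is complete if its induced metric is complete. *)

(* Defs.v *)
From HB Require Import structures.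
From mathcomp Require Import all_boot all_order all_algebra.
From mathcomp Require Import all_classical all_reals all_analysis.
Set Implicit Arguments.
Unset Strict Implicit.
Unset Printing Implicit Defensive.
Import Order.TTheory GRing.Theory Num.Theory.
Import numFieldNormedType.Exports.
Local Open Scope classical_set_scope.
Local Open Scope ring_scope.

(* MathComp-Analysis, over an arbitrary R : realType.  The base M is the open
   set Om of R * R with the metric delta^-2 (dx^2 + dy^2); functions on M are
   total functions on R * R of which only the values on Om matter.  The norm
   of the library on R * R is the max norm, so Euclidean lengths are spelled
   out. *)

(* f is C^k on the open set U. *)
Fixpoint Ck (R : realType) (V W : normedModType R) (k : nat) (U : set V)
    (f : V -> W) : Prop :=
  match k with
  | 0 => forall p, U p -> {for p, continuous f}
  | k'.+1 => (forall p, U p -> differentiable f p) /\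
             (forall v : V, Ck k' U (fun p => 'D_v f p))
  end.

Definition smooth (R : realType) (V W : normedModType R) (U : set V)
    (f : V -> W) : Prop := forall k, Ck k U f.

Definition star_shaped0 (R : realType) (Om : set (R * R)) : Prop :=
  Om (0, 0) /\
  forall (p : R * R) (t : R), Om p -> 0 <= t <= 1 -> Om (t * p.1, t * p.2).

Definition conformal_domain (R : realType) (Om : set (R * R))
    (delta : R * R -> R) : Prop :=
  [/\ open Om, star_shaped0 Om, smooth Om delta
    & forall p, Om p -> 0 < delta p].

Section cheeger.
Context {R : realType}.
Implicit Types (Om D : set (R * R)) (delta : R * R -> R).

Definition area delta D : R :=
  Rintegral (lebesgue_measure \x lebesgue_measure)%E D
    (fun p => (delta p ^+ 2)^-1).

(* c is a regular, simple, closed smooth curve, of period 1. *)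
Definition closed_curve (c : R -> R * R) : Prop :=
  [/\ smooth setT c,
      forall t, 'D_1 c t != 0,
      forall t, c (t + 1) = c t
    & forall s t, 0 <= s < 1 -> 0 <= t < 1 -> c s = c t -> s = t].

Definition closed_curve_length delta (c : R -> R * R) : R :=
  Rintegral lebesgue_measure `[0, 1]
    (fun t => Num.sqrt (('D_1 c t).1 ^+ 2 + ('D_1 c t).2 ^+ 2) / delta (c t)).

(* The boundary of a relatively compact open set is compact; being a smooth
   curve then means being a finite disjoint union of closed curves, here
   c 0, ..., c n.-1. *)
Definition smooth_boundary D n (c : 'I_n -> R -> R * R) : Prop :=
  [/\ forall i, closed_curve (c i),
      forall i j s t, c i s = c j t -> i = j
    & closure D `\` D = \bigcup_i range (c i)].

(* The empty set is excluded: its area is 0. *)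
Definition regular_domain Om D n (c : 'I_n -> R -> R * R) : Prop :=
  [/\ open D, D !=set0, compact (closure D), closure D `<=` Om
    & smooth_boundary D c].

Definition cheeger Om delta : \bar R :=
  ereal_inf [set q | exists D n (c : 'I_n -> R -> R * R),
    regular_domain Om D c /\
    q = ((\sum_(i < n) closed_curve_length delta (c i)) / area delta D)%:E].

Definition inf_abs Om (h : R * R -> R) : \bar R :=
  ereal_inf [set (`|h p|)%:E | p in Om].

End cheeger.

Section bundle.
Context {R : realType}.
Implicit Types (Om : set (R * R)) (delta tau u : R * R -> R).

Definition calabi_potential delta tau (p : R * R) : R :=
  2 * Rintegral lebesgue_measure `[0, 1]
    (fun t => t * (tau (t * p.1, t * p.2) / delta (t * p.1, t * p.2) ^+ 2)).

(* The metric of E^3(M, tau) (eps = 1) and of L^3(M, tau) (eps = -1), as a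
   quadratic form in the tangent vector w at the point q = (x, y, z). *)
Definition bundle_metric (eps : R) delta tau (q w : R * R * R) : R :=
  let: (x, y, _) := q in
  let: (dx, dy, dz) := w in
  (dx ^+ 2 + dy ^+ 2) / delta (x, y) ^+ 2 +
  eps * (dz + eps * calabi_potential delta tau (x, y) * (y * dx - x * dy)) ^+ 2.

(* Mean curvature in E^3(M, tau) of the graph of u, with respect to the
   upward-pointing unit normal, as a function on M. *)
Definition graph_mean_curvature delta tau u (p : R * R) : R :=
  let C := calabi_potential delta tau in
  let alpha := fun q : R * R => 'D_(1, 0) u q + q.2 * C q in
  let beta := fun q : R * R => 'D_(0, 1) u q - q.1 * C q in
  let omega := fun q : R * R =>
    Num.sqrt (1 + delta q ^+ 2 * (alpha q ^+ 2 + beta q ^+ 2)) in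
  delta p ^+ 2 / 2 * ('D_(1, 0) (fun q => alpha q / omega q) p +
                      'D_(0, 1) (fun q => beta q / omega q) p).

(* The metric induced on U by X : U -> L^3(M, tau) is Riemannian. *)
Definition spacelike_param delta tau (U : set (R * R))
    (X : R * R -> R * R * R) : Prop :=
  forall p, U p -> forall v : R * R, v != 0 ->
    0 < bundle_metric (-1) delta tau (X p) ('D_v X p).

Definition entire_spacelike_graph Om delta tau u : Prop :=
  Ck 2 Om u /\
  spacelike_param delta tau Om (fun p : R * R => (p.1, p.2, u p)).

End bundle.

Section surfaces.
Context {R : realType}.
Variables (Om : set (R * R)) (delta tau : R * R -> R).
Variables (S : topologicalType) (f : S -> R * R * R).

(* phi parametrizes an open set of S by U, homeomorphically, and f \o phi is a
   C^2 immersion. *)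
Definition local_param (U : set (R * R)) (phi : R * R -> S) : Prop :=
  [/\ open U,
      forall p, U p -> {for p, continuous phi},
      forall p q, U p -> U q -> phi p = phi q -> p = q,
      forall V, open V -> V `<=` U -> open (phi @` V)
    & Ck 2 U (f \o phi) /\
      forall p, U p -> forall v : R * R, v != 0 -> 'D_v (f \o phi) p != 0].

(* An immersed C^2 surface f : S -> Om * R.  No atlas has to be given on S:
   since f is an immersion, the changes of local parametrizations are
   automatically C^2 diffeomorphisms. *)
Definition immersed_surface : Prop :=
  [/\ hausdorff_space S, @second_countable S, [set: S] !=set0,
      forall s, Om (f s).1
    & forall s, exists U phi, local_param U phi /\ (phi @` U) s].

Definition spacelike_surface : Prop :=
  immersed_surface /\
  forall U phi, local_param U phi -> spacelike_param delta tau U (f \o phi).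

(* A C^1 curve in S, restricted to [0, 1], from s to s'.  Since f is an
   immersion, a continuous c is C^1 if and only if f \o c is. *)
Definition surface_path (s s' : S) (c : R -> S) : Prop :=
  [/\ continuous c, Ck 1 setT (f \o c), c 0 = s & c 1 = s'].

Definition surface_path_length (c : R -> S) : R :=
  Rintegral lebesgue_measure `[0, 1]
    (fun t => Num.sqrt
       (bundle_metric (-1) delta tau (f (c t)) ('D_1 (f \o c) t))).

(* Riemannian distance of the induced metric.  The velocity of a path may
   vanish, so piecewise C^1 paths, reparametrized, would give the same
   infimum.  The distance between distinct connected components is +oo. *)
Definition surface_dist (s s' : S) : \bar R :=
  ereal_inf [set (surface_path_length c)%:E | c in surface_path s s'].

(* Completeness of the induced distance, whose topology is that of S. *)
Definition complete_surface : Prop :=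
  forall x : nat -> S,
    (forall e : R, 0 < e -> exists N : nat, forall m n : nat,
       (N <= m)%N -> (N <= n)%N -> (surface_dist (x m) (x n) < e%:E)%E) ->
    exists l : S, x @ \oo --> l.

End surfaces.

(* Main.v *)
(* If a C^1 field V on Om satisfies |V| <= 1/delta and div V = 2 h / delta^2,
   where |h| >= m > 0, then h has constant sign and the divergence theorem on a
   regular domain D gives 2 m Area(D) <= Length(boundary of D), so m <= Ch / 2.
   The divergence theorem is only needed as an inequality and up to an arbitrary
   error, which is obtained by cutting V off along the boundary curves.

   For a graph in E^3 the field is (alpha / omega, beta / omega), with
   h = H.  For a spacelike graph in L^3 it is (u_y + x C, y C - u_x): its norm is
   less than 1/delta because the graph is spacelike, and its divergence is
   2 C + x C_x + y C_y = 2 tau / delta^2 because the second derivatives of u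
   commute.

   A complete spacelike surface is an entire graph: its projection to Om is a
   local diffeomorphism which does not decrease lengths, so that segments
   lift, and lifting the segments issued from the origin gives a global
   section. *)

Require Import Defs.
From HB Require Import structures.
From mathcomp Require Import all_boot all_order all_algebra.
From mathcomp Require Import all_classical all_reals all_analysis.
From mathcomp Require Import measurable_realfun.
From mathcomp Require Import ring lra.
Set Implicit Arguments.
Unset Strict Implicit.
Unset Printing Implicit Defensive.
Import Order.TTheory GRing.Theory Num.Theory.
Import numFieldNormedType.Exports.
Local Open Scope classical_set_scope.
Local Open Scope ring_scope.

Local Notation mu := (@lebesgue_measure _).
Local Notation mu2 := (mu \x mu)%E.
Local Notation I2 F := (Rintegral mu2 setT F).

(** No normal vector, orientation or tubular neighbourhood of the boundary curves is at hand: only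
    that their union is the closure of [D] minus [D]. The integral over [D] is therefore taken with
    the sign function of [D], which jumps by 2 across the boundary, while a cutoff vanishing near
    the curves has a gradient of total mass close to twice the length, once for each side; the two
    factors 2 cancel. Such a cutoff is a finite product of functions attached to short arcs. Its
    cost is subadditive, so overlaps of arcs are harmless, but the cost of one arc must be sharp to
    first order: hence thin parallelograms along the tangent.

    The Calabi potential is the radial primitive of the Poincare lemma on a star-shaped domain,
    which is where the identity for 2 C + x C_x + y C_y comes from.

    Lifting uses no covering space theory. Sections of the projection live on convex open sets, and
    two of them that agree at one common point agree at all common points. *)

Lemma continuous_at_pair (T U V : topologicalType) (f : T -> U) (g : T -> V) x :
  {for x, continuous f} -> {for x, continuous g} ->
  {for x, continuous (fun y => (f y, g y))}.
Proof. by move=> cf cg; apply: cvg_pair; [exact: cf|exact: cg]. Qed.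

Lemma continuous_comp2 (T U V W : topologicalType) (f : T -> U) (g : T -> V)
    (F : U * V -> W) x :
  {for x, continuous f} -> {for x, continuous g} ->
  {for (f x, g x), continuous F} -> {for x, continuous (fun y => F (f y, g y))}.
Proof.
move=> cf cg cF; apply: (@continuous_comp _ _ _ (fun y => (f y, g y)) F) => //.
exact: continuous_at_pair.
Qed.

Lemma lra_le (R : realFieldType) (a b : R) : a <= b -> 0 <= b - a.
Proof. by rewrite subr_ge0. Qed.

Lemma lra_lt (R : realFieldType) (a b : R) : a < b -> 0 < b - a.
Proof. by rewrite subr_gt0. Qed.

(* [lra] does not see the inequalities whose order structure was inferred from
   [R : realType] directly; [lra_le] and [lra_lt] restate them over a
   [realFieldType]. *)
Ltac lra' :=
  repeat match goal with
  | H : is_true (_ && _) |- _ => case/andP: H => ? ?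
  | H : is_true (@Order.le ring_display _ _ _) |- _ => move: (lra_le H); clear H
  | H : is_true (@Order.lt ring_display _ _ _) |- _ => move: (lra_lt H); clear H
  end; intros;
  try lazymatch goal with
  | |- is_true (@Order.le ring_display _ _ _) => rewrite -subr_ge0
  | |- is_true (@Order.lt ring_display _ _ _) => rewrite -subr_gt0
  end; lra.

(* The remaining context makes [lra] very slow. *)
Ltac lra_clear := clear; move=> *; lra'.

(** * Integration of compactly supported functions on the plane *)

Section plane_measure.
Context {R : realType}.
Implicit Types (F G : R * R -> R) (U : set (R * R)) (A : R).

Definition box A : set (R * R) := [set p | `|p.1| <= A /\ `|p.2| <= A].

(** The measurable sets of [R * R] are those of the product sigma-algebra, so [U] is exhausted by
    the countably many open squares with rational centre and radius that it contains. *)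
Lemma open_measurable_plane U : open U -> measurable U.
Proof.
move=> oU.
pose B (q : rat * rat * rat) : set (R * R) :=
  `]ratr q.1.1 - ratr q.2, ratr q.1.1 + ratr q.2[ `*`
  `]ratr q.1.2 - ratr q.2, ratr q.1.2 + ratr q.2[.
have -> : U = \bigcup_(q in [set q | B q `<=` U]) B q.
  apply/seteqP; split => [p Up|p [q Bq]]; last exact: Bq.
  have /nbhs_ballP[e /= e0 eU] : nbhs p U by apply: open_nbhs_nbhs.
  have [r] : exists r : rat, (ratr r : R) \in `]0, e / 2[.
    by apply: rat_in_itvoo; rewrite divr_gt0.
  rewrite in_itv/= => /andP[r0 re].
  have ex (x : R) : exists a : rat, (ratr a : R) \in `]x - ratr r, x + ratr r[.
    by apply: rat_in_itvoo; lra.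
  have [a] := ex p.1; rewrite in_itv/= => /andP[a1 a2].
  have [b] := ex p.2; rewrite in_itv/= => /andP[b1 b2].
  exists (a, b, r); last by split; rewrite /= in_itv/=; apply/andP; split; lra.
  move=> z [/=]; rewrite !in_itv/= => /andP[z1 z2] /andP[z3 z4].
  by apply: eU; split; rewrite /ball/= ltr_norml; apply/andP; split; lra.
rewrite bigcup_mkcond; apply: countable_bigcupT_measurable; first exact: countableP.
move=> q; case: ifPn => // _.
exact: measurableX.
Qed.

Lemma continuous_measurable_plane F : continuous F -> measurable_fun setT F.
Proof.
move=> /continuousP cF; apply: (measurability _ (measurable_realfun.RGenOpens.measurableE R)).
move=> _ [_ [a [b ->] <-]]; rewrite setTI; apply: open_measurable_plane.
exact/cF/interval_open.
Qed.

Lemma boxE A : box A = `[- A, A] `*` `[- A, A].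
Proof.
apply/seteqP; split => p; rewrite /box /setX /= !in_itv /= !ler_norml;
  exact.
Qed.

Lemma measurable_box A : measurable (box A).
Proof. by rewrite boxE; exact: measurableX. Qed.

Lemma compact_box A : compact (box A).
Proof. by rewrite boxE; apply: compact_setX; exact: segment_compact. Qed.

Lemma box_fin A : (mu2 (box A) < +oo)%E.
Proof.
rewrite boxE product_measure1E//= lebesgue_measure_itv/=.
by case: ifP => _; rewrite ?mule0 ?mul0e// -EFinB -EFinM ltry.
Qed.

Lemma compact_sub_box (K : set (R * R)) : compact K -> exists2 A : R, 0 < A & K `<=` box A.
Proof.
move=> /compact_bounded[M [_ KM]]; exists (`|M| + 1); first by rewrite ltr_wpDl.
move=> p Kp; have : `|p| <= `|M| + 1 by apply: KM => //; rewrite ltr_pwDr// ler_norm.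
by rewrite prod_normE ge_max => /andP[].
Qed.

Definition supp_box F := exists2 A : R, 0 < A & forall p, ~ box A p -> F p = 0.

Definition Cc F := continuous F /\ supp_box F.

Lemma integrable_bounded_box F : measurable_fun setT F -> supp_box F ->
  (exists M : R, forall p, `|F p| <= M) -> mu2.-integrable setT (EFin \o F).
Proof.
move=> mF [A A0 FA] [M FM].
have -> : EFin \o F = (EFin \o F) \_ (box A).
  apply/funext => p; rewrite patchE; case: ifPn => // /negP; rewrite in_setE => /FA.
  by move=> /= ->.
have iff := @integrable_mkcond _ _ R mu2 (box A) (EFin \o F) (measurable_box A).
apply iff; apply: measurable_bounded_integrable.
- exact: measurable_box.
- exact: box_fin.
- exact: measurable_funTS.
- by exists M; split; [exact: num_real|move=> x /ltW Mx p _; exact: le_trans (FM p) Mx].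
Qed.

Lemma Cc_bounded F : Cc F -> exists M : R, forall p, `|F p| <= M.
Proof.
move=> [cF [A A0 FA]].
have /compact_bounded[M [_ MF]] : compact (F @` box A).
  by apply: continuous_compact (@compact_box A); apply: continuous_subspaceT.
exists (`|M| + 1) => p; have [pA|/FA->] := pselect (box A p); last by rewrite normr0 addr_ge0.
by apply: MF; [rewrite ltr_pwDr// ler_norm|exists p].
Qed.

Lemma Cc_integrable F : Cc F -> mu2.-integrable setT (EFin \o F).
Proof.
move=> cF; apply: integrable_bounded_box (Cc_bounded cF).
- by apply: continuous_measurable_plane; case: cF.
- by case: cF.
Qed.

Lemma CcD F G : Cc F -> Cc G -> Cc (F \+ G).
Proof.
move=> [cF [A A0 FA]] [cG [B B0 GB]]; split; first by move=> p; apply: cvgD; [exact: cF|exact: cG].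
exists (Num.max A B); first by rewrite lt_max A0.
move=> p np; rewrite /= FA ?GB ?addr0// => -[h1 h2]; apply: np; split;
  by rewrite le_max ?h1 ?h2 ?orbT.
Qed.

Lemma CcMl F G : continuous F -> Cc G -> Cc (F \* G).
Proof.
move=> cF [cG [B B0 GB]]; split; first by move=> p; apply: cvgM; [exact: cF|exact: cG].
by exists B => // p np; rewrite /= GB ?mulr0.
Qed.

Lemma Cc_normr F : Cc F -> Cc (fun p => `|F p|).
Proof.
move=> [cF [B B0 FB]]; split; last by exists B => // p np; rewrite FB ?normr0.
by move=> p; apply: cvg_norm; exact: cF.
Qed.

(** [Rintegral] is [fine] of an extended integral, and [fine] loses infinite values; continuity on a
    segment supplies the finiteness that makes the two integrals equal. *)
Lemma Rintegral_itv_setT (f : R -> R) A : continuous f ->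
  (forall x, ~ `|x| <= A -> f x = 0) ->
  (\int[mu]_x (f x)%:E = (\int[mu]_(x in `[- A, A]) f x)%:E)%E.
Proof.
move=> cf fA; rewrite /Rintegral fineK; last first.
  apply: integrable_fin_num => //; apply: continuous_compact_integrable => //.
    exact: segment_compact.
  exact: continuous_subspaceT.
rewrite [RHS]integral_mkcond; apply: eq_integral => x _.
rewrite patchE; case: ifPn => // /negP; rewrite inE/= in_itv/= -ler_norml.
by move=> /fA ->.
Qed.

Lemma continuous_pairl F x : continuous F -> continuous (fun y => F (x, y)).
Proof.
move=> cF y; apply: continuous_comp2; [exact: cvg_cst|exact: cvg_id|exact: cF].
Qed.

Lemma continuous_pairr F y : continuous F -> continuous (fun x => F (x, y)).
Proof.
move=> cF x; apply: continuous_comp2; [exact: cvg_id|exact: cvg_cst|exact: cF].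
Qed.

Lemma Cc_fubiniE F : Cc F ->
  exists2 A : R, 0 < A & (I2 F)%:E = (\int[mu]_x (\int[mu]_(y in `[- A, A]) F (x, y))%:E)%E
    /\ (I2 F)%:E = (\int[mu]_y (\int[mu]_(x in `[- A, A]) F (x, y))%:E)%E
    /\ (forall p, ~ box A p -> F p = 0).
Proof.
move=> CF; have iF := Cc_integrable CF; case: CF => cF [A A0 FA].
exists A => //; rewrite /Rintegral fineK; last exact: integrable_fin_num.
split; [rewrite -(integral12_prod_meas1 iF)|split=> //; rewrite -(integral21_prod_meas1 iF)].
  apply: eq_integral => x _; apply: Rintegral_itv_setT.
    exact: continuous_pairl.
  by move=> y ny; apply: FA => -[].
apply: eq_integral => y _; apply: (Rintegral_itv_setT (f := fun x => F (x, y))).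
  exact: continuous_pairr.
by move=> x nx; apply: FA => -[].
Qed.

Lemma I2_swap F : Cc F -> I2 (fun p => F (p.2, p.1)) = I2 F.
Proof.
move=> CF; have CF' : Cc (fun p => F (p.2, p.1)).
  case: CF => cF [A A0 FA]; split; last first.
    by exists A => // p np; apply: FA => -[h1 h2]; apply: np; split.
  by move=> p; apply: continuous_comp2; [exact: cvg_snd|exact: cvg_fst|exact: cF].
apply: EFin_inj; have [A A0 [_ [-> FA]]] := Cc_fubiniE CF'.
have [B B0 [-> [_ FB]]] := Cc_fubiniE CF.
apply: eq_integral => x _; rewrite -!Rintegral_itv_setT //=.
- by apply: continuous_pairl; case: CF.
- by move=> y ny; apply: FB => -[].
- by apply: continuous_pairl; case: CF.
- by move=> y ny; apply: (FA (y, x)) => -[].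
Qed.

(** The bounds on the slices and on [kappa] are asked for every window [[- A, A]], so that the box
    given by the support of [F] need not be known when the lemma is applied. *)
Lemma I2_iterated_le F (kappa : R -> R) (K : R) : Cc F -> (forall p, 0 <= F p) ->
  continuous kappa -> (forall x, 0 <= kappa x) ->
  (forall A x, 0 < A -> \int[mu]_(y in `[- A, A]) F (x, y) <= kappa x) ->
  (forall A, 0 < A -> \int[mu]_(x in `[- A, A]) kappa x <= K) -> I2 F <= K.
Proof.
move=> CF F0 ck k0 Fk kK; have [A A0 [E [_ FA]]] := Cc_fubiniE CF.
rewrite -lee_fin E; apply: (@le_trans _ _ ((\int[mu]_(x in `[- A, A]) kappa x)%:E)%E); last first.
  by rewrite lee_fin kK.
rewrite /Rintegral fineK; last first.
  apply: integrable_fin_num => //; apply: continuous_compact_integrable => //.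
    exact: segment_compact.
  exact: continuous_subspaceT.
pose h x := (\int[mu]_(y in `[- A, A]) F (x, y))%:E.
have hF : h = fubini_F mu (EFin \o F).
  apply/funext => x; rewrite /fubini_F /h -Rintegral_itv_setT //.
    by apply: continuous_pairl; case: CF.
  by move=> y ny; apply: FA => -[].
have hR : h = h \_ `[- A, A].
  apply/funext => x; rewrite patchE; case: ifPn => // /negP.
  rewrite inE/= in_itv/= -ler_norml => nx.
  rewrite /h (@eq_Rintegral _ _ _ _ _ (cst 0)) ?Rintegral_cst ?mul0r//.
  by move=> y _; apply: FA => -[].
have mh : measurable_fun setT h.
  rewrite hF; exact: (measurable_fubini_F (Cc_integrable CF)).
rewrite -/h hR -integral_mkcond; apply: ge0_le_integral.
- exact: measurable_itv.
- by move=> x _; rewrite lee_fin; apply: Rintegral_ge0.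
- exact: measurable_funTS.
- apply/measurable_EFinP; apply: measurable_funTS; exact: continuous_measurable_fun.
- by move=> x _; rewrite lee_fin Fk.
Qed.

Lemma I2_le F G : Cc F -> Cc G -> (forall p, F p <= G p) -> I2 F <= I2 G.
Proof. by move=> CF CG FG; apply: le_Rintegral => //; exact: Cc_integrable. Qed.

Lemma I2_D F G : Cc F -> Cc G -> I2 (fun p => F p + G p) = I2 F + I2 G.
Proof. by move=> CF CG; apply: RintegralD => //; exact: Cc_integrable. Qed.

End plane_measure.

(** * C^1 functions on the plane *)

Section slices.
Context {R : realType}.

(** Both difference quotients are the same function of [h]; this is how the one-variable calculus is
    carried over to directional derivatives. *)
Lemma is_derive_slice (V W : normedModType R) (f : V -> W) (x v : V) (d : W) :
  is_derive x v f d <-> is_derive (0 : R) 1 (fun h : R => f (h *: v + x)) d.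
Proof.
have E : 'D_v f x = 'D_1 (fun h : R => f (h *: v + x)) 0.
  rewrite /derive; set g1 := fun h => h^-1 *: _; set g2 := fun h => h^-1 *: _.
  suff -> : g1 = g2 by [].
  by rewrite funeqE /g1 /g2 => h /=; rewrite addr0 scale0r add0r [_%:A]mulr1.
by split=> -[df <-]; split => //; apply/(derivable1P f x v).
Qed.

Lemma is_derive_comp1 (V : normedModType R) (g : R -> R) (f : V -> R) (x v : V) (df dg : R) :
  is_derive x v f df -> is_derive (f x) 1 g dg -> is_derive x v (fun y => g (f y)) (dg * df).
Proof.
move=> /is_derive_slice hf hg; apply/is_derive_slice.
set k := fun h : R => f (h *: v + x) in hf *.
have kE : k 0 = f x by rewrite /k scale0r add0r.
have dk : differentiable k 0 by apply/derivable1_diffP; case: hf.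
have dg' : differentiable g (k 0) by rewrite kE; apply/derivable1_diffP; case: hg.
split; first by apply/derivable1_diffP; apply: (@differentiable_comp _ _ _ _ k g).
rewrite -derive1E (@derive1_comp _ k g 0); last 2 first.
- by case: hf.
- by rewrite kE; case: hg.
by rewrite kE !derive1E; case: hf => _ ->; case: hg => _ ->.
Qed.

End slices.

Section C1.
Context {R : realType}.
Implicit Types (F G : R * R -> R) (p : R * R).

(** The partial derivatives are explicit functions, so that the calculus rules produce formulas that
    can be integrated. At a single [p] nothing ties [Fx] to [F] at nearby points; the notion means
    C^1 once it is required on an open set. *)
Definition C1at p F Fx Fy := [/\ {for p, continuous F},
  is_derive p (1, 0) F (Fx p), is_derive p (0, 1) F (Fy p),
  {for p, continuous Fx} & {for p, continuous Fy}].

Lemma near_continuous (T U : topologicalType) (f g : T -> U) x :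
  (\forall y \near x, f y = g y) -> {for x, continuous g} -> {for x, continuous f}.
Proof.
move=> fg cg; rewrite /prop_for /continuous_at (nbhs_singleton fg); apply: cvg_trans cg; apply: near_eq_cvg.
by near=> y; apply/esym; near: y.
Unshelve. all: by end_near. Qed.

Lemma near_C1at p F G Fx Fy Gx Gy :
  (\forall q \near p, [/\ F q = G q, Fx q = Gx q & Fy q = Gy q]) ->
  C1at p G Gx Gy -> C1at p F Fx Fy.
Proof.
move=> h [cG Gx' Gy' cx cy].
have [_ hx hy] := nbhs_singleton h; split.
- by apply: near_continuous cG; near=> q; have [] := near h q.
- rewrite hx; apply: near_eq_is_derive Gx'.
  by near=> q; have [->] : [/\ F q = G q, Fx q = Gx q & Fy q = Gy q] by near: q.
- rewrite hy; apply: near_eq_is_derive Gy'.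
  by near=> q; have [->] : [/\ F q = G q, Fx q = Gx q & Fy q = Gy q] by near: q.
- by apply: near_continuous cx; near=> q; have [] := near h q.
- by apply: near_continuous cy; near=> q; have [] := near h q.
Unshelve. all: by end_near. Qed.

Lemma C1at_cst p (k : R) : C1at p (cst k) (cst 0) (cst 0).
Proof. by split; try exact: is_derive_cst; exact: cvg_cst. Qed.

Lemma C1atD p F Fx Fy G Gx Gy : C1at p F Fx Fy -> C1at p G Gx Gy ->
  C1at p (fun q => F q + G q) (fun q => Fx q + Gx q) (fun q => Fy q + Gy q).
Proof.
move=> [? ? ? ? ?] [? ? ? ? ?]; split; try exact: cvgD; exact: is_deriveD.
Qed.

Lemma C1atN p F Fx Fy : C1at p F Fx Fy ->
  C1at p (fun q => - F q) (fun q => - Fx q) (fun q => - Fy q).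
Proof.
move=> [? ? ? ? ?]; split; try exact: cvgN; exact: is_deriveN.
Qed.

Lemma C1atB p F Fx Fy G Gx Gy : C1at p F Fx Fy -> C1at p G Gx Gy ->
  C1at p (fun q => F q - G q) (fun q => Fx q - Gx q) (fun q => Fy q - Gy q).
Proof. by move=> hF /C1atN; exact: C1atD. Qed.

Lemma C1atM p F Fx Fy G Gx Gy : C1at p F Fx Fy -> C1at p G Gx Gy ->
  C1at p (fun q => F q * G q) (fun q => Fx q * G q + F q * Gx q)
         (fun q => Fy q * G q + F q * Gy q).
Proof.
move=> [cF Fx' Fy' cFx cFy] [cG Gx' Gy' cGx cGy]; split.
- exact: cvgM.
- by apply: is_derive_eq; rewrite addrC; congr (_ + _); rewrite [LHS]mulrC.
- by apply: is_derive_eq; rewrite addrC; congr (_ + _); rewrite [LHS]mulrC.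
- by apply: cvgD; exact: cvgM.
- by apply: cvgD; exact: cvgM.
Qed.

Lemma C1at_comp p (g g' : R -> R) F Fx Fy : C1at p F Fx Fy ->
  is_derive (F p) 1 g (g' (F p)) -> {for F p, continuous g'} ->
  C1at p (fun q => g (F q)) (fun q => g' (F q) * Fx q) (fun q => g' (F q) * Fy q).
Proof.
move=> [cF Fx' Fy' cFx cFy] dg cg'.
have cg : {for F p, continuous g}.
  by apply/differentiable_continuous/derivable1_diffP; case: dg.
have c' : {for p, continuous (fun q => g' (F q))} by apply: (@continuous_comp _ _ _ F g').
split; try exact: cvgM.
- exact: (@continuous_comp _ _ _ F g).
- exact: is_derive_comp1.
- exact: is_derive_comp1.
Qed.

Lemma C1at_fst p : C1at p fst (cst 1) (cst 0).
Proof.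
split; try exact: cvg_cst; try exact: cvg_fst.
- apply/is_derive_slice; rewrite /=.
  rewrite (_ : (fun h => _) = (fun h : R => h + p.1)); last first.
    by apply/funext => h; rewrite [_ *: _]mulr1.
  by apply: is_derive_eq; rewrite addr0.
- apply/is_derive_slice; rewrite /=.
  rewrite (_ : (fun h => _) = (cst p.1)); last first.
    by apply/funext => h; rewrite [_ *: _]mulr0 add0r.
  exact: is_derive_cst.
Qed.

Lemma C1at_snd p : C1at p snd (cst 0) (cst 1).
Proof.
split; try exact: cvg_cst; try exact: cvg_snd.
- apply/is_derive_slice; rewrite /=.
  rewrite (_ : (fun h => _) = (cst p.2)); last first.
    by apply/funext => h; rewrite [_ *: _]mulr0 add0r.
  exact: is_derive_cst.
- apply/is_derive_slice; rewrite /=.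
  rewrite (_ : (fun h => _) = (fun h : R => h + p.2)); last first.
    by apply/funext => h; rewrite [_ *: _]mulr1.
  by apply: is_derive_eq; rewrite addr0.
Qed.

Lemma C1at_swap p F Fx Fy : C1at (p.2, p.1) F Fx Fy ->
  C1at p (fun q => F (q.2, q.1)) (fun q => Fy (q.2, q.1)) (fun q => Fx (q.2, q.1)).
Proof.
move=> [cF Fx' Fy' cFx cFy].
have sw G : {for (p.2, p.1), continuous G} -> {for p, continuous (fun q => G (q.2, q.1))}.
  by move=> cG; apply: continuous_comp2; [exact: cvg_snd|exact: cvg_fst|].
split; try exact: sw.
- by apply/is_derive_slice; move/is_derive_slice : Fy'.
- by apply/is_derive_slice; move/is_derive_slice : Fx'.
Qed.

Lemma is_derive_pairr F (x y d : R) : is_derive (x, y) (1, 0) F d ->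
  is_derive x 1 (fun t => F (t, y)) d.
Proof.
move=> /is_derive_slice h; apply/is_derive_slice; move: h.
congr is_derive; apply/funext => t.
have -> : t *: (1, 0) + (x, y) = (t * 1 + x, t * 0 + y) by [].
by rewrite mulr0 add0r.
Qed.

Lemma is_derive_pairl F (x y d : R) : is_derive (x, y) (0, 1) F d ->
  is_derive y 1 (fun t => F (x, t)) d.
Proof.
move=> /is_derive_slice h; apply/is_derive_slice; move: h.
congr is_derive; apply/funext => t.
have -> : t *: (0, 1) + (x, y) = (t * 0 + x, t * 1 + y) by [].
by rewrite mulr0 add0r.
Qed.

End C1.

Section FTC.
Context {R : realType}.

Lemma FTC2 (f F : R -> R) (a b : R) : a <= b -> continuous f ->
  (forall x : R, is_derive x 1 F (f x)) -> \int[mu]_(x in `[a, b]) f x = F b - F a.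
Proof.
rewrite le_eqVlt => /predU1P[->|ab] cf dF.
  by rewrite set_itv1 Rintegral_set1 subrr.
have cF : continuous F.
  by move=> x; apply/differentiable_continuous/derivable1_diffP; case: (dF x).
rewrite /Rintegral (@continuous_FTC2 _ f F) //.
- exact: continuous_subspaceT.
- split; first by move=> x _; case: (dF x).
  by apply: cvg_at_right_filter; exact: cF.
  by apply: cvg_at_left_filter; exact: cF.
- by move=> x _; rewrite derive1E; case: (dF x).
Qed.

End FTC.

(** * Compactly supported fields have divergence of integral zero *)

Section divergence.
Context {R : realType}.
Implicit Types (F G : R * R -> R) (p : R * R).

Lemma open_notbox A : open (~` box A : set (R * R)).
Proof. by apply: closed_openC; apply: compact_closed (@compact_box _ A); exact: norm_hausdorff. Qed.

Lemma deriv_out_box A F v d p : (forall q, ~ box A q -> F q = 0) -> ~ box A p ->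
  is_derive p v F d -> d = 0.
Proof.
move=> FA np [_ <-]; rewrite (@near_eq_derive _ _ _ F (cst 0)) ?derive_cst//.
have : nbhs p (~` box A) by apply: open_nbhs_nbhs; split => //; exact: open_notbox.
by apply: filterS => q; exact: FA.
Qed.

Lemma supp_C1 F Fx Fy : supp_box F -> (forall p, C1at p F Fx Fy) ->
  [/\ Cc F, Cc Fx & Cc Fy].
Proof.
move=> [A A0 FA] dF; split; (split; first by move=> p; case: (dF p)); exists A => // p np.
- by case: (dF p) => _ /(deriv_out_box FA np).
- by case: (dF p) => _ _ /(deriv_out_box FA np).
Qed.

(** Fubini, then the fundamental theorem of calculus on each line: [F] vanishes at both ends of a
    long enough segment. *)
Lemma I2_deriv0 F Fx Fy : supp_box F -> (forall p, C1at p F Fx Fy) ->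
  I2 Fx = 0 /\ I2 Fy = 0.
Proof.
move=> sF dF; have [CF CFx CFy] := supp_C1 sF dF; case: sF => A A0 FA.
(* The window [B] supplied by Fubini may be too short to leave the support of [F]. The alternative
   [B <= A] records this, and is excluded below by enlarging the window to [Num.max B (A + 1)]. *)
have h f g : continuous f -> (forall x : R, is_derive x 1 g (f x)) ->
    (forall x, A < `|x| -> g x = 0) -> forall B, \int[mu]_(x in `[- B, B]) f x = 0 \/ B <= A.
  move=> cf dg gA B; have [|AB] := leP B A; [by right|left].
  have B0 : 0 < B by exact: lt_trans AB.
  by rewrite (FTC2 _ cf dg) ?gA ?subrr ?normrN ?gtr0_norm// ge0_cp// ltW.
split; apply: EFin_inj.
  have [B B0 [_ [-> FB]]] := Cc_fubiniE CFx.
  rewrite -[RHS](@integral0 _ _ _ mu setT); apply: eq_integral => y _.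
  pose f x := Fx (x, y); have cf : continuous f by apply: continuous_pairr; case: CFx.
  rewrite -Rintegral_itv_setT //; last by move=> x nx; apply: FB => -[].
  rewrite (@Rintegral_itv_setT _ f (Num.max B (A + 1))) //; last first.
    by move=> x nx; apply: FB => -[/= xB _]; apply: nx; rewrite le_max xB.
  have df (x : R) : is_derive x 1 (fun x => F (x, y)) (f x).
    by apply: is_derive_pairr; case: (dF (x, y)).
  have f0 x : A < `|x| -> F (x, y) = 0.
    by move=> Ax; apply: FA => -[/= xA _]; move: Ax; rewrite ltNge xA.
  have [->//|] := h f _ cf df f0 (Num.max B (A + 1)).
  by rewrite ge_max => /andP[_ ?]; exfalso; lra.
have [B B0 [-> [_ FB]]] := Cc_fubiniE CFy.
rewrite -[RHS](@integral0 _ _ _ mu setT); apply: eq_integral => x _.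
pose f y := Fy (x, y); have cf : continuous f by apply: continuous_pairl; case: CFy.
rewrite -Rintegral_itv_setT //; last by move=> y ny; apply: FB => -[].
rewrite (@Rintegral_itv_setT _ f (Num.max B (A + 1))) //; last first.
  by move=> y ny; apply: FB => -[/= _ yB]; apply: ny; rewrite le_max yB.
have df (y : R) : is_derive y 1 (fun y => F (x, y)) (f y).
  by apply: is_derive_pairl; case: (dF (x, y)).
have f0 y : A < `|y| -> F (x, y) = 0.
  by move=> Ay; apply: FA => -[/= _ yA]; move: Ay; rewrite ltNge yA.
have [->//|] := h f _ cf df f0 (Num.max B (A + 1)).
by rewrite ge_max => /andP[_ ?]; exfalso; lra.
Qed.

End divergence.

(** * Cutoff functions along curves *)

Section smoothstep.
Context {R : realType}.

(* An antiderivative of 2 |x|; its second difference is the step below. *)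
Let q (x : R) := x * `|x|.

Let is_derive_q (x : R) : is_derive x 1 q (2 * `|x|).
Proof.
have [x0|x0|->] := ltgtP x 0.
- apply: (@near_eq_is_derive _ _ _ (fun y : R => - (y ^+ 2))).
    near=> y; rewrite /q ltr0_norm ?mulrN -?expr2//; near: y.
    exact: lt_nbhsl.
  by apply: is_derive_eq; rewrite ltr0_norm// /GRing.scale/=; ring.
- apply: (@near_eq_is_derive _ _ _ (fun y : R => y ^+ 2)).
    near=> y; rewrite /q gtr0_norm -?expr2//; near: y.
    exact: lt_nbhsr.
  by apply: is_derive_eq; rewrite gtr0_norm// /GRing.scale/=; ring.
rewrite normr0 mulr0.
have h : h^-1 *: (q (h *: 1 + 0) - q 0) @[h --> (0:R)^'] --> (0 : R).
  have c : `|h| @[h --> (0:R)^'] --> `|0 : R|.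
    by apply: cvg_norm; apply: nbhs_dnbhs.
  rewrite normr0 in c.
  apply: cvg_trans c; apply: near_eq_cvg; near=> h.
  rewrite /q /GRing.scale/= mulr1 addr0 mul0r subr0 mulKf//.
  by near: h; exact: nbhs_dnbhs_neq.
by split; [apply/cvg_ex; exists 0|exact: cvg_lim h].
Unshelve. all: by end_near. Qed.

(** The tent of height 1 over [[-1, 1]], as half the second difference of the absolute value. *)
Definition hat (x : R) := (`|x + 1| + `|x - 1| - 2 * `|x|) / 2.

(** The second difference of [q] is -2 to the left of -1 and 2 to the right of 1; the constants 1/2
    and 1/4 bring these values to 0 and 1. *)
Definition step (x : R) := 2^-1 + (q (x + 1) + q (x - 1) - 2 * q x) / 4.

Let is_derive_shift (k x : R) : is_derive x 1 (fun y : R => y + k) 1.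
Proof. by apply: is_derive_eq; rewrite addr0. Qed.

Lemma is_derive_step (x : R) : is_derive x 1 step (hat x).
Proof.
have h k : is_derive x 1 (fun y : R => q (y + k)) (2 * `|x + k|).
  by have := is_derive_comp1 (is_derive_shift k x) (is_derive_q (x + k)); rewrite mulr1.
have h1 := h 1; have h2 := h (- 1); have h3 := is_derive_q x.
apply: is_derive_eq; by rewrite /hat /GRing.scale /=; field.
Qed.

Lemma continuous_hat : continuous hat.
Proof.
move=> x; apply: cvgMl; apply: cvgB; first apply: cvgD.
- by apply: cvg_norm; apply: cvgD; [exact: cvg_id|exact: cvg_cst].
- by apply: cvg_norm; apply: cvgB; [exact: cvg_id|exact: cvg_cst].
- by apply: cvgMr; apply: cvg_norm; exact: cvg_id.
Qed.

Lemma hat_ge0 x : 0 <= hat x.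
Proof.
rewrite /hat; apply: divr_ge0 => //; rewrite subr_ge0.
have -> : 2 * `|x| = `|(x + 1) + (x - 1)|.
  by rewrite -[2]ger0_norm// -normrM; congr `|_|; ring.
exact: ler_normD.
Qed.

Lemma hat_out x : 1 <= `|x| -> hat x = 0.
Proof.
rewrite ler_normr => /orP[x1|x1]; rewrite /hat.
  by rewrite !ger0_norm; lra.
by rewrite !ler0_norm; lra.
Qed.

Lemma step0 x : x <= - 1 -> step x = 0.
Proof. by move=> x1; rewrite /step /q !ler0_norm; try lra; field. Qed.

Lemma step1 x : 1 <= x -> step x = 1.
Proof. by move=> x1; rewrite /step /q !ger0_norm; try lra; field. Qed.

Lemma step_le x y : x <= y -> step x <= step y.
Proof.
move=> xy; rewrite -subr_ge0 -(FTC2 xy continuous_hat is_derive_step).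
by apply: Rintegral_ge0 => z _; exact: hat_ge0.
Qed.

Lemma step_ge0 x : 0 <= step x.
Proof.
have [/step0->//|/ltW x1] := leP x (-1).
by rewrite -(step0 (lexx (-1))); exact: step_le.
Qed.

Lemma step_le1 x : step x <= 1.
Proof.
have [/step1->//|/ltW x1] := leP 1 x.
by rewrite -(step1 (lexx 1)); exact: step_le.
Qed.

(** A C^1 bump whose transitions are centred at [l] and [r] and have half-width [w]; it is supported
    in [[l - w, r + w]]. *)
Definition plateau (l r w x : R) := step ((x - l) / w) - step ((x - r) / w).
Definition dplateau (l r w x : R) := (hat ((x - l) / w) - hat ((x - r) / w)) / w.

Section plateau.
Variables (l r w : R).
Hypotheses (lr : l <= r) (w0 : 0 < w).

Lemma is_derive_step_scaled (k x : R) :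
  is_derive x 1 (fun y : R => step ((y - k) / w)) (hat ((x - k) / w) / w).
Proof.
have h : is_derive x 1 (fun y : R => (y - k) / w) w^-1.
  by apply: is_derive_eq; rewrite /GRing.scale /=; ring.
exact: is_derive_comp1 h (is_derive_step _).
Qed.

Lemma continuous_hat_scaled (k : R) : continuous (fun x => hat ((x - k) / w) / w).
Proof.
move=> x; apply: cvgMl.
apply: (@continuous_comp _ _ _ (fun x => (x - k) / w) hat); last exact: continuous_hat.
by apply: cvgMl; apply: cvgB; [exact: cvg_id|exact: cvg_cst].
Qed.

Lemma is_derive_plateau (x : R) :
  is_derive x 1 (plateau l r w) (dplateau l r w x).
Proof.
have := is_deriveB (is_derive_step_scaled l x) (is_derive_step_scaled r x).
by rewrite -mulrBl.
Qed.

Lemma continuous_dplateau : continuous (dplateau l r w).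
Proof.
rewrite (_ : dplateau l r w = fun x => hat ((x - l) / w) / w - hat ((x - r) / w) / w).
  by move=> x; apply: cvgB; exact: continuous_hat_scaled.
by apply/funext => x; rewrite /dplateau mulrBl.
Qed.

Lemma continuous_plateau : continuous (plateau l r w).
Proof.
by move=> x; apply/differentiable_continuous/derivable1_diffP; case: (is_derive_plateau x).
Qed.

Lemma plateau_ge0 x : 0 <= plateau l r w x.
Proof. by rewrite subr_ge0; apply: step_le; apply: ler_wpM2r; [rewrite invr_ge0 ltW|lra']. Qed.

Lemma plateau_le1 x : plateau l r w x <= 1.
Proof. by rewrite lerBlDr (le_trans (step_le1 _))// lerDl step_ge0. Qed.

Lemma plateau1 x : l + w <= x <= r - w -> plateau l r w x = 1.
Proof.
move=> /andP[h1 h2]; rewrite /plateau step1 ?step0 ?subr0//.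
  by rewrite ler_pdivrMr//; lra'.
by rewrite ler_pdivlMr//; lra'.
Qed.

Lemma plateau_out x : ~~ (l - w < x < r + w) -> plateau l r w x = 0 /\ dplateau l r w x = 0.
Proof.
rewrite negb_and -!leNgt => /orP[h|h]; rewrite /plateau /dplateau.
  rewrite !step0 ?hat_out ?subrr ?mul0r//.
  - by rewrite ler_normr; apply/orP; right; rewrite -mulNr ler_pdivlMr//; lra'.
  - by rewrite ler_normr; apply/orP; right; rewrite -mulNr ler_pdivlMr//; lra'.
  - by rewrite ler_pdivrMr//; lra'.
  - by rewrite ler_pdivrMr//; lra'.
rewrite !step1 ?hat_out ?subrr ?mul0r//.
- by rewrite ler_normr; apply/orP; left; rewrite ler_pdivlMr//; lra'.
- by rewrite ler_normr; apply/orP; left; rewrite ler_pdivlMr//; lra'.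
- by rewrite ler_pdivlMr//; lra'.
- by rewrite ler_pdivlMr//; lra'.
Qed.

Lemma integrable_itv (f : R -> R) (a b : R) : continuous f -> mu.-integrable `[a, b] (EFin \o f).
Proof.
move=> cf; apply: continuous_compact_integrable; first exact: segment_compact.
exact: continuous_subspaceT.
Qed.

(** The total variation is at most 1 for the rise plus 1 for the fall, whatever [w] is. The shift
    [k] serves for the slices of a slanted strip. *)
Lemma int_dplateau_le (k A : R) : 0 < A ->
  \int[mu]_(x in `[- A, A]) `|dplateau l r w (x - k)| <= 2.
Proof.
move=> A0; have AA : - A <= A by lra'.
have cs (m : R) : continuous (fun x => hat ((x - m) / w) / w) := @continuous_hat_scaled m.
have I m : \int[mu]_(x in `[- A, A]) (hat ((x - m) / w) / w) <= 1.
  rewrite (FTC2 AA (cs m) (is_derive_step_scaled m)).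
  by rewrite lerBlDr (le_trans (step_le1 _))// lerDl step_ge0.
apply: (@le_trans _ _ (\int[mu]_(x in `[- A, A]) (hat ((x - (l + k)) / w) / w +
    hat ((x - (r + k)) / w) / w))); last first.
  rewrite RintegralD//; [|exact: integrable_itv|exact: integrable_itv].
  by rewrite -[2]/(1 + 1) lerD.
apply: le_Rintegral => //.
- apply: integrable_itv => x; apply: cvg_norm.
  apply: (@continuous_comp _ _ _ (fun x => x - k) (dplateau l r w)); last exact: continuous_dplateau.
  by apply: cvgB; [exact: cvg_id|exact: cvg_cst].
- by apply: integrable_itv => x; apply: cvgD; exact: cs.
- move=> x _; rewrite /dplateau mulrBl (le_trans (ler_normB _ _))//.
  have E m : x - (m + k) = x - k - m by ring.
  have d0 y : 0 <= hat y / w by rewrite divr_ge0 ?hat_ge0// ltW.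
  by rewrite !E !ger0_norm.
Qed.

Lemma int_plateau_le (k A : R) : 0 < A ->
  \int[mu]_(x in `[- A, A]) plateau l r w (x - k) <= r - l + 2 * w.
Proof.
move=> A0; rewrite -lee_fin /Rintegral.
have cp : continuous (fun x => plateau l r w (x - k)).
  move=> x; apply: (@continuous_comp _ _ _ (fun x => x - k) (plateau l r w)); last exact: continuous_plateau.
  by apply: cvgB; [exact: cvg_id|exact: cvg_cst].
rewrite fineK; last by apply: integrable_fin_num => //; exact: integrable_itv.
apply: (@le_trans _ _ (\int[mu]_(x in `[(- A)%R, A]) (\1_(`[l - w + k, r + w + k]) x)%:E)%E).
  apply: ge0_le_integral => //.
  - by move=> x _; rewrite lee_fin plateau_ge0.
  - by apply/measurable_EFinP; apply: measurable_funTS; exact: continuous_measurable_fun.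
  - by apply/measurable_EFinP; apply: measurable_indic.
  - move=> x _; rewrite lee_fin indicE; case: (boolP (_ \in _)) => [_|].
      exact: plateau_le1.
    rewrite notin_setE/= in_itv/= => /negP nx.
    rewrite (plateau_out _).1//; apply: contra nx => /andP[? ?]; apply/andP; split; lra'.
rewrite integral_indic//; apply: (@le_trans _ _ (mu `[l - w + k, r + w + k])).
  by apply: le_measure; rewrite ?inE//; exact: measurableI.
have lt : l - w + k < r + w + k by lra'.
rewrite lebesgue_measure_itv/= lte_fin lt -EFinB lee_fin. lra'.
Qed.

End plateau.

End smoothstep.

Section euclidean.
Context {R : realType}.

Definition enorm (a b : R) := Num.sqrt (a ^+ 2 + b ^+ 2).

Lemma enorm_ge0 a b : 0 <= enorm a b. Proof. exact: sqrtr_ge0. Qed.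

Lemma enorm_sq a b : enorm a b ^+ 2 = a ^+ 2 + b ^+ 2.
Proof. by rewrite sqr_sqrtr// addr_ge0// sqr_ge0. Qed.

Lemma enorm_le a b (c : R) : 0 <= c -> a ^+ 2 + b ^+ 2 <= c ^+ 2 -> enorm a b <= c.
Proof.
by move=> c0 h; rewrite -(@ler_pXn2r _ 2)// ?nnegrE ?enorm_ge0// enorm_sq.
Qed.

Lemma enorm_CS a b c d : a * c + b * d <= enorm a b * enorm c d.
Proof.
apply: le_trans (ler_norm _) _; rewrite -sqrtr_sqr -sqrtrM ?addr_ge0 ?sqr_ge0//.
rewrite ler_sqrt ?mulr_ge0 ?addr_ge0 ?sqr_ge0// -subr_ge0.
rewrite (_ : _ - _ = (a * d - b * c) ^+ 2) ?sqr_ge0//; ring.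
Qed.

Lemma enorm_CS_abs a b c d : `|a * c + b * d| <= enorm a b * enorm c d.
Proof.
rewrite ler_norml enorm_CS andbT lerNl.
have := enorm_CS (- a) (- b) c d.
by rewrite /enorm !sqrrN !mulNr opprD.
Qed.

Lemma enormD a b c d : enorm (a + c) (b + d) <= enorm a b + enorm c d.
Proof.
apply: enorm_le; first by rewrite addr_ge0 ?enorm_ge0.
rewrite [leRHS]sqrrD !enorm_sq.
have := enorm_CS a b c d; set N := enorm a b * enorm c d; move=> h.
rewrite -subr_ge0 (_ : _ - _ = 2 * (N - (a * c + b * d))); last by rewrite /N; ring.
by rewrite mulr_ge0// subr_ge0.
Qed.

Lemma enormZ k a b : enorm (k * a) (k * b) = `|k| * enorm a b.
Proof. by rewrite /enorm !exprMn -mulrDr sqrtrM ?sqr_ge0// sqrtr_sqr. Qed.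

Lemma enorm_swap a b : enorm a b = enorm b a.
Proof. by rewrite /enorm addrC. Qed.

Lemma enorm_le_abs a b : enorm a b <= `|a| + `|b|.
Proof.
apply: enorm_le; first by rewrite addr_ge0.
by rewrite [leRHS]sqrrD !real_normK ?num_real// lerD2r lerDl mulrn_wge0// mulr_ge0.
Qed.

Lemma abs_le_enorm a b : `|a| <= enorm a b.
Proof. by rewrite -sqrtr_sqr ler_wsqrtr// lerDl sqr_ge0. Qed.

Lemma continuous_enorm (T : topologicalType) (f g : T -> R) x :
  {for x, continuous f} -> {for x, continuous g} ->
  {for x, continuous (fun y => enorm (f y) (g y))}.
Proof.
move=> cf cg.
apply: (@continuous_comp _ _ _ (fun y => f y ^+ 2 + g y ^+ 2) Num.sqrt); last first.
  exact: sqrt_continuous.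
apply: cvgD; first exact: (@continuous_comp _ _ _ f (fun z => z ^+ 2) x cf (@exprn_continuous _ 2 _)).
exact: (@continuous_comp _ _ _ g (fun z => z ^+ 2) x cg (@exprn_continuous _ 2 _)).
Qed.

End euclidean.

(** * Cutoffs, their cost, and bumps on parallelograms *)

Section cutoff.
Context {R : realType}.
Implicit Types (F G w g : R * R -> R) (p : R * R).

(* chi vanishes near Z; kappa bounds its gradient in the weight w, plus the
   g-mass of the region where chi differs from 1. *)
Definition cutoff w g (Z : set (R * R)) (kappa : R) :=
  exists chi chix chiy : R * R -> R, [/\ forall p, C1at p chi chix chiy,
    forall p, 0 <= chi p <= 1, forall p, Z p -> \forall q \near p, chi q = 0
    & I2 (fun p => enorm (chix p) (chiy p) * w p + (1 - chi p) * g p) <= kappa].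

Lemma Cc_cutoff w g chi chix chiy : Cc w -> Cc g -> (forall p, C1at p chi chix chiy) ->
  Cc (fun p => enorm (chix p) (chiy p) * w p + (1 - chi p) * g p).
Proof.
move=> cw cg hC; apply: CcD; apply: CcMl => // p; have [? ? ? ? ?] := hC p.
  exact: continuous_enorm.
by apply: cvgB => //; exact: cvg_cst.
Qed.

(** The product of the two cutoffs works: by the Leibniz rule with factors in [0, 1] its gradient is
    at most the sum of the gradients, and 1 - f h is at most (1 - f) + (1 - h). *)
Lemma cutoffU w g Z1 Z2 k1 k2 : Cc w -> Cc g -> (forall p, 0 <= w p) -> (forall p, 0 <= g p) ->
  cutoff w g Z1 k1 -> cutoff w g Z2 k2 -> cutoff w g (Z1 `|` Z2) (k1 + k2).
Proof.
move=> cw cg w0 g0 [f [fx [fy [df f01 fZ fk]]]] [h [hx [hy [dh h01 hZ hk]]]].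
exists (fun p => f p * h p), (fun p => fx p * h p + f p * hx p),
  (fun p => fy p * h p + f p * hy p).
have dfh p := C1atM (df p) (dh p); split => //.
- move=> p; have /andP[f0 f1] := f01 p; have /andP[h0 h1] := h01 p.
  by rewrite mulr_ge0// mulr_ile1.
- by move=> p [/fZ|/hZ]; apply: filterS => q ->; rewrite ?mul0r ?mulr0.
have C1 := Cc_cutoff cw cg df; have C2 := Cc_cutoff cw cg dh.
apply: le_trans (lerD fk hk); rewrite -I2_D//; apply: I2_le => //.
- exact: Cc_cutoff.
- exact: CcD.
move=> p; have /andP[f0 f1] := f01 p; have /andP[h0 h1] := h01 p.
rewrite addrACA -!mulrDl; apply: lerD; apply: ler_wpM2r => //; last first.
  rewrite -subr_ge0 (_ : _ - _ = (1 - f p) * (1 - h p)); last by ring.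
  by rewrite mulr_ge0// subr_ge0.
apply: le_trans (enormD _ _ _ _) _; apply: lerD.
  by rewrite mulrC [X in enorm _ X]mulrC enormZ ger0_norm// ler_piMl// enorm_ge0.
by rewrite enormZ ger0_norm// ler_piMl// enorm_ge0.
Qed.

Lemma cutoff_subset w g Z1 Z2 k1 k2 : Z1 `<=` Z2 -> k2 <= k1 ->
  cutoff w g Z2 k2 -> cutoff w g Z1 k1.
Proof.
move=> Z12 k21 [f [fx [fy [df f01 fZ fk]]]]; exists f, fx, fy; split => //.
  by move=> p /Z12/fZ.
exact: le_trans k21.
Qed.

Lemma I2_iterated_mul (f : R -> R) (h : R * R -> R) (K L : R) : Cc h -> (forall p, 0 <= h p) ->
  continuous f -> (forall x, 0 <= f x) -> 0 <= L ->
  (forall A x, 0 < A -> \int[mu]_(y in `[- A, A]) h (x, y) <= f x * L) ->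
  (forall A, 0 < A -> \int[mu]_(x in `[- A, A]) f x <= K) -> I2 h <= K * L.
Proof.
move=> Ch h0 cf f0 L0 hf fK; apply: (@I2_iterated_le _ _ (fun x => f x * L)) => //.
- by move=> x; apply: cvgMl; exact: cf.
- by move=> x; rewrite mulr_ge0.
move=> A A0; rewrite RintegralZr//; last exact: integrable_itv.
by rewrite ler_wpM2r// fK.
Qed.

Lemma eq_C1at p F G Fx Fy Gx Gy : F =1 G -> Fx =1 Gx -> Fy =1 Gy ->
  C1at p G Gx Gy -> C1at p F Fx Fy.
Proof. by move=> /funext -> /funext -> /funext ->. Qed.

Section pbump.
Variables (la ra wa lb rb wb m : R).
Hypotheses (lra : la <= ra) (wa0 : 0 < wa) (lrb : lb <= rb) (wb0 : 0 < wb).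

Let a := plateau la ra wa.
Let da := dplateau la ra wa.
Let b := plateau lb rb wb.
Let db := dplateau lb rb wb.
Let Y p := p.2 - m * p.1.

(** A bump on a parallelogram with two vertical sides and two sides of slope [m]. The shear [Y]
    preserves area, and on each vertical line the second factor is a translate of [b]. *)
Definition pbump p := a p.1 * b (Y p).
Definition pbumpx p := da p.1 * b (Y p) + a p.1 * (db (Y p) * - m).
Definition pbumpy p := a p.1 * db (Y p).

Let C1a p : C1at p (fun q => a q.1) (fun q => da q.1) (cst 0).
Proof.
have := C1at_comp (C1at_fst p) (is_derive_plateau la ra wa _) (@continuous_dplateau _ la ra wa _).
apply: eq_C1at => // q; first by rewrite [cst 1 q]/= mulr1.
by rewrite [cst 0 q]/= mulr0.
Qed.

Let C1Y p : C1at p Y (cst (- m)) (cst 1).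
Proof.
have := C1atB (C1at_snd p) (C1atM (C1at_cst p m) (C1at_fst p)).
apply: eq_C1at => // q; rewrite /=; first by rewrite mul0r !add0r mulr1.
by rewrite mul0r !add0r mulr0 subr0.
Qed.

Let C1b p : C1at p (fun q => b (Y q)) (fun q => db (Y q) * - m) (fun q => db (Y q)).
Proof.
have := C1at_comp (C1Y p) (is_derive_plateau lb rb wb _) (@continuous_dplateau _ lb rb wb _).
by apply: eq_C1at => // q; rewrite [cst 1 q]/= mulr1.
Qed.

Lemma C1at_bump p : C1at p pbump pbumpx pbumpy.
Proof.
have := C1atM (C1a p) (C1b p); apply: eq_C1at => // q.
by rewrite [cst 0 q]/= mul0r add0r.
Qed.

Lemma bump_itv p : 0 <= pbump p <= 1.
Proof. by rewrite mulr_ge0 ?plateau_ge0// mulr_ile1 ?plateau_ge0 ?plateau_le1. Qed.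

Lemma bump1 p : la + wa <= p.1 <= ra - wa -> lb + wb <= p.2 - m * p.1 <= rb - wb -> pbump p = 1.
Proof. by move=> h1 h2; rewrite /pbump /a /b !plateau1// mulr1. Qed.

Lemma bump_out p :
  ~~ ((la - wa < p.1 < ra + wa) && (lb - wb < p.2 - m * p.1 < rb + wb)) ->
  [/\ pbump p = 0, pbumpx p = 0 & pbumpy p = 0].
Proof.
rewrite negb_and => /orP[h|h]; rewrite /pbump /pbumpx /pbumpy /a /da /b /db.
  by have [-> ->] := plateau_out lra wa0 h; rewrite !mul0r addr0.
by have [-> ->] := plateau_out lrb wb0 h; rewrite !mul0r !mulr0 addr0.
Qed.

Lemma bump_region_box : exists2 A : R, 0 < A & forall p, ~ box A p ->
  ~~ ((la - wa < p.1 < ra + wa) && (lb - wb < p.2 - m * p.1 < rb + wb)).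
Proof.
exists (`|la| + `|ra| + wa + `|lb| + `|rb| + wb + `|m| * (`|la| + `|ra| + wa)).
  have := normr_ge0 la; have := normr_ge0 ra; have := normr_ge0 lb.
  have := normr_ge0 rb; have := mulr_ge0 (normr_ge0 m) (addr_ge0 (addr_ge0 (normr_ge0 la) (normr_ge0 ra)) (ltW wa0)).
  by move: wa0 wb0; move=> *; lra'.
move=> p np; apply/negP => /andP[/andP[h1 h2] /andP[h3 h4]]; apply: np.
have n1 : `|p.1| <= `|la| + `|ra| + wa.
  rewrite ler_norml; apply/andP; split.
    by have := ler_norm (- la); rewrite normrN; have := normr_ge0 ra; move: h1; move=> ? ? ?; lra'.
  by have := ler_norm ra; have := normr_ge0 la; move: h2; move=> ? ? ?; lra'.
have n2 : `|p.2 - m * p.1| <= `|lb| + `|rb| + wb.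
  rewrite ler_norml; apply/andP; split.
    by have := ler_norm (- lb); rewrite normrN; have := normr_ge0 rb; move: h3; move=> ? ? ?; lra'.
  by have := ler_norm rb; have := normr_ge0 lb; move: h4; move=> ? ? ?; lra'.
have n3 : `|m * p.1| <= `|m| * (`|la| + `|ra| + wa) by rewrite normrM ler_wpM2l.
have n4 : `|p.2| <= `|p.2 - m * p.1| + `|m * p.1|.
  by rewrite -{1}[p.2](subrK (m * p.1)) ler_normD.
have n5 := normr_ge0 (p.2 - m * p.1); have n6 := normr_ge0 (m * p.1).
have n7 := normr_ge0 p.1.
by move: n1 n2 n3 n4 n5 n6 n7; split; lra'.
Qed.

Lemma supp_bump : supp_box pbump.
Proof.
have [A A0 hA] := bump_region_box; exists A => // p /hA.
by case/bump_out.
Qed.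

Lemma I2_bump : I2 pbump <= (ra - la + 2 * wa) * (rb - lb + 2 * wb).
Proof.
have Cb : Cc pbump by case: (supp_C1 supp_bump C1at_bump).
apply: (@I2_iterated_mul a) => //.
- by move=> p; case/andP: (bump_itv p).
- exact: continuous_plateau.
- by move=> x; exact: plateau_ge0.
- by move: lrb wb0; move=> *; lra'.
- move=> A x A0; rewrite /pbump /= RintegralZl//; last first.
    apply: integrable_itv => y.
    apply: (@continuous_comp _ _ _ (fun y => y - m * x) b); last exact: continuous_plateau.
    by apply: cvgB; [exact: cvg_id|exact: cvg_cst].
  by apply: ler_wpM2l; [exact: plateau_ge0|exact: (int_plateau_le lrb wb0 (m * x) A0)].
- move=> A A0; have := int_plateau_le lra wa0 0 A0.
  by congr (_ <= _); apply: eq_Rintegral => x _; rewrite subr0.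
Qed.

(** The gradient is [da * b] times (1, 0) plus [a * db] times (- m, 1), a vector of length
    [enorm 1 m]. The first term accounts for the vertical sides, the second for the two sides of
    slope [m]; each plateau derivative has mass at most 2. *)
Lemma I2_bump_grad : I2 (fun p => enorm (pbumpx p) (pbumpy p)) <=
  2 * (rb - lb + 2 * wb) + enorm 1 m * (2 * (ra - la + 2 * wa)).
Proof.
have [Cb Cx Cy] := supp_C1 supp_bump C1at_bump.
have Cz : Cc (fun p => enorm (pbumpx p) (pbumpy p)).
  case: Cx Cy => cx [A A0 xA] [cy [B B0 yB]]; split.
    by move=> p; apply: continuous_enorm; [exact: cx|exact: cy].
  have [D D0 hD] := bump_region_box; exists D => // p /hD/bump_out[_ -> ->].
  by rewrite /enorm expr0n addr0 sqrtr0.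
have out p : ~~ ((la - wa < p.1 < ra + wa) && (lb - wb < p.2 - m * p.1 < rb + wb)) ->
    `|da p.1| * b (Y p) = 0 /\ a p.1 * `|db (Y p)| = 0.
  rewrite negb_and => /orP[h|h].
    by rewrite /a /da; have [-> ->] := plateau_out lra wa0 h; rewrite normr0 !mul0r.
  by rewrite /b /db; have [-> ->] := plateau_out lrb wb0 h; rewrite normr0 !mulr0.
have C1 : Cc (fun p => `|da p.1| * b (Y p)).
  split; last by have [D D0 hD] := bump_region_box; exists D => // p /hD/out[].
  move=> p; have [? ? ? cda _] := C1a p; have [cb _ _ _ _] := C1b p.
  by apply: cvgM => //; apply: cvg_norm.
have C2 : Cc (fun p => a p.1 * `|db (Y p)|).
  split; last by have [D D0 hD] := bump_region_box; exists D => // p /hD/out[].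
  move=> p; have [ca _ _ _ _] := C1a p; have [_ _ _ _ cdb] := C1b p.
  by apply: cvgM => //; apply: cvg_norm.
have C3 : Cc (fun p => enorm 1 m * (a p.1 * `|db (Y p)|)).
  by apply: (@CcMl _ (cst (enorm 1 m))) => // p; exact: cvg_cst.
apply: (@le_trans _ _ (I2 (fun p => `|da p.1| * b (Y p) + enorm 1 m * (a p.1 * `|db (Y p)|)))).
  apply: I2_le => //; first exact: CcD.
  move=> p; rewrite /pbumpx /pbumpy -[a p.1 * db (Y p)]add0r.
  apply: le_trans (enormD _ _ _ _) _; apply: lerD.
    by apply: le_trans (enorm_le_abs _ _) _; rewrite normr0 addr0 normrM (ger0_norm (plateau_ge0 _ _ _)).
  rewrite mulrA -[X in enorm _ X]mulr1 enormZ normrM (ger0_norm (plateau_ge0 _ _ _))// mulrC.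
  by rewrite enorm_swap /enorm sqrrN.
rewrite I2_D//; apply: lerD.
  apply: (@I2_iterated_mul (fun x => `|da x|)) => //.
  - by move=> p; rewrite mulr_ge0 ?plateau_ge0.
  - by move=> x; apply: cvg_norm; exact: continuous_dplateau.
  - by move: lrb wb0; move=> *; lra'.
  - move=> A x A0; rewrite /= RintegralZl//; last first.
      apply: integrable_itv => y.
      apply: (@continuous_comp _ _ _ (fun y => y - m * x) b); last exact: continuous_plateau.
      by apply: cvgB; [exact: cvg_id|exact: cvg_cst].
    by apply: ler_wpM2l => //; exact: (int_plateau_le lrb wb0 (m * x) A0).
  - move=> A A0; have := int_dplateau_le lra wa0 0 A0.
    by congr (_ <= _); apply: eq_Rintegral => x _; rewrite subr0.
rewrite (_ : Rintegral _ _ _ = enorm 1 m * I2 (fun p => a p.1 * `|db (Y p)|)); last first.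
  by rewrite RintegralZl//; exact: Cc_integrable.
apply: ler_wpM2l; first exact: enorm_ge0.
rewrite mulrC; apply: (@I2_iterated_mul a) => //.
- by move=> p; rewrite mulr_ge0 ?plateau_ge0.
- exact: continuous_plateau.
- by move=> x; exact: plateau_ge0.
- move=> A x A0; rewrite /= RintegralZl//; last first.
    apply: integrable_itv => y; apply: cvg_norm.
    apply: (@continuous_comp _ _ _ (fun y => y - m * x) db); last exact: continuous_dplateau.
    by apply: cvgB; [exact: cvg_id|exact: cvg_cst].
  by apply: ler_wpM2l; [exact: plateau_ge0|exact: (int_dplateau_le lrb wb0 (m * x) A0)].
- move=> A A0; have := int_plateau_le lra wa0 0 A0.
  by congr (_ <= _); apply: eq_Rintegral => x _; rewrite subr0.
Qed.

End pbump.

End cutoff.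

Section cousin.
Context {R : realType}.

(** Compactness of a segment for properties that are additive under juxtaposition: the supremum of
    the [t] reachable from [a] cannot lie before [b], since [P] holds on all short intervals near
    it. *)
Lemma cousin (P : R -> R -> Prop) :
  (forall s m t, s < m -> m < t -> P s m -> P m t -> P s t) ->
  (forall t0, exists2 d : R, 0 < d & forall s t, t0 - d < s -> s < t -> t < t0 + d -> P s t) ->
  forall a b, a < b -> P a b.
Proof.
move=> addP locP a b ab.
pose E := [set t | a < t <= b /\ P a t].
have [d0 d00 hd0] := locP a.
pose t1 := Num.min b (a + d0 / 2).
have at1 : a < t1 by rewrite lt_min ab/= ltrDl divr_gt0.
have t1b : t1 <= b by rewrite ge_min lexx.
have t1d : t1 < a + d0.
  by apply: (@le_lt_trans _ _ (a + d0 / 2)); [rewrite ge_min lexx orbT|lra'].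
have Et1 : E t1.
  split; first by rewrite at1.
  by apply: hd0 => //; rewrite ltrBlDr ltrDl.
have sE : has_sup E by split; [exists t1|exists b => t [/andP[]]].
pose T := sup E.
have t1T : t1 <= T by apply: ub_le_sup => //; case: sE.
have Tb : T <= b by apply: ge_sup; [exists t1|move=> t [/andP[]]].
have [d d_gt0 hd] := locP T.
have [t [/andP[at_ tb] Pat] Tt] : exists2 t, E t & T - d < t by apply: sup_adherent.
have tT : t <= T by apply: ub_le_sup; [case: sE|split => //; rewrite at_].
have ext u : t < u -> u <= b -> u < T + d -> P a u.
  by move=> tu ub uT; apply: (addP _ t) => //; exact: hd.
have [Tb'|bT] := ltP T b.
  pose u := Num.min b (T + d / 2).
  have Tu : T < u by rewrite lt_min Tb'/= ltrDl divr_gt0.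
  have ub : u <= b by rewrite ge_min lexx.
  have ud : u < T + d.
    by apply: (@le_lt_trans _ _ (T + d / 2)); [rewrite ge_min lexx orbT|lra'].
  have : u <= T.
    apply: ub_le_sup; first by case: sE.
    by split; [rewrite ub andbT (lt_trans _ Tu)// (lt_le_trans at1)|apply: ext => //; exact: le_lt_trans Tu].
  by rewrite leNgt Tu.
have [tb'|bt] := ltP t b; last by rewrite (_ : b = t) //; apply/le_anti; rewrite bt tb.
by apply: ext => //; rewrite (le_lt_trans bT)// ltrDl.
Qed.

End cousin.

(** * Cutoffs along a C^1 curve *)

Section curve.
Context {R : realType}.
Implicit Types (w g : R * R -> R) (p : R * R).

(** The symmetry that lets the tangent be taken of slope at most 1 in absolute value. *)
Lemma cutoff_swap w g Z k : Cc w -> Cc g ->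
  cutoff (fun p => w (p.2, p.1)) (fun p => g (p.2, p.1)) [set p | Z (p.2, p.1)] k ->
  cutoff w g Z k.
Proof.
move=> cw cg [f [fx [fy [df f01 fZ fk]]]].
pose sw p : R * R := (p.2, p.1).
have dfs p : C1at p (f \o sw) (fy \o sw) (fx \o sw) by apply: C1at_swap; exact: df.
exists (f \o sw), (fy \o sw), (fx \o sw); split => //.
- by move=> p; exact: f01.
- move=> p Zp; have h : \forall q \near sw p, f q = 0 by apply: fZ; rewrite /= -surjective_pairing.
  have : sw @ p --> sw p by apply: continuous_at_pair; [exact: cvg_snd|exact: cvg_fst].
  by move/(_ _ h).
rewrite -I2_swap; last exact: Cc_cutoff.
apply: le_trans fk; rewrite le_eqVlt; apply/orP; left; apply/eqP.
by apply: eq_Rintegral => -[x y] _ /=; rewrite enorm_swap.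
Qed.

Section local.
Variables (w g : R * R -> R) (c1 c2 d1 d2 : R -> R).
Hypotheses (cw : Cc w) (cg : Cc g) (w_ge0 : forall p, 0 <= w p) (g_ge0 : forall p, 0 <= g p).
Hypotheses (dc1 : forall t : R, is_derive t 1 c1 (d1 t)) (dc2 : forall t : R, is_derive t 1 c2 (d2 t)).
Hypotheses (cd1 : continuous d1) (cd2 : continuous d2).

Let cc1 : continuous c1.
Proof. by move=> x; apply/differentiable_continuous/derivable1_diffP; case: (dc1 x). Qed.
Let cc2 : continuous c2.
Proof. by move=> x; apply/differentiable_continuous/derivable1_diffP; case: (dc2 x). Qed.

Definition speed t := w (c1 t, c2 t) * enorm (d1 t) (d2 t).

Lemma continuous_speed : continuous speed.
Proof.
move=> t; apply: cvgM.
  by apply: continuous_comp2; [exact: cc1|exact: cc2|case: cw => + _; apply].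
by apply: continuous_enorm; [exact: cd1|exact: cd2].
Qed.

Lemma mean_slope (c d : R -> R) (s t v e : R) : (forall t : R, is_derive t 1 c (d t)) ->
  s <= t -> (forall u, s <= u <= t -> `|d u - v| <= e) ->
  exists2 D, `|D - v| <= e & c t = c s + D * (t - s).
Proof.
move=> dc st hd.
have [|u] := MVT_segment st (fun x _ => dc x).
  by apply: continuous_subspaceT => x; apply/differentiable_continuous/derivable1_diffP; case: (dc x).
rewrite in_itv/= => sut E; exists (d u); first exact: hd.
by rewrite -E addrCA subrr addr0.
Qed.

End local.

(* The cutoff is 1 minus a bump on a thin parallelogram around the arc; its two
   long sides are what makes the weighted length appear twice. *)
Lemma cutoff_estimate w g (c1 c2 d1 d2 : R -> R) (s t v1 v2 m e w0 G : R)
    (h := t - s) (V := enorm v1 v2) :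
  Cc w -> Cc g -> (forall p, 0 <= w p) -> (forall p, 0 <= g p) ->
  (forall t : R, is_derive t 1 c1 (d1 t)) -> (forall t : R, is_derive t 1 c2 (d2 t)) ->
  continuous d1 -> continuous d2 ->
  s < t -> h <= 1 -> 0 < e -> e <= 1 -> 0 <= w0 -> `|m| <= 1 -> v2 = m * v1 ->
  (forall u, s <= u <= t -> `|d1 u - v1| <= e) ->
  (forall u, s <= u <= t -> `|d2 u - v2| <= e) ->
  (forall u, s <= u <= t -> w0 * V - e <= speed w c1 c2 d1 d2 u) ->
  (forall p, `|p.1 - c1 s| <= h * (`|v1| + 4 * e) ->
     `|p.2 - c2 s| <= h * (`|v1| + 9 * e) -> w p <= w0 + e) ->
  (forall p, g p <= G) ->
  cutoff w g [set (c1 u, c2 u) | u in `[s, t]]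
  (2 * \int[mu]_(u in `[s, t]) speed w c1 c2 d1 d2 u +
   e * (2 * V + 52 * w0 + 54 + 10 * G * (V + 8)) * (t - s)).
Proof.
move=> cw cg w_ge0 g_ge0 dc1 dc2 cd1 cd2 st h1 e0 e1 w00 m1 v2E hd1 hd2 hsp hw hG.
(* [An] and [Ap] are the negative and positive parts of [v1]: whatever its sign, the first
   coordinate of the tangent segment runs over the interval from [c1 s - h * An] to
   [c1 s + h * Ap]. *)
pose An := (`|v1| - v1) / 2.
pose Ap := (`|v1| + v1) / 2.
(* Margins in units of [e * h]. The arc strays from the tangent segment by at most 1 in x and 2 in y
   - m x; adding 1 for the half-width of the transition and 1 to spare, so that the bump is 1 on a
   neighbourhood of the arc, gives 3 and 4. *)
pose la := c1 s - h * An - 3 * (e * h).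
pose ra := c1 s + h * Ap + 3 * (e * h).
pose lb := c2 s - m * c1 s - 4 * (e * h).
pose rb := c2 s - m * c1 s + 4 * (e * h).
pose wd := e * h.
have h0 : 0 < h by rewrite subr_gt0.
have wd0 : 0 < wd by rewrite mulr_gt0.
have An0 : 0 <= An by rewrite divr_ge0// subr_ge0 ler_norm.
have Ap0 : 0 <= Ap by rewrite divr_ge0//; have := ler_norm (- v1); rewrite normrN; move; lra_clear.
have v1E : v1 = Ap - An by rewrite /An /Ap; clear; lra.
have nv1E : `|v1| = Ap + An by rewrite /An /Ap; clear; lra.
have hAn : 0 <= h * An by rewrite mulr_ge0// ltW.
have hAp : 0 <= h * Ap by rewrite mulr_ge0// ltW.
have lara : la <= ra by rewrite /la /ra; move: wd0 hAn hAp; rewrite /wd ; lra_clear.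
have lbrb : lb <= rb by rewrite /lb /rb; move: wd0; rewrite /wd ; lra_clear.
have G0 : 0 <= G by exact: le_trans (g_ge0 (0, 0)) (hG _).
have V0 : 0 <= V by exact: enorm_ge0.
have v1V : `|v1| <= V by exact: abs_le_enorm.
have N2 : enorm 1 m <= 2.
  by apply: le_trans (enorm_le_abs _ _) _; rewrite normr1; move: m1 ; lra_clear.
(* The sides of slope [m] have length about [h * V], the length of the tangent segment; this
   equality makes the estimate sharp to first order. *)
have VE : enorm 1 m * `|v1| = V.
  by rewrite /V v2E -[X in _ = enorm X _]mulr1 [m * v1]mulrC enormZ mulrC.
pose B := pbump la ra wd lb rb wd m; pose Bx := pbumpx la ra wd lb rb wd m.
pose By := pbumpy la ra wd lb rb wd m.
have dB p : C1at p B Bx By by exact: C1at_bump.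
have [CB CBx CBy] := supp_C1 (supp_bump m lara wd0 lbrb wd0) dB.
(* On the support of the bump the x-margin is 3 + 1 = 4 and the margin in y - m x is 4 + 1 = 5; as
   [m] is at most 1 in absolute value, y has margin 4 + 5 = 9. *)
have region p : [&& la - wd < p.1 < ra + wd, lb - wd < p.2 - m * p.1 & p.2 - m * p.1 < rb + wd] ->
    w p <= w0 + e.
  move=> /andP[/andP[p1 p2] /andP[p3 p4]].
  have px : `|p.1 - c1 s| <= h * (`|v1| + 4 * e).
    rewrite ler_norml nv1E mulrDr mulrDr; apply/andP; split;
      move: p1 p2 hAn hAp; rewrite /la /ra /wd ; lra_clear.
  apply: hw => //.
  have -> : p.2 - c2 s = (p.2 - m * p.1 - (c2 s - m * c1 s)) + m * (p.1 - c1 s) by ring.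
  apply: le_trans (ler_normD _ _) _.
  have -> : h * (`|v1| + 9 * e) = 5 * wd + h * (`|v1| + 4 * e) by rewrite /wd; ring.
  apply: lerD.
    by rewrite ler_norml; apply/andP; split; move: p3 p4; rewrite /lb /rb /wd ; lra_clear.
  rewrite normrM -[leRHS]mul1r; apply: ler_pM => //.
exists (fun p => 1 - B p), (fun p => - Bx p), (fun p => - By p); split.
- move=> p; have := C1atB (C1at_cst p 1) (dB p).
  by apply: eq_C1at => // q; rewrite [cst 0 q]/= sub0r.
- move=> p; have /andP[b0 b1] := bump_itv m lara wd0 lbrb wd0 p.
  by rewrite subr_ge0 b1 lerBlDr lerDl.
- move=> p [u /=]; rewrite in_itv/= => /andP[su ut] <-.
  have th0 : 0 <= u - s by rewrite subr_ge0.
  have thh : 0 <= h - (u - s) by rewrite /h; move: ut ; lra_clear.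
  have sub x : s <= x <= u -> s <= x <= t by move=> /andP[-> xu]; rewrite (le_trans xu).
  have [D1 hD1 E1] := mean_slope dc1 su (fun x hx => hd1 x (sub x hx)).
  have [D2 hD2 E2] := mean_slope dc2 su (fun x hx => hd2 x (sub x hx)).
  have DD : `|D2 - m * D1| <= 2 * e.
    have -> : D2 - m * D1 = (D2 - v2) - m * (D1 - v1) by rewrite v2E; ring.
    apply: le_trans (ler_normB _ _) _; rewrite mulr2n mulrDl mul1r; apply: lerD => //.
    rewrite normrM -[leRHS]mul1r; exact: ler_pM.
  have x1 : la + wd < c1 u.
    move: hD1; rewrite ler_norml => /andP[hD _].
    have k1 : 0 <= (D1 + An + e) * (u - s).
      by rewrite mulr_ge0//; move: hD Ap0; rewrite v1E ; lra_clear.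
    have k2 : 0 <= (An + e) * (h - (u - s)) by rewrite mulr_ge0// addr_ge0// ltW.
    by rewrite E1 /la; move: k1 k2 wd0; rewrite /wd ; lra_clear.
  have x2 : c1 u < ra - wd.
    move: hD1; rewrite ler_norml => /andP[_ hD].
    have k1 : 0 <= (Ap + e - D1) * (u - s).
      by rewrite mulr_ge0//; move: hD An0; rewrite v1E ; lra_clear.
    have k2 : 0 <= (Ap + e) * (h - (u - s)) by rewrite mulr_ge0// addr_ge0// ltW.
    by rewrite E1 /ra; move: k1 k2 wd0; rewrite /wd ; lra_clear.
  move: DD; rewrite ler_norml => /andP[DD1 DD2].
  have k3 : 0 <= e * (h - (u - s)) by rewrite mulr_ge0// ltW.
  have y1 : lb + wd < c2 u - m * c1 u.
    have k1 : 0 <= (D2 - m * D1 + 2 * e) * (u - s).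
      by rewrite mulr_ge0//; move: DD1 ; lra_clear.
    by rewrite E1 E2 /lb; move: k1 k3 wd0; rewrite /wd ; lra_clear.
  have y2 : c2 u - m * c1 u < rb - wd.
    have k1 : 0 <= (2 * e - (D2 - m * D1)) * (u - s).
      by rewrite mulr_ge0//; move: DD2 ; lra_clear.
    by rewrite E1 E2 /rb; move: k1 k3 wd0; rewrite /wd ; lra_clear.
  have [cY _ _ _ _] := C1atB (C1at_snd (c1 u, c2 u)) (C1atM (C1at_cst (c1 u, c2 u) m) (C1at_fst (c1 u, c2 u))).
  have cx : fst @ (c1 u, c2 u) --> c1 u by exact: cvg_fst.
  near=> q; rewrite /B bump1 ?subrr//; apply/andP; split; apply: ltW; near: q.
  + exact: (cvgr_gt _ cx).
  + exact: (cvgr_lt _ cx).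
  + exact: (cvgr_gt _ cY).
  + exact: (cvgr_lt _ cY).
have Cz : Cc (fun p => enorm (Bx p) (By p)).
  case: CBx CBy => cx [A A0 xA] [cy [D D0 yD]]; split.
    by move=> p; apply: continuous_enorm; [exact: cx|exact: cy].
  exists (Num.max A D); first by rewrite lt_max A0.
  move=> p np; rewrite xA ?yD ?/enorm ?expr0n ?addr0 ?sqrtr0// => -[q1 q2]; apply: np;
    by split; rewrite le_max ?q1 ?q2 ?orbT.
have Cz' : Cc (fun p => (w0 + e) * enorm (Bx p) (By p)).
  by apply: (@CcMl _ (cst (w0 + e))) => // p; exact: cvg_cst.
have CB' : Cc (fun p => G * B p) by apply: (@CcMl _ (cst G)) => // p; exact: cvg_cst.
(* On the support of the bump [w] is at most [w0 + e], and [g] is at most [G]; off it the bump and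
   its gradient vanish. *)
apply: (@le_trans _ _ (I2 (fun p => (w0 + e) * enorm (Bx p) (By p) + G * B p))).
  apply: I2_le; last 2 first.
  - exact: CcD.
  - move=> p; have /andP[b0 b1] := bump_itv m lara wd0 lbrb wd0 p.
    apply: lerD; last by rewrite opprB addrC subrK mulrC ler_wpM2r.
    have [/region wp|h0'] := boolP [&& la - wd < p.1 < ra + wd, lb - wd < p.2 - m * p.1 & p.2 - m * p.1 < rb + wd].
      by rewrite /enorm !sqrrN mulrC ler_wpM2r// enorm_ge0.
    have [_ bx by_] := bump_out lara wd0 lbrb wd0 h0'.
    by rewrite /Bx /By bx by_ /enorm !sqrrN expr0n addr0 sqrtr0 mul0r mulr0.
  - apply: (@Cc_cutoff _ w g (fun p => 1 - B p) (fun p => - Bx p) (fun p => - By p) cw cg).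
    move=> p; have := C1atB (C1at_cst p 1) (dB p).
    by apply: eq_C1at => // q; rewrite [cst 0 q]/= sub0r.
rewrite I2_D// RintegralZl//; last exact: Cc_integrable.
rewrite RintegralZl//; last exact: Cc_integrable.
have gB := I2_bump m lara wd0 lbrb wd0; have gG := I2_bump_grad m lara wd0 lbrb wd0.
have raE : ra - la + 2 * wd = h * `|v1| + 8 * wd by rewrite /ra /la nv1E /wd; ring.
have rbE : rb - lb + 2 * wd = 10 * wd by rewrite /rb /lb /wd; ring.
rewrite raE rbE in gB gG.
(* 52 = 20 + 2 * 16: the vertical sides give 20, and the excess 16 of the slanted sides is weighted
   by [enorm 1 m], which is at most 2. *)
have {}gG : I2 (fun p => enorm (Bx p) (By p)) <= 2 * h * V + 52 * wd.
  apply: le_trans gG _.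
  have -> : 2 * (10 * wd) + enorm 1 m * (2 * (h * `|v1| + 8 * wd)) =
    20 * wd + 2 * h * (enorm 1 m * `|v1|) + 16 * (enorm 1 m * wd) by ring.
  rewrite VE; have : enorm 1 m * wd <= 2 * wd by rewrite ler_wpM2r// ltW.
  by move; lra_clear.
have {}gB : I2 B <= h * (V + 8) * (10 * e).
  apply: le_trans gB _; rewrite /wd.
  have -> : (h * `|v1| + 8 * (e * h)) * (10 * (e * h)) = h * (`|v1| + 8 * e) * (10 * e * h) by ring.
  apply: ler_pM.
  - by apply: mulr_ge0; [exact: ltW|rewrite addr_ge0// mulr_ge0// ltW].
  - by apply: mulr_ge0; [rewrite mulr_ge0// ltW|exact: ltW].
  - by rewrite ler_wpM2l ?(ltW h0)//; move: v1V e1 ; lra_clear.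
  - by rewrite -[leRHS]mulr1 ler_wpM2l// mulr_ge0// (ltW e0).
have {}gG := ler_wpM2l (addr_ge0 w00 (ltW e0)) gG.
have {}gB := ler_wpM2l G0 gB.
apply: le_trans (lerD gG gB) _.
have cs := continuous_speed cw dc1 dc2 cd1 cd2.
have lowI : h * (w0 * V - e) <= \int[mu]_(u in `[s, t]) speed w c1 c2 d1 d2 u.
  apply: (@le_trans _ _ (\int[mu]_(u in `[s, t]) (w0 * V - e))).
    have mst : lebesgue_measure (`[s, t]%classic : set R) = h%:E.
      by rewrite lebesgue_measure_itv/= lte_fin st.
    by rewrite Rintegral_cst// [X in _ * fine X]mst mulrC.
  apply: le_Rintegral => //.
  - by apply: integrable_itv => ?; exact: cvg_cst.
  - exact: integrable_itv.
(* The constant 54 of the statement is 2 + 52: the 2 pays for replacing [w0 * V] by the speed in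
   [lowI], the 52 for this bound on the term in [e ^+ 2]. *)
have hh : e ^+ 2 * h <= e * h by rewrite ler_wpM2r ?(ltW h0)// expr2 ler_piMl// ltW.
have -> : (w0 + e) * (2 * h * V + 52 * wd) + G * (h * (V + 8) * (10 * e)) =
  2 * (h * (w0 * V - e)) + h * (e * (2 * V + 52 * w0 + 2 + 10 * G * (V + 8))) + 52 * (e ^+ 2 * h).
  by rewrite /wd; ring.
have -> : e * (2 * V + 52 * w0 + 54 + 10 * G * (V + 8)) * (t - s) = h * (e * (2 * V + 52 * w0 + 2 + 10 * G * (V + 8))) + 52 * (e * h).
  by rewrite -/h; ring.
set I := Rintegral _ _ _ in lowI *; move: lowI hh.
by move: I (h) (V); lra_clear.
Unshelve. all: by end_near. Qed.

Lemma cutoff_local_slope w g (c1 c2 d1 d2 : R -> R) :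
  Cc w -> Cc g -> (forall p, 0 <= w p) -> (forall p, 0 <= g p) ->
  (forall t : R, is_derive t 1 c1 (d1 t)) -> (forall t : R, is_derive t 1 c2 (d2 t)) ->
  continuous d1 -> continuous d2 ->
  forall (t0 eta : R), 0 < eta -> `|d2 t0| <= `|d1 t0| ->
  exists2 d : R, 0 < d & forall s t, t0 - d < s -> s < t -> t < t0 + d ->
    cutoff w g [set (c1 u, c2 u) | u in `[s, t]]
      (2 * \int[mu]_(u in `[s, t]) speed w c1 c2 d1 d2 u + eta * (t - s)).
Proof.
move=> cw cg w0 g0 dc1 dc2 cd1 cd2 t0 eta eta0 d21.
have cc1 : continuous c1.
  by move=> x; apply/differentiable_continuous/derivable1_diffP; case: (dc1 x).
have cc2 : continuous c2.
  by move=> x; apply/differentiable_continuous/derivable1_diffP; case: (dc2 x).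
have [M hM] := Cc_bounded cg.
have hG p : g p <= M by apply: le_trans (ler_norm _) (hM p).
have M0 : 0 <= M by exact: le_trans (g0 (0, 0)) (hG _).
pose v1 := d1 t0; pose v2 := d2 t0; pose V := enorm v1 v2; pose m := v2 / v1.
have V0 : 0 <= V by exact: enorm_ge0.
(* When [v1] vanishes so does [v2], and [m] is then 0 because the inverse of 0 is 0. *)
have v2E : v2 = m * v1.
  have [z|nz] := eqVneq v1 0; last by rewrite /m divfK.
  by move: d21; rewrite -/v1 -/v2 z normr0 normr_le0 mulr0 => /eqP.
have m1 : `|m| <= 1.
  have [z|nz] := eqVneq v1 0; first by rewrite /m z invr0 mulr0 normr0.
  by rewrite normrM normfV ler_pdivrMr ?normr_gt0// mul1r.
pose W := w (c1 t0, c2 t0).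
have W0 : 0 <= W by exact: w0.
(* [K] is the coefficient of [e] in [cutoff_estimate], and [e] is chosen so that [e * K <= eta]. *)
pose K := 2 * V + 52 * W + 54 + 10 * M * (V + 8).
have K0 : 0 < K.
  by rewrite /K ltr_pwDl// ?mulr_ge0 ?addr_ge0 ?mulr_ge0// ltr_wpDl// addr_ge0// mulr_ge0.
pose e := Num.min 1 (eta / K).
have e0 : 0 < e by rewrite lt_min ltr01 divr_gt0.
have e1 : e <= 1 by rewrite ge_min lexx.
have eK : e * K <= eta by rewrite -ler_pdivlMr// ge_min lexx orbT.
have [r /= r0 hr] : exists2 r : R, 0 < r & forall p, `|p.1 - c1 t0| < r -> `|p.2 - c2 t0| < r -> w p <= W + e.
  have : \forall p \near (c1 t0, c2 t0), w p <= W + e.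
    have cwt : w p @[p --> (c1 t0, c2 t0)] --> W by case: cw => + _; apply.
    by apply: (cvgr_le W cwt); rewrite ltrDl.
  move=> /nbhs_ballP[r /= r0 hr]; exists r => // p p1 p2; apply: hr.
  by split; rewrite /ball/= distrC.
have near1 : \forall u \near t0, [/\ `|d1 u - v1| <= e, `|d2 u - v2| <= e,
    W * V - e <= speed w c1 c2 d1 d2 u, `|c1 u - c1 t0| < r / 2 & `|c2 u - c2 t0| < r / 2].
  have r20 : 0 < r / 2 by rewrite divr_gt0.
  have csp : {for t0, continuous (speed w c1 c2 d1 d2)} by exact: continuous_speed.
  near=> u; split; near: u.
  - by apply: (@cvgr_distC_le _ _ _ _ _ d1 v1 (cd1 t0)).
  - by apply: (@cvgr_distC_le _ _ _ _ _ d2 v2 (cd2 t0)).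
  - by apply: (cvgr_ge _ csp); rewrite ltrBlDr ltrDl.
  - by apply: (@cvgr_distC_lt _ _ _ _ _ c1 _ (cc1 t0)).
  - by apply: (@cvgr_distC_lt _ _ _ _ _ c2 _ (cc2 t0)).
have [d /= d0 hd] := (nbhs_ballP _ _).1 near1.
pose L := 4 * (`|v1| + 9 * e).
have L0 : 0 < L by rewrite mulr_gt0// ltr_wpDl// mulr_gt0.
(* The bound [d] keeps the velocity and the speed close to their values at [t0], the bound 1/2 makes
   [t - s] at most 1, and the last one keeps the parallelogram where [w] is at most [W + e]. *)
exists (Num.min d (Num.min (1 / 2) (r / (2 * L)))).
  by rewrite !lt_min d0 !divr_gt0// mulr_gt0.
move=> s t; set D := Num.min _ _ => sD st tD.
have Dd : D <= d by rewrite ge_min lexx.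
have D2 : D <= 1 / 2 by rewrite !ge_min lexx orbT.
have DL : D * L <= r / 2.
  have : D <= r / (2 * L) by rewrite !ge_min lexx !orbT.
  rewrite ler_pdivlMr; last exact: mulr_gt0.
  by rewrite ler_pdivlMr// -mulrA [L * 2]mulrC.
clearbody D.
have inb u : s <= u <= t -> ball t0 d u.
  move=> /andP[su ut]; rewrite /ball/= ltr_norml; apply/andP; split.
    by move: tD ut Dd; lra_clear.
  by move: sD su Dd; lra_clear.
have inn u (h : s <= u <= t) := hd u (inb u h).
have ss : s <= s <= t by rewrite lexx ltW.
have hL : (t - s) * (`|v1| + 9 * e) < r / 2.
  apply: lt_le_trans DL; rewrite /L mulrA ltr_pM2r; first by move: sD tD st; lra_clear.
  by rewrite ltr_wpDl// mulr_gt0.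
have [_ _ _ s1 s2] := inn s ss.
apply: (@cutoff_subset _ _ _ _ _ _ _ (fun _ h => h)); last first.
  apply: (@cutoff_estimate w g c1 c2 d1 d2 s t v1 v2 m e W M) => //.
  - by move: sD tD D2; lra_clear.
  - by move=> u /inn[].
  - by move=> u /inn[].
  - by move=> u /inn[].
  - move=> p p1 p2; apply: hr.
      rewrite -(subrK (c1 s) p.1) -addrA; apply: le_lt_trans (ler_normD _ _) _.
      have : (t - s) * (`|v1| + 4 * e) <= (t - s) * (`|v1| + 9 * e).
        by rewrite ler_pM2l ?subr_gt0// lerD2l ler_pM2r// ler_nat.
      by move: p1 s1 hL; lra_clear.
    rewrite -(subrK (c2 s) p.2) -addrA; apply: le_lt_trans (ler_normD _ _) _.
    by move: p2 s2 hL; lra_clear.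
by rewrite lerD2l ler_wpM2r// subr_ge0 ltW.
Unshelve. all: by end_near. Qed.

Lemma cutoff_local w g (c1 c2 d1 d2 : R -> R) :
  Cc w -> Cc g -> (forall p, 0 <= w p) -> (forall p, 0 <= g p) ->
  (forall t : R, is_derive t 1 c1 (d1 t)) -> (forall t : R, is_derive t 1 c2 (d2 t)) ->
  continuous d1 -> continuous d2 ->
  forall (t0 eta : R), 0 < eta ->
  exists2 d : R, 0 < d & forall s t, t0 - d < s -> s < t -> t < t0 + d ->
    cutoff w g [set (c1 u, c2 u) | u in `[s, t]]
      (2 * \int[mu]_(u in `[s, t]) speed w c1 c2 d1 d2 u + eta * (t - s)).
Proof.
move=> cw cg w0 g0 dc1 dc2 cd1 cd2 t0 eta eta0.
have [d21|/ltW d12] := leP `|d2 t0| `|d1 t0|; first exact: cutoff_local_slope.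
pose ws p := w (p.2, p.1); pose gs p := g (p.2, p.1).
have Cs h : Cc h -> Cc (fun p : R * R => h (p.2, p.1)).
  move=> [ch [A A0 hA]]; split; last first.
    by exists A => // p np; apply: hA => -[h1 h2]; apply: np; split.
  by move=> p; apply: continuous_comp2; [exact: cvg_snd|exact: cvg_fst|exact: ch].
have [d d0 hd] := @cutoff_local_slope ws gs c2 c1 d2 d1 (Cs _ cw) (Cs _ cg)
  (fun p => w0 _) (fun p => g0 _) dc2 dc1 cd2 cd1 t0 eta eta0 d12.
exists d => // s t h1 h2 h3; apply: cutoff_swap => //.
have := hd s t h1 h2 h3; apply: cutoff_subset.
  by move=> [x y] [u hu [<- <-]]; exists u.
rewrite le_eqVlt; apply/orP; left; apply/eqP; congr (_ * _ + _).
by apply: eq_Rintegral => u _; rewrite /speed /ws /= enorm_swap.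
Qed.

Lemma Rintegral_itvD (f : R -> R) (s m t : R) : continuous f -> s <= m -> m <= t ->
  \int[mu]_(u in `[s, t]) f u = \int[mu]_(u in `[s, m]) f u + \int[mu]_(u in `[m, t]) f u.
Proof.
move=> cf sm mt.
have := @Rintegral_itvB _ f (BLeft s) (BRight t) m (@integrable_itv _ f s t cf).
rewrite !bnd_simp => /(_ sm mt) E.
rewrite -(Rintegral_itv_obnd_cbnd (r := m) (b := BRight t)); last first.
  by apply: integrableS (integrable_itv m t cf) => //; exact: subset_itv_oc_cc.
by rewrite -E addrC subrK.
Qed.

(** The allowed error [eta * (t - s)] is proportional to the parameter length, so the whole bound is
    additive in the interval and [cousin] applies. *)
Lemma cutoff_curve w g (c1 c2 d1 d2 : R -> R) :
  Cc w -> Cc g -> (forall p, 0 <= w p) -> (forall p, 0 <= g p) ->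
  (forall t : R, is_derive t 1 c1 (d1 t)) -> (forall t : R, is_derive t 1 c2 (d2 t)) ->
  continuous d1 -> continuous d2 -> forall eta : R, 0 < eta ->
  cutoff w g [set (c1 u, c2 u) | u in `[0, 1]]
      (2 * \int[mu]_(u in `[0, 1]) speed w c1 c2 d1 d2 u + eta).
Proof.
move=> cw cg w0 g0 dc1 dc2 cd1 cd2 eta eta0.
have csp : continuous (speed w c1 c2 d1 d2) by exact: continuous_speed.
have E : eta = eta * (1 - 0) by rewrite subr0 mulr1.
rewrite [X in _ + X]E.
apply: (@cousin _ (fun s t => cutoff w g [set (c1 u, c2 u) | u in `[s, t]]
      (2 * \int[mu]_(u in `[s, t]) speed w c1 c2 d1 d2 u + eta * (t - s)))) => //.
  move=> s m t sm mt hs ht.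
  have := cutoffU cw cg w0 g0 hs ht; apply: cutoff_subset.
    move=> p [u /=]; rewrite in_itv/= => /andP[su ut] <-.
    by have [um|mu'] := leP u m; [left|right]; exists u => //; rewrite /= in_itv/= ?su ?um ?ut ?ltW.
  rewrite (Rintegral_itvD csp (ltW sm) (ltW mt)) le_eqVlt; apply/orP; left; apply/eqP.
  ring.
by move=> t0; exact: cutoff_local.
Qed.

End curve.

(** * The divergence inequality on regular domains *)

Section green.
Context {R : realType}.
Implicit Types (w g : R * R -> R) (p : R * R).

(** Compactness as an induction principle. If [Q K] failed, the sets [A] such that [Q] holds for [K]
    minus [A] would form a proper filter containing [K]; a cluster point in [K] contradicts the
    local hypothesis. *)
Lemma compact_union (T : topologicalType) (K : set T) (Q : set T -> Prop) :
  compact K -> Q set0 -> (forall A B, A `<=` B -> Q B -> Q A) ->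
  (forall A B, Q A -> Q B -> Q (A `|` B)) ->
  (forall x, K x -> exists2 U, nbhs x U & Q U) -> Q K.
Proof.
move=> cK Q0 QS QU Qloc; apply: contrapT => nQ.
pose F : set_system T := [set A | Q (K `\` A)].
have FF : ProperFilter F.
  apply: Build_ProperFilter_ex.
    move=> A FA; apply: contrapT => nA; apply: nQ; apply: QS FA => x Kx; split => // Ax.
    by apply: nA; exists x.
  split; first by rewrite /F /= setDT.
    by move=> A B FA FB; rewrite /F /= setDIr; exact: QU.
  by move=> A B AB; apply: QS => x [Kx nB]; split => // /AB.
have FK : F K by rewrite /F /= setDv.
have [p [Kp clp]] := cK F FF FK.
have [U Up QUU] := Qloc p Kp.
have [x [nx Ux]] : ~` U `&` U !=set0.
  by apply: clp => //; rewrite /F /=; apply: QS QUU => x [_ /contrapT].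
by [].
Qed.

Lemma near_zero_deriv (f : R * R -> R) p v (d : R * R -> R) :
  (forall q, is_derive q v f (d q)) -> (\forall q \near p, f q = 0) -> \forall q \near p, d q = 0.
Proof.
move=> df /nbhs_interior; apply: filterS => q fq.
have [_ <-] := df q; rewrite (@near_eq_derive _ _ _ f (cst 0)) ?derive_cst//.
Qed.

(** Vanishing near every point off [Om] lets [z] times a field be extended by 0, whatever values the
    field takes outside [Om]. *)
Definition plateau_on (Om Z : set (R * R)) := exists z zx zy : R * R -> R,
  [/\ forall p, C1at p z zx zy, supp_box z, forall p, Z p -> z p = 1
    & forall p, ~ Om p -> \forall q \near p, z q = 0].

(** The function is 1 - (1 - z) (1 - y), which is 1 as soon as one factor is. *)
Lemma plateau_onU Om A B : plateau_on Om A -> plateau_on Om B -> plateau_on Om (A `|` B).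
Proof.
move=> [z [zx [zy [dz [a a0 sz] zA zO]]]] [y [yx [yy [dy [b b0 sy] yB yO]]]].
exists (fun p => z p + y p - z p * y p), (fun p => zx p + yx p - (zx p * y p + z p * yx p)),
  (fun p => zy p + yy p - (zy p * y p + z p * yy p)); split.
- by move=> p; apply: C1atB; [exact: C1atD|exact: C1atM].
- exists (Num.max a b); first by rewrite lt_max a0.
  by move=> p np; rewrite sz ?sy ?mul0r ?addr0 ?subr0// => -[h1 h2]; apply: np; split;
    by rewrite le_max ?h1 ?h2 ?orbT.
- by move=> p [/zA|/yB] ->; ring.
- move=> p np; have h1 := zO p np; have h2 := yO p np.
  near=> q; rewrite (near h1 q) ?(near h2 q) ?mul0r ?addr0 ?subr0//; by near: q.
Unshelve. all: by end_near. Qed.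

Lemma plateau_on_local Om p : open Om -> Om p -> exists2 U, nbhs p U & plateau_on Om U.
Proof.
move=> oO Op; have /nbhs_ballP[r /= r0 hr] : nbhs p Om by apply: open_nbhs_nbhs.
(* The bump is 1 within [2 * d] of [p] and vanishes beyond [4 * d]. A point off [Om] is at distance
   at least [8 * d], so its ball of radius [d] misses the support. *)
pose d := r / 8; have d0 : 0 < d by rewrite divr_gt0.
exists (ball p d); first exact: nbhsx_ballx.
have h1 : p.1 - 3 * d <= p.1 + 3 * d by move: d0; lra_clear.
have h2 : p.2 - 3 * d <= p.2 + 3 * d by move: d0; lra_clear.
exists (pbump (p.1 - 3 * d) (p.1 + 3 * d) d (p.2 - 3 * d) (p.2 + 3 * d) d 0),
  (pbumpx (p.1 - 3 * d) (p.1 + 3 * d) d (p.2 - 3 * d) (p.2 + 3 * d) d 0),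
  (pbumpy (p.1 - 3 * d) (p.1 + 3 * d) d (p.2 - 3 * d) (p.2 + 3 * d) d 0); split.
- by move=> q; exact: C1at_bump.
- exact: supp_bump.
- move=> q []; rewrite /ball/= !ltr_norml => /andP[q1 q2] /andP[q3 q4].
  apply: bump1 => //; rewrite ?mul0r ?subr0; apply/andP; split;
    by move: q1 q2 q3 q4 d0; lra_clear.
- move=> q nq; near=> x.
  suff /(bump_out h1 d0 h2 d0)[] : ~~ [&& p.1 - 3 * d - d < x.1 < p.1 + 3 * d + d,
    p.2 - 3 * d - d < x.2 - 0 * x.1 & x.2 - 0 * x.1 < p.2 + 3 * d + d] by [].
  apply/negP => /andP[/andP[x1 x2] /andP[]]; rewrite mul0r subr0 => x3 x4.
  have : ball q d x by near: x; exact: nbhsx_ballx.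
  move=> []; rewrite /ball/= !ltr_norml => /andP[q1 q2] /andP[q3 q4].
  apply: nq; apply: hr; split; rewrite /ball/= ltr_norml; apply/andP; split;
    by move: x1 x2 x3 x4 q1 q2 q3 q4 r0; rewrite /d; lra_clear.
Unshelve. all: by end_near. Qed.

Lemma plateau_on_compact Om K : open Om -> compact K -> K `<=` Om -> plateau_on Om K.
Proof.
move=> oO cK KO; apply: compact_union => //.
- exists (cst 0), (cst 0), (cst 0); split => //; first by move=> p; exact: C1at_cst.
    by exists 1.
  by move=> p _; near=> q.
- move=> A B AB [z [zx [zy [? ? zB ?]]]]; exists z, zx, zy; split => //.
  by move=> p /AB/zB.
- exact: plateau_onU.
- by move=> p /KO; exact: plateau_on_local.
Unshelve. all: by end_near. Qed.

Lemma C1at_plateauM Om z zx zy P Px Py p : (forall p, C1at p z zx zy) ->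
  (forall p, ~ Om p -> \forall q \near p, z q = 0) ->
  (forall p, Om p -> C1at p P Px Py) ->
  C1at p (fun q => z q * P q) (fun q => zx q * P q + z q * Px q) (fun q => zy q * P q + z q * Py q).
Proof.
move=> dz zO dP; have [Op|nOp] := pselect (Om p); first by apply: C1atM => //; exact: dP.
have h := zO p nOp; apply: near_C1at (C1at_cst p 0).
have hx : \forall q \near p, zx q = 0 by apply: (@near_zero_deriv z p (1, 0) zx _ h) => q; case: (dz q).
have hy : \forall q \near p, zy q = 0 by apply: (@near_zero_deriv z p (0, 1) zy _ h) => q; case: (dz q).
near=> q; rewrite (near h q)// (near hx q)// ?(near hy q)// ?mul0r ?addr0.
by split.
all: by near: q.
Unshelve. all: by end_near. Qed.

Lemma cutoff0 w g : Cc w -> Cc g -> cutoff w g set0 0.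
Proof.
move=> cw cg; exists (cst 1), (cst 0), (cst 0); split => //.
- by move=> p; exact: C1at_cst.
- by move=> p; rewrite /= ler01 lexx.
rewrite (@eq_Rintegral _ _ _ _ _ (cst 0)) ?Rintegral_cst ?mul0r//.
by move=> p _; rewrite /= /enorm expr0n addr0 sqrtr0 subrr !mul0r addr0.
Qed.

Lemma cutoff_bigcup w g n (Z : 'I_n -> set (R * R)) (k : 'I_n -> R) :
  Cc w -> Cc g -> (forall p, 0 <= w p) -> (forall p, 0 <= g p) ->
  (forall i, cutoff w g (Z i) (k i)) -> cutoff w g (\bigcup_i Z i) (\sum_(i < n) k i).
Proof.
move=> cw cg w0 g0; elim: n Z k => [|n IH] Z k hZ.
  rewrite big_ord0; apply: cutoff_subset (lexx 0) (cutoff0 cw cg).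
  by move=> p [[]].
rewrite big_ord_recr /=.
have := cutoffU cw cg w0 g0 (IH _ _ (fun i => hZ (widen_ord (leqnSn n) i))) (hZ ord_max).
apply: cutoff_subset => // p [i _ Zp].
have [j ji|ji] := unliftP ord_max i; last by right; rewrite -ji.
left; exists j => //; rewrite (_ : widen_ord _ _ = i)//; apply/val_inj.
by rewrite ji; apply/esym; exact: lift_max.
Qed.

Lemma is_derive_fst (V W1 W2 : normedModType R) (c : V -> W1 * W2) (t v : V) d :
  is_derive t v c d -> is_derive t v (fun s => (c s).1) d.1.
Proof.
move=> [dc <-].
have h : h^-1 *: ((c (h *: v + t)).1 - (c t).1) @[h --> (0:R)^'] --> ('D_v c t).1.
  exact: (cvg_comp _ _ dc (@cvg_fst _ _ _ _ _)).
by split; [apply/cvg_ex; exists ('D_v c t).1|exact: cvg_lim h].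
Qed.

Lemma is_derive_snd (V W1 W2 : normedModType R) (c : V -> W1 * W2) (t v : V) d :
  is_derive t v c d -> is_derive t v (fun s => (c s).2) d.2.
Proof.
move=> [dc <-].
have h : h^-1 *: ((c (h *: v + t)).2 - (c t).2) @[h --> (0:R)^'] --> ('D_v c t).2.
  exact: (cvg_comp _ _ dc (@cvg_snd _ _ _ _ _)).
by split; [apply/cvg_ex; exists ('D_v c t).2|exact: cvg_lim h].
Qed.

Lemma range_periodic (T : Type) (c : R -> T) : (forall t, c (t + 1) = c t) ->
  range c = [set c u | u in `[0, 1]].
Proof.
move=> per; apply/seteqP; split => [_ [t _ <-]|_ [t _ <-]]; last by exists t.
have pern (n : nat) t' : c (t' + n%:R) = c t'.
  by elim: n t' => [|n IH] t'; rewrite ?addr0// -natr1 addrA per.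
exists (t - (Num.floor t)%:~R).
  rewrite /= in_itv/= subr_ge0 floor_le/= lerBlDl.
  by rewrite ltW//; have := floorD1_gt t; rewrite intrD.
case: (Num.floor t) => n; first by rewrite -[in RHS](subrK n%:R t) pern.
by rewrite NegzE mulrNz opprK pern.
Qed.

Lemma cutoff_closed_curve w g (c : R -> R * R) (eta : R) : closed_curve c ->
  Cc w -> Cc g -> (forall p, 0 <= w p) -> (forall p, 0 <= g p) -> 0 < eta ->
  cutoff w g (range c)
    (2 * \int[mu]_(t in `[0, 1]) (w (c t) * enorm ('D_1 c t).1 ('D_1 c t).2) + eta).
Proof.
move=> [sc _ per _] cw cg w0 g0 eta0; rewrite (range_periodic per).
have [dc cdc] : Ck 1 setT c := sc 1%N.
have der (t : R) : is_derive t 1 c ('D_1 c t).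
  by apply: derivableP; apply: diff_derivable; exact: dc.
have d1 t := is_derive_fst (der t); have d2 t := is_derive_snd (der t).
have cD : continuous ('D_1 c) by move=> t; exact: cdc.
have c1 : continuous (fun t => ('D_1 c t).1).
  by move=> t; apply: (@continuous_comp _ _ _ ('D_1 c) fst); [exact: cD|exact: cvg_fst].
have c2 : continuous (fun t => ('D_1 c t).2).
  by move=> t; apply: (@continuous_comp _ _ _ ('D_1 c) snd); [exact: cD|exact: cvg_snd].
have := cutoff_curve cw cg w0 g0 d1 d2 c1 c2 eta0; apply: cutoff_subset.
  by move=> _ [u u01 <-]; exists u => //; rewrite -surjective_pairing.
rewrite le_eqVlt; apply/orP; left; apply/eqP; congr (_ * _ + _).
by apply: eq_Rintegral => t _; rewrite /speed -surjective_pairing.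
Qed.

Lemma open_sign_near (D : set (R * R)) p : open D -> ~ (closure D `\` D) p ->
  \forall q \near p, (D q <-> D p).
Proof.
move=> oD nK; have [Dp|nDp] := pselect (D p).
  have : nbhs p D by apply: open_nbhs_nbhs.
  by apply: filterS => q Dq; split.
have ncl : ~ closure D p by move=> cl; apply: nK.
have : nbhs p (~` closure D).
  by apply: open_nbhs_nbhs; split => //; apply: closed_openC; exact: closed_closure.
by apply: filterS => q nq; split => // /subset_closure.
Qed.

(** Multiplication by a plateau [z] equal to 1 on the closure of [D] first makes the field global
    and compactly supported, changing neither its divergence on [D] nor its values on the
    boundary. *)
Lemma green_ineq (Om D : set (R * R)) n (c : 'I_n -> R -> R * R)
    (P Px Py Q Qx Qy : R * R -> R) : open Om -> regular_domain Om D c ->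
  (forall p, Om p -> C1at p P Px Py) -> (forall p, Om p -> C1at p Q Qx Qy) ->
  `|Rintegral mu2 D (fun p => Px p + Qy p)| <=
  \sum_(i < n) \int[mu]_(t in `[0, 1])
     (enorm (P (c i t)) (Q (c i t)) * enorm ('D_1 (c i) t).1 ('D_1 (c i) t).2).
Proof.
move=> oO [oD _ cD DO [cc _ bD]] dP dQ.
have [z [zx [zy [dz sz zD zO]]]] := plateau_on_compact oO cD DO.
pose W1 p := z p * P p; pose W1x p := zx p * P p + z p * Px p.
pose W1y p := zy p * P p + z p * Py p.
pose W2 p := z p * Q p; pose W2x p := zx p * Q p + z p * Qx p.
pose W2y p := zy p * Q p + z p * Qy p.
have dW1 p : C1at p W1 W1x W1y by exact: C1at_plateauM zO dP.
have dW2 p : C1at p W2 W2x W2y by exact: C1at_plateauM zO dQ.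
have sW F : supp_box (fun p => z p * F p).
  by have [A A0 hA] := sz; exists A => // p /hA ->; rewrite mul0r.
have [CW1 CW1x CW1y] := supp_C1 (sW P) dW1.
have [CW2 CW2x CW2y] := supp_C1 (sW Q) dW2.
pose dv p := W1x p + W2y p; have Cdv : Cc dv by exact: CcD.
(* The weight [w] is the norm of the field, paid by the gradient of the cutoff; [g] bounds the
   divergence lost where the cutoff is not 1. *)
pose w p := enorm (W1 p) (W2 p); pose g p := `|dv p|.
have Cg : Cc g by exact: Cc_normr.
have Cw : Cc w.
  split; first by move=> p; apply: continuous_enorm; [case: CW1|case: CW2] => + _; apply.
  have [A A0 hA] := sz; exists A => // p /hA z0.
  by rewrite /w /W1 /W2 z0 !mul0r /enorm expr0n addr0 sqrtr0.
have w0 p : 0 <= w p by exact: enorm_ge0.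
have g0 p : 0 <= g p by exact: normr_ge0.
have zp1 p : D p -> z p = 1 by move=> /subset_closure/zD.
have zn1 p : D p -> \forall q \near p, z q = 1.
  move=> Dp; have : nbhs p D by apply: open_nbhs_nbhs.
  by apply: filterS => q; exact: zp1.
have dvD p : D p -> dv p = Px p + Qy p.
  move=> Dp; have z1 := zp1 p Dp; have hn := zn1 p Dp.
  have hd v d : is_derive p v z d -> d = 0.
    by move=> [_ <-]; rewrite (@near_eq_derive _ _ _ z (cst 1)) ?derive_cst.
  have [_ /hd x0 /hd y0 _ _] := dz p.
  by rewrite /dv /W1x /W2y x0 y0 z1 !mul0r !add0r !mul1r.
have -> : Rintegral mu2 D (fun p => Px p + Qy p) = Rintegral mu2 D dv.
  by apply: eq_Rintegral => p; rewrite inE => /dvD.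
pose L i := \int[mu]_(t in `[0, 1]) (w (c i t) * enorm ('D_1 (c i) t).1 ('D_1 (c i) t).2).
have -> : \sum_(i < n) \int[mu]_(t in `[0, 1])
     (enorm (P (c i t)) (Q (c i t)) * enorm ('D_1 (c i) t).1 ('D_1 (c i) t).2) = \sum_(i < n) L i.
  apply: eq_bigr => i _; apply: eq_Rintegral => t _.
  have : (closure D `\` D) (c i t) by rewrite bD; exists i => //; exists t.
  by move=> [/zD z1 _]; rewrite /w /W1 /W2 z1 !mul1r.
apply/ler_addgt0Pl => eta eta0.
(* The error is shared as [eta / n.+1] rather than [eta / n], so that an empty family of curves is
   no exception. *)
have n1 : 0 < n.+1%:R :> R by rewrite ltr0n.
have [chi [chix [chiy [dchi chi01 chiK chiI]]]] :
    cutoff w g (closure D `\` D) (\sum_(i < n) (2 * L i + eta / n.+1%:R)).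
  rewrite bD; apply: cutoff_bigcup => // i.
  by apply: cutoff_closed_curve => //; rewrite divr_gt0.
have CI := Cc_cutoff Cw Cg dchi.
(* With s = 1 on D and s = -1 elsewhere, 2 \int_D div W = \int s div W since
   \int div W = 0, while s chi W is C^1 and so \int div (s chi W) = 0. *)
pose s p : R := if p \in D then 1 else - 1.
have s1 p : `|s p| = 1 by rewrite /s; case: ifP => _; rewrite ?normrN normr1.
have snear p : ~ (closure D `\` D) p -> \forall q \near p, s q = s p.
  move=> nK; have := open_sign_near oD nK; apply: filterS => q Dqp.
  rewrite /s; congr (if _ then _ else _); by apply/idP/idP; rewrite !inE => /Dqp.
(* Near a boundary point [chi] vanishes identically; near any other point [s] is constant. *)
have dS F Fx Fy : (forall p, C1at p F Fx Fy) -> forall p,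
    C1at p (fun q => s q * (chi q * F q)) (fun q => s q * (chix q * F q + chi q * Fx q))
      (fun q => s q * (chiy q * F q + chi q * Fy q)).
  move=> dF p; have [Kp|/snear sp] := pselect ((closure D `\` D) p).
    have h := chiK p Kp; apply: near_C1at (C1at_cst p 0).
    have hx : \forall q \near p, chix q = 0 by apply: (@near_zero_deriv chi p (1, 0) chix _ h) => q; case: (dchi q).
    have hy : \forall q \near p, chiy q = 0 by apply: (@near_zero_deriv chi p (0, 1) chiy _ h) => q; case: (dchi q).
    move: h hx hy; apply: filterS3 => q -> -> ->.
    by rewrite !mul0r !addr0 mulr0.
  have := C1atM (C1at_cst p (s p)) (C1atM (dchi p) (dF p)); apply: near_C1at.
  near=> q; have sq : s q = s p by near: q.
  by rewrite /= !sq !mul0r !add0r; split.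
have sS F Fx Fy : Cc F -> (forall p, C1at p F Fx Fy) -> supp_box (fun q => s q * (chi q * F q)).
  by move=> [_ [A A0 hA]] _; exists A => // p /hA ->; rewrite !mulr0.
have [I1x _] := I2_deriv0 (sS _ _ _ CW1 dW1) (dS _ _ _ dW1).
have [_ I2y] := I2_deriv0 (sS _ _ _ CW2 dW2) (dS _ _ _ dW2).
have [_ C1x _] := supp_C1 (sS _ _ _ CW1 dW1) (dS _ _ _ dW1).
have [_ _ C2y] := supp_C1 (sS _ _ _ CW2 dW2) (dS _ _ _ dW2).
have Idv : I2 dv = 0.
  have [E1 _] := I2_deriv0 (sW P) dW1; have [_ E2] := I2_deriv0 (sW Q) dW2.
  by rewrite I2_D// E1 E2 addr0.
pose T p := s p * (chix p * W1 p + chi p * W1x p) + s p * (chiy p * W2 p + chi p * W2y p).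
have CT : Cc T by exact: CcD.
have IT : I2 T = 0 by rewrite I2_D// I1x I2y addr0.
pose E := dv \_ D.
have mD : measurable D by exact: open_measurable_plane.
have iE : mu2.-integrable setT (EFin \o E).
  have iD : mu2.-integrable D (EFin \o dv).
    by apply: integrableS (Cc_integrable Cdv).
  have iff := @integrable_mkcond _ _ R mu2 D (EFin \o dv) mD.
  by move: (iff.1 iD); rewrite restrict_EFin.
have -> : Rintegral mu2 D dv = I2 E by rewrite Rintegral_mkcond.
have sE p : s p * dv p = 2 * E p - dv p.
  rewrite /s /E patchE; case: (boolP (p \in D)) => _; first by ring.
  by rewrite -[point]/(0 : R); ring.
have CdT : Cc (fun p => dv p + T p) by exact: CcD.
have i2E : mu2.-integrable setT (EFin \o (fun p => 2 * E p)).
  have := @integrableZl _ _ R mu2 setT measurableT 2 _ iE.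
  by congr (_ .-integrable _ _); apply/funext => p /=; rewrite EFinM.
(* [U] is [s * dv - T]. Its integral is twice that of [E], as [dv] and [T] integrate to 0, and it
   equals [s] times the difference of [(1 - chi) * dv] and the scalar product of the gradient of
   [chi] with the field: exactly what the cost of [chi] controls. *)
pose U p := 2 * E p - (dv p + T p).
have IU : I2 U = 2 * I2 E.
  rewrite RintegralB//; last exact: Cc_integrable.
  by rewrite (I2_D Cdv CT) Idv IT !addr0 subr0 RintegralZl.
have iU : mu2.-integrable setT (EFin \o U).
  have := @integrableB _ _ R mu2 setT measurableT _ _ i2E (Cc_integrable CdT).
  by congr (_ .-integrable _ _); apply/funext => p /=; rewrite EFinB.
have UE p : `|U p| <= enorm (chix p) (chiy p) * w p + (1 - chi p) * g p.
  have -> : U p = s p * ((1 - chi p) * dv p - (chix p * W1 p + chiy p * W2 p)).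
    by rewrite /U /T opprD addrA -sE /dv; ring.
  rewrite normrM s1 mul1r [leRHS]addrC; apply: le_trans (ler_normB _ _) _.
  apply: lerD; last exact: enorm_CS_abs.
  by rewrite normrM ger0_norm// subr_ge0; case/andP: (chi01 p).
have : `|2 * I2 E| <= \sum_(i < n) (2 * L i + eta / n.+1%:R).
  rewrite -IU; apply: le_trans chiI; apply: le_trans (le_normr_Rintegral measurableT iU) _.
  apply: le_Rintegral => //; [exact: integrable_norm|exact: Cc_integrable].
rewrite big_split/= -mulr_sumr sumr_const card_ord normrM ger0_norm// => h.
have h2 : (eta / n.+1%:R) *+ n <= eta.
  rewrite -mulr_natr -mulrA ler_piMr ?(ltW eta0)// mulrC ler_pdivrMr// mul1r.
  by rewrite ler_nat leqnSn.
rewrite -(ler_pM2l (ltr0Sn R 1)) mulrDr.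
move: h h2 eta0; move: (_ *+ n) (\sum_(i < n) L i) `|I2 E|; clear => X Y Z h h2 h3.
by lra'.
Unshelve. all: by end_near. Qed.

End green.

(** * The Calabi potential *)

Section Ck1.
Context {R : realType}.
Implicit Types (f g : R * R -> R) (U : set (R * R)) (p v : R * R).

Lemma Ck1_C1at U f p : Ck 1 U f -> U p -> C1at p f ('D_(1, 0) f) ('D_(0, 1) f).
Proof.
move=> [df cf] Up; have dfp := df p Up; split.
- exact: differentiable_continuous.
- exact/derivableP/diff_derivable.
- exact/derivableP/diff_derivable.
- exact: cf.
- exact: cf.
Qed.

Lemma Ck1M U f g : open U -> Ck 1 U f -> Ck 1 U g -> Ck 1 U (fun p => f p * g p).
Proof.
move=> oU [df cf] [dg cg]; split=> [p Up|v p Up].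
  by apply: (@differentiableM _ _ f g); [exact: df|exact: dg].
have cF := differentiable_continuous (df p Up).
have cG := differentiable_continuous (dg p Up).
apply: (@near_continuous _ _ _ (fun q => f q * 'D_v g q + g q * 'D_v f q)).
  have : nbhs p U by apply: open_nbhs_nbhs.
  apply: filterS => q Uq.
  by rewrite (@deriveM _ _ f g) //; apply: diff_derivable; [exact: df|exact: dg].
apply: cvgD; apply: cvgM => //; [exact: cg|exact: cf].
Qed.

Lemma Ck1V U f : open U -> (forall p, U p -> f p != 0) -> Ck 1 U f -> Ck 1 U (fun p => (f p)^-1).
Proof.
move=> oU f0 [df cf]; split=> [p Up|v p Up].
  by apply: (@differentiableV _ _ f); [exact: df|exact: f0].
have cF := differentiable_continuous (df p Up).
apply: (@near_continuous _ _ _ (fun q => - (f q) ^- 2 * 'D_v f q)).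
  have : nbhs p U by apply: open_nbhs_nbhs.
  apply: filterS => q Uq.
  by rewrite (@deriveV _ _ f) //; [exact: f0|apply: diff_derivable; exact: df].
apply: cvgM; last exact: cf.
apply: cvgN; apply: cvgV; first by rewrite expf_neq0// f0.
exact: (@continuous_comp _ _ _ f (fun x => x ^+ 2) p cF (@exprn_continuous _ 2 _)).
Qed.

Lemma is_derive_scale_dir f p v (t : R) : differentiable f p ->
  is_derive p (t *: v) f (t * 'D_v f p).
Proof.
move=> df; split; first exact: diff_derivable.
by rewrite !deriveE// linearZ.
Qed.

Lemma deriveE2 f p v : differentiable f p ->
  'D_v f p = v.1 * 'D_(1, 0) f p + v.2 * 'D_(0, 1) f p.
Proof.
move=> df; rewrite !deriveE//.
rewrite [X in 'd f p X = _](_ : v = v.1 *: (1, 0) + v.2 *: (0, 1)).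
  by rewrite linearD !linearZ.
by case: v => a b /=; congr pair; rewrite /= /GRing.scale/=; ring.
Qed.

End Ck1.

Section ray.
Context {R : realType}.
Implicit Types (g G : R * R -> R) (p v : R * R).
Variable Om : set (R * R).
Hypotheses (oO : open Om) (sO : star_shaped0 Om).

Definition ray (t : R) p : R * R := (t * p.1, t * p.2).

(** The Calabi potential is [2 * ray_int 1 G] with [G] equal to [tau / delta ^+ 2]; each derivative
    in [p] raises the exponent [k] by one. *)
Definition ray_int (k : nat) G p := \int[mu]_(t in `[0, 1]) (t ^+ k * G (ray t p)).

Lemma ray_in p t : Om p -> `[0, 1]%classic t -> Om (ray t p).
Proof. by move=> Op; rewrite /= in_itv/= => /andP[t0 t1]; apply: (sO.2) => //; apply/andP. Qed.

Lemma continuous_ray2 : continuous (fun z : R * (R * R) => ray z.1 z.2).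
Proof.
move=> z; apply: (@continuous_at_pair _ _ _ (fun z : R * (R * R) => z.1 * z.2.1)
  (fun z : R * (R * R) => z.1 * z.2.2)); apply: cvgM; try exact: cvg_fst.
  apply: (@continuous_comp _ _ _ snd fst); [exact: cvg_snd|exact: cvg_fst].
apply: (@continuous_comp _ _ _ snd snd); [exact: cvg_snd|exact: cvg_snd].
Qed.

Lemma continuous_ray p : continuous (ray ^~ p).
Proof.
move=> t; apply: (@continuous_comp2 _ _ _ _ id (cst p) (fun z : R * (R * R) => ray z.1 z.2)).
- exact: cvg_id.
- exact: cvg_cst.
- exact: continuous_ray2.
Qed.

Lemma within_ray k G p : (forall q, Om q -> {for q, continuous G}) -> Om p ->
  {within `[0, 1], continuous (fun t : R => t ^+ k * G (ray t p))}.
Proof.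
move=> cG Op; apply: continuous_in_subspaceT => t; rewrite inE => t01.
apply: cvgM; first exact: exprn_continuous.
apply: (@continuous_comp _ _ _ (ray ^~ p) G); first exact: continuous_ray.
by apply: cG; exact: ray_in.
Qed.

Lemma integrable_within (f : R -> R) (a b : R) : {within `[a, b], continuous f} ->
  mu.-integrable `[a, b] (EFin \o f).
Proof. by move=> cf; apply: continuous_compact_integrable => //; exact: segment_compact. Qed.

Lemma Rintegral01_le (f : R -> R) (e : R) : mu.-integrable `[0, 1] (EFin \o f) ->
  (forall t, `[0, 1]%classic t -> `|f t| <= e) -> `|\int[mu]_(t in `[0, 1]) f t| <= e.
Proof.
move=> fi fe; apply: le_trans (le_normr_Rintegral _ fi) _ => //.
have -> : e = \int[mu]_(t in `[(0:R), 1]) e.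
  have m01 : lebesgue_measure (`[0, 1]%classic : set R) = 1%:E.
    by rewrite lebesgue_measure_itv/= lte_fin ltr01 oppr0 adde0.
  by rewrite Rintegral_cst// [X in _ * fine X]m01 mulr1.
apply: le_Rintegral => //; first exact: integrable_norm.
by apply: integrable_within; apply: continuous_subspaceT => ?; exact: cvg_cst.
Qed.

(** Compactness of [0, 1] yields one neighbourhood of [p] that serves for all [t], both for staying
    in [Om] and for the oscillation of [G]. *)
Lemma ray_unif G p e : (forall q, Om q -> {for q, continuous G}) -> Om p -> 0 < e ->
  \forall q \near p, forall t, `[0, 1]%classic t ->
    Om (ray t q) /\ `|G (ray t q) - G (ray t p)| <= e.
Proof.
move=> cG Op e0.
have /compact_near_coveringP nc := @segment_compact R 0 1.
have := nc (R * R)%type (nbhs p) (fun q t => Om (ray t q) /\ `|G (ray t q) - G (ray t p)| <= e) _.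
apply => t t01.
have e2 : 0 < e / 2 by rewrite divr_gt0.
have Ot : Om (ray t p) by exact: ray_in.
have h : \forall y \near ray t p, Om y /\ `|G (ray t p) - G y| < e / 2.
  near=> y; split; near: y; first exact: open_nbhs_nbhs.
  exact: (@cvgr_dist_lt _ _ _ _ _ G _ (cG _ Ot)).
have h1 : \forall s \near t, Om (ray s p) /\ `|G (ray t p) - G (ray s p)| < e / 2.
  exact: (@continuous_ray p t _ h).
have h2 : \forall z \near (t, p), Om (ray z.1 z.2) /\ `|G (ray t p) - G (ray z.1 z.2)| < e / 2.
  exact: (@continuous_ray2 (t, p) _ h).
have h3 : \forall z \near (t, p), Om (ray z.1 p) /\ `|G (ray t p) - G (ray z.1 p)| < e / 2.
  exact: (@cvg_fst _ _ _ _ _ _ h1).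
suff : \forall z \near (t, p), Om (ray z.1 z.2) /\ `|G (ray z.1 z.2) - G (ray z.1 p)| <= e.
  by [].
move: h2 h3; apply: filterS2 => -[s q]/= [Oq G1] [_ G2]; split => //.
rewrite (_ : _ - _ = (G (ray t p) - G (ray s p)) - (G (ray t p) - G (ray s q))); last by ring.
apply: le_trans (ler_normB _ _) _.
by move: G1 G2; move: `|_| `|_|; clear; move=> x y *; lra'.
Unshelve. all: by end_near. Qed.

Lemma continuous_ray_int k G p : (forall q, Om q -> {for q, continuous G}) -> Om p ->
  {for p, continuous (ray_int k G)}.
Proof.
move=> cG Op; apply/cvgrPdist_le => e e0.
have h := ray_unif cG Op e0.
have Onear : nbhs p Om by apply: open_nbhs_nbhs.
near=> q; have Oq : Om q by near: q.
have hq : forall t, `[0, 1]%classic t -> Om (ray t q) /\ `|G (ray t q) - G (ray t p)| <= e by near: q.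
rewrite /ray_int -RintegralB//; last 2 first.
- exact/integrable_within/within_ray.
- exact/integrable_within/within_ray.
apply: Rintegral01_le.
  by apply: integrable_within => x; apply: cvgB; exact: within_ray.
move=> t t01; have [_ Ge] := hq t t01.
rewrite -mulrBr normrM distrC -[leRHS]mul1r; apply: ler_pM => //.
by move: t01; rewrite /= in_itv/= => /andP[t0 t1]; rewrite ger0_norm ?exprn_ge0// exprn_ile1.
Unshelve. all: by end_near. Qed.

(** Differentiation under the integral sign. The mean value theorem on each ray gives a point [c]
    depending on [t]; it enters only through the uniform bound of [ray_unif] on ['D_v g], so its
    dependence on [t] is immaterial. *)
Lemma is_derive_ray_int k g p v : Ck 1 Om g -> Om p ->
  is_derive p v (ray_int k g) (ray_int k.+1 ('D_v g) p).
Proof.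
move=> [dg cg] Op.
have cg0 q : Om q -> {for q, continuous g} by move=> /dg; exact: differentiable_continuous.
suff h : h^-1 *: (ray_int k g (h *: v + p) - ray_int k g p) @[h --> (0:R)^'] -->
    ray_int k.+1 ('D_v g) p.
  by split; [apply/cvg_ex; exists (ray_int k.+1 ('D_v g) p)|exact: cvg_lim h].
apply/cvgrPdist_le => e e0.
have /nbhs_ballP[r /= r0 hr] := ray_unif (cg v) Op e0.
pose d := r / (`|v| + 1).
have d0 : 0 < d by rewrite divr_gt0// ltr_wpDl.
have inb (h : R) : `|h| < d -> ball p r (h *: v + p).
  move=> hd; rewrite -ball_normE /= opprD addrCA subrr addr0 normrN normrZ.
  apply: le_lt_trans (_ : `|h| * (`|v| + 1) < r); last by rewrite -ltr_pdivlMr// ltr_wpDl.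
  by rewrite ler_wpM2l// lerDl.
near=> h.
have hd : `|h| < d by near: h; apply: dnbhs0_lt.
have h0 : h != 0 by near: h; exact: nbhs_dnbhs_neq.
have Oq : Om (h *: v + p).
  have /(_ 1) [|] := hr _ (inb h hd); first by rewrite /= in_itv/= ler01 lexx.
  by rewrite /ray !mul1r -surjective_pairing.
have i1 m G q : (forall q, Om q -> {for q, continuous G}) -> Om q ->
    mu.-integrable `[0, 1] (EFin \o (fun t => t ^+ m * G (ray t q))).
  by move=> cG Oq'; apply: integrable_within; exact: within_ray.
have cdiff : {within `[0, 1], continuous (fun t : R => h^-1 * (t ^+ k * g (ray t (h *: v + p)) - t ^+ k * g (ray t p)))}.
  move=> x; apply: cvgM; first exact: cvg_cst.
  by apply: cvgB; exact: within_ray.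
rewrite /ray_int -RintegralB//; [|exact: i1|exact: i1].
rewrite /GRing.scale/= -RintegralZl//; last first.
  by apply: integrable_within => x; apply: cvgB; exact: within_ray.
rewrite -RintegralB//; [|exact: i1 (cg v) Op|exact: integrable_within].
apply: Rintegral01_le.
  by apply: integrable_within => x; apply: cvgB; [exact: (within_ray (cg v) Op)|exact: cdiff].
move=> t t01.
pose phi (y : R) := g (ray t (y *: v + p)).
have dphi (y : R) : `|y| < d -> is_derive y 1 phi (t * 'D_v g (ray t (y *: v + p))).
  move=> yd; have [Oy _] := hr _ (inb y yd) t t01.
  have := is_derive_scale_dir v t (dg _ Oy) => /is_derive_slice H; apply/is_derive_slice.
  move: H; congr is_derive; apply/funext => z; rewrite /phi; congr g.
  have -> : z *: (t *: v) + ray t (y *: v + p) =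
    (z * (t * v.1) + t * (y * v.1 + p.1), z * (t * v.2) + t * (y * v.2 + p.2)) by [].
  have -> : ray t ((z *: 1 + y) *: v + p) =
    (t * ((z * 1 + y) * v.1 + p.1), t * ((z * 1 + y) * v.2 + p.2)) by [].
  by congr pair; ring.
have [c cd E] : exists2 c : R, `|c| < d & phi h - phi 0 = t * 'D_v g (ray t (c *: v + p)) * h.
  have cphi (y : R) : `|y| < d -> {for y, continuous phi}.
    by move=> /dphi[? _]; apply/differentiable_continuous/derivable1_diffP.
  have [hp|hn] := leP 0 h.
    have hh y : y \in `[0, h] -> `|y| < d.
      by rewrite in_itv/= => /andP[y0 yh]; rewrite ger0_norm//; apply: le_lt_trans yh _; rewrite -(ger0_norm hp).
    have [|c c0h ->] := MVT_segment hp (fun y hy => dphi y (hh y (subset_itv_oo_cc hy))).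
      by apply: continuous_in_subspaceT => y; rewrite inE => /hh/cphi.
    by exists c; [exact: hh|rewrite subr0].
  have hh y : y \in `[h, 0] -> `|y| < d.
    rewrite in_itv/= => /andP[yh y0]; rewrite ler0_norm//; apply: le_lt_trans hd.
    by rewrite ltr0_norm// lerN2.
  have [|c c0h E] := MVT_segment (ltW hn) (fun y hy => dphi y (hh y (subset_itv_oo_cc hy))).
    by apply: continuous_in_subspaceT => y; rewrite inE => /hh/cphi.
  by exists c; [exact: hh|rewrite -opprB E sub0r mulrN opprK].
have [_ Ge] := hr _ (inb c cd) t t01.
have E' : g (ray t (h *: v + p)) - g (ray t p) = t * 'D_v g (ray t (c *: v + p)) * h.
  by rewrite -E /phi scale0r add0r.
rewrite -mulrBr E' (_ : _ - _ = t ^+ k.+1 * ('D_v g (ray t p) - 'D_v g (ray t (c *: v + p)))); last first.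
  by rewrite exprS; field.
rewrite normrM distrC -[leRHS]mul1r; apply: ler_pM => //.
by move: t01; rewrite /= in_itv/= => /andP[t0 t1]; rewrite ger0_norm ?exprn_ge0// exprn_ile1.
Unshelve. all: by end_near. Qed.

(** The left side is the integral over [0, 1] of the derivative of t^2 g(t p). *)
Lemma radial_ray_int g p : Ck 1 Om g -> Om p ->
  2 * ray_int 1 g p + (p.1 * ray_int 2 ('D_(1, 0) g) p + p.2 * ray_int 2 ('D_(0, 1) g) p) = g p.
Proof.
move=> [dg cg] Op.
have cg0 q : Om q -> {for q, continuous g} by move=> /dg; exact: differentiable_continuous.
have i1 m G : (forall q, Om q -> {for q, continuous G}) ->
    mu.-integrable `[0, 1] (EFin \o (fun t => t ^+ m * G (ray t p))).
  by move=> cG; apply: integrable_within; exact: within_ray.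
have iZ m (a : R) G : (forall q, Om q -> {for q, continuous G}) ->
    mu.-integrable `[0, 1] (EFin \o (fun t => a * (t ^+ m * G (ray t p)))).
  move=> cG; apply: integrable_within => x; apply: cvgM; first exact: cvg_cst.
  exact: within_ray.
pose f (t : R) := 2 * (t ^+ 1 * g (ray t p)) + (p.1 * (t ^+ 2 * 'D_(1, 0) g (ray t p)) +
  p.2 * (t ^+ 2 * 'D_(0, 1) g (ray t p))).
have cf : {within `[0, 1], continuous f}.
  move=> x; apply: cvgD.
    by apply: cvgM; [exact: cvg_cst|exact: within_ray].
  by apply: cvgD; (apply: cvgM; [exact: cvg_cst|exact: (within_ray (cg _) Op)]).
pose F (t : R) := t ^+ 2 * g (ray t p).
have dray (t : R) : `[0, 1]%classic t -> is_derive t 1 (fun s : R => g (ray s p)) ('D_p g (ray t p)).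
  move=> t01; have Ot := ray_in Op t01.
  have /is_derive_slice H : is_derive (ray t p) p g ('D_p g (ray t p)) by exact/derivableP/diff_derivable/dg.
  apply/is_derive_slice.
  move: H; congr is_derive; apply/funext => z; congr g.
  have -> : z *: p + ray t p = (z * p.1 + t * p.1, z * p.2 + t * p.2) by [].
  have -> : ray (z *: 1 + t) p = ((z * 1 + t) * p.1, (z * 1 + t) * p.2) by [].
  by congr pair; ring.
have dF (t : R) : `[0, 1]%classic t -> is_derive t 1 F (f t).
  move=> t01; have Ot := ray_in Op t01; have d1 := dray t t01.
  have d2 : is_derive t 1 (fun s : R => s ^+ 2) (2 * t).
    by apply: is_derive_eq; rewrite /GRing.scale/=; ring.
  have d3 : is_derive t 1 F _ := is_deriveM d2 d1.
  apply: (is_derive_eq d3).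
  rewrite (deriveE2 p (dg _ Ot)) /f /GRing.scale/=; ring.
have F01 (t : R) : `[0, 1]%classic t -> {for t, continuous F}.
  by move=> /dF[? _]; apply/differentiable_continuous/derivable1_diffP.
have -> : 2 * ray_int 1 g p + (p.1 * ray_int 2 ('D_(1, 0) g) p + p.2 * ray_int 2 ('D_(0, 1) g) p) =
    \int[mu]_(t in `[0, 1]) f t.
  rewrite RintegralD//; [|exact: iZ|]; last first.
    apply: integrable_within => x; apply: cvgD;
    by (apply: cvgM; [exact: cvg_cst|exact: (within_ray (cg _) Op)]).
  rewrite RintegralD//; [|exact: iZ (cg _)|exact: iZ (cg _)].
  by rewrite !RintegralZl//; [exact: i1 (cg _)|exact: i1 (cg _)|exact: i1].
have zi : `[0, 1]%classic (0 : R) by rewrite /= in_itv/= lexx ler01.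
have oi : `[0, 1]%classic (1 : R) by rewrite /= in_itv/= lexx ler01.
rewrite /Rintegral (@continuous_FTC2 _ f F 0 1 ltr01 cf).
- by rewrite /= /F expr0n mul0r subr0 expr1n mul1r /ray !mul1r -surjective_pairing.
- split; first by move=> t /subset_itv_oo_cc /dF[].
    by apply: cvg_at_right_filter; exact: F01.
  by apply: cvg_at_left_filter; exact: F01.
- by move=> t /subset_itv_oo_cc /dF[_]; rewrite derive1E.
Qed.

End ray.

Section calabi.
Context {R : realType}.
Implicit Types (Om : set (R * R)) (delta tau u : R * R -> R) (p v : R * R).

(** The identity is [radial_ray_int] for [tau / delta ^+ 2], doubled. It computes the divergence of
    the field attached to a spacelike graph. *)
Lemma calabi_C1 Om delta tau : conformal_domain Om delta -> smooth Om tau ->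
  exists Cx Cy : R * R -> R, forall p, Om p ->
    C1at p (calabi_potential delta tau) Cx Cy /\
    2 * calabi_potential delta tau p + (p.1 * Cx p + p.2 * Cy p) = 2 * (tau p / delta p ^+ 2).
Proof.
move=> [oO sO sd d0] st.
have Cd : Ck 1 Om delta := sd 1%N; have Ct : Ck 1 Om tau := st 1%N.
pose g p := tau p * (delta p * delta p)^-1.
have Cg : Ck 1 Om g.
  apply: (Ck1M oO Ct); apply: (@Ck1V _ Om (fun p => delta p * delta p) oO); last first.
    exact: (Ck1M oO Cd Cd).
  by move=> p /d0 dp; rewrite mulf_neq0// gt_eqF.
have CE : calabi_potential delta tau = fun p => 2 * ray_int 1 g p.
  by apply/funext => p; congr (_ * _); apply: eq_Rintegral => t _; rewrite expr1.
exists (fun p => 2 * ray_int 2 ('D_(1, 0) g) p), (fun p => 2 * ray_int 2 ('D_(0, 1) g) p).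
move=> p Op; have [dg cg] := Cg.
have cg0 q : Om q -> {for q, continuous g} by move=> /dg; exact: differentiable_continuous.
split.
  have C2 := C1at_cst p (2 : R).
  have C1 : C1at p (ray_int 1 g) (ray_int 2 ('D_(1, 0) g)) (ray_int 2 ('D_(0, 1) g)).
    split.
    - by apply: (continuous_ray_int oO sO) => //.
    - by apply: (is_derive_ray_int oO sO).
    - by apply: (is_derive_ray_int oO sO).
    - by apply: (continuous_ray_int oO sO) => //; exact: cg.
    - by apply: (continuous_ray_int oO sO) => //; exact: cg.
  rewrite CE; have := C1atM C2 C1; apply: eq_C1at => // q.
    by rewrite /= mul0r add0r.
  by rewrite /= mul0r add0r.
have -> : tau p / delta p ^+ 2 = g p by [].
rewrite CE; apply: etrans (congr1 ( *%R 2) (radial_ray_int sO Cg Op)).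
move: (ray_int 1 g p) (ray_int 2 ('D_(1, 0) g) p) (ray_int 2 ('D_(0, 1) g) p) => A B D.
by ring.
Qed.

(** The mixed second difference of [u] over a small square, evaluated by the mean value theorem in
    the two orders, equates a value of [uxy] with a value of [uyx], both taken near [p]. *)
Lemma schwarz (u ux uy uxy uyx : R * R -> R) p :
  nbhs p [set q : R * R | is_derive q (1, 0) u (ux q) /\ is_derive q (0, 1) u (uy q)] ->
  nbhs p [set q : R * R | is_derive q (0, 1) ux (uxy q) /\ is_derive q (1, 0) uy (uyx q)] ->
  {for p, continuous uxy} -> {for p, continuous uyx} -> uxy p = uyx p.
Proof.
move=> h1 h2 cxy cyx; apply/eqP; rewrite -subr_eq0 -normr_le0; apply/ler_addgt0Pl => e e0.
rewrite addr0.
have e2 : 0 < e / 2 by rewrite divr_gt0.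
have h3 : nbhs p [set q : R * R | [/\ is_derive q (1, 0) u (ux q), is_derive q (0, 1) u (uy q),
    is_derive q (0, 1) ux (uxy q), is_derive q (1, 0) uy (uyx q)
    & `|uxy p - uxy q| < e / 2 /\ `|uyx p - uyx q| < e / 2]].
  have n1 : nbhs p [set q : R * R | `|uxy p - uxy q| < e / 2].
    exact: (@cvgr_dist_lt _ _ _ _ _ uxy _ cxy).
  have n2 : nbhs p [set q : R * R | `|uyx p - uyx q| < e / 2].
    exact: (@cvgr_dist_lt _ _ _ _ _ uyx _ cyx).
  apply: (@filterS _ _ _ _ _ _ (filterI (filterI h1 h2) (filterI n1 n2))).
  by move=> q [[[? ?] [? ?]] [? ?]]; split.
have [r /= r0 hr] := (nbhs_ballP _ _).1 h3.
pose h := r / 2; have h0 : 0 < h by rewrite divr_gt0.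
case: p hr {h1 h2 h3 cxy cyx} => x y hr.
have inb s t : s \in `[x, x + h] -> t \in `[y, y + h] -> ball (x, y) r (s, t).
  rewrite !in_itv/= => /andP[s1 s2] /andP[t1 t2]; split; rewrite /ball/= ltr_norml;
    apply/andP; split; move: s1 s2 t1 t2 r0; rewrite /h; lra_clear.
have xh : x < x + h by rewrite ltrDl.
have yh : y < y + h by rewrite ltrDl.
have y0 : y \in `[y, y + h] by rewrite in_itv/= lexx ltW.
have y1 : y + h \in `[y, y + h] by rewrite in_itv/= lexx ltW.
have x0 : x \in `[x, x + h] by rewrite in_itv/= lexx ltW.
have x1 : x + h \in `[x, x + h] by rewrite in_itv/= lexx ltW.
have mvt (f df : R -> R) (a b : R) : a < b -> (forall s : R, s \in `[a, b] -> is_derive s 1 f (df s)) ->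
    exists2 c, c \in `[a, b] & f b - f a = df c * (b - a).
  move=> ab dfs.
  have [|c ci E] := MVT_segment (ltW ab) (fun x hx => dfs x (subset_itv_oo_cc hx)).
    by apply: derivable_within_continuous => s /dfs[].
  by exists c.
have [xi xiI E1] := mvt (fun s => u (s, y + h) - u (s, y)) (fun s => ux (s, y + h) - ux (s, y)) _ _ xh
  (fun s si => is_deriveB (is_derive_pairr (let: And5 d _ _ _ _ := hr _ (inb s _ si y1) in d))
     (is_derive_pairr (let: And5 d _ _ _ _ := hr _ (inb s _ si y0) in d))).
have [et etI E2] := mvt (fun t => ux (xi, t)) (fun t => uxy (xi, t)) _ _ yh
  (fun t ti => is_derive_pairl (let: And5 _ _ d _ _ := hr _ (inb _ _ xiI ti) in d)).
have [et' et'I E3] := mvt (fun t => u (x + h, t) - u (x, t)) (fun t => uy (x + h, t) - uy (x, t)) _ _ yh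
  (fun t ti => is_deriveB (is_derive_pairl (let: And5 _ d _ _ _ := hr _ (inb _ _ x1 ti) in d))
     (is_derive_pairl (let: And5 _ d _ _ _ := hr _ (inb _ _ x0 ti) in d))).
have [xi' xi'I E4] := mvt (fun s => uy (s, et')) (fun s => uyx (s, et')) _ _ xh
  (fun s si => is_derive_pairr (let: And5 _ _ _ d _ := hr _ (inb _ _ si et'I) in d)).
have E : uxy (xi, et) = uyx (xi', et').
  have hh : x + h - x = h by ring.
  have hh' : y + h - y = h by ring.
  move: E1 E3; rewrite E2 E4 hh hh' => E1 E3.
  have : uxy (xi, et) * h * h = uyx (xi', et') * h * h by rewrite -E1 -E3; ring.
  by move=> /(mulIf (lt0r_neq0 h0)) /(mulIf (lt0r_neq0 h0)).
have [_ _ _ _ [b1 _]] := hr _ (inb _ _ xiI etI).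
have [_ _ _ _ [_ b2]] := hr _ (inb _ _ xi'I et'I).
have -> : uxy (x, y) - uyx (x, y) = (uxy (x, y) - uxy (xi, et)) - (uyx (x, y) - uyx (xi', et')).
  by rewrite E; ring.
apply: le_trans (ler_normB _ _) _.
by move: b1 b2; move: `|_| `|_|; clear; move=> a b *; lra'.
Qed.

Lemma C1at_inv p F Fx Fy : F p != 0 -> C1at p F Fx Fy ->
  C1at p (fun q => (F q)^-1) (fun q => - (F q) ^- 2 * Fx q) (fun q => - (F q) ^- 2 * Fy q).
Proof.
move=> F0 hF; apply: (C1at_comp (g := fun x => x^-1) (g' := fun x => - x ^- 2)) => //.
  have := @is_deriveV _ id (F p) 1 1 F0 (is_derive_id _ _).
  by rewrite [_ *: _]mulr1.
apply: cvgN; apply: cvgV; first by rewrite expf_neq0.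
exact: exprn_continuous.
Qed.

Lemma C1at_sqrt p F Fx Fy : 0 < F p -> C1at p F Fx Fy ->
  C1at p (fun q => Num.sqrt (F q)) (fun q => (2 * Num.sqrt (F q))^-1 * Fx q)
    (fun q => (2 * Num.sqrt (F q))^-1 * Fy q).
Proof.
move=> F0 hF; apply: (C1at_comp (g := Num.sqrt) (g' := fun x => (2 * Num.sqrt x)^-1)) => //.
  exact: is_derive1_sqrt.
have n0 : 2 * Num.sqrt (F p) != 0 by rewrite mulf_neq0// gt_eqF// sqrtr_gt0.
by apply: (cvgV n0); apply: cvgM; [exact: cvg_cst|exact: sqrt_continuous].
Qed.

End calabi.

(** * Comparison of a divergence with the Cheeger constant *)

Section cheeger.
Context {R : realType}.
Implicit Types (Om D : set (R * R)) (delta tau u h : R * R -> R) (p v : R * R).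

Lemma measure_open_gt0 D : open D -> D !=set0 -> (0 < mu2 D)%E.
Proof.
move=> oD [p Dp]; have /nbhs_ballP[r /= r0 hr] : nbhs p D by apply: open_nbhs_nbhs.
pose d := r / 2; have d0 : 0 < d by rewrite divr_gt0.
pose B : set (R * R) := `[p.1 - d, p.1 + d] `*` `[p.2 - d, p.2 + d].
have BD : B `<=` D.
  move=> q [/=]; rewrite !in_itv/= => /andP[q1 q2] /andP[q3 q4]; apply: hr.
  split; rewrite /ball/= ltr_norml; apply/andP; split;
    by move: q1 q2 q3 q4 r0; rewrite /d; lra_clear.
have mB : measurable B by apply: measurableX; exact: measurable_itv.
apply: (@lt_le_trans _ _ (mu2 B)).
  rewrite /B product_measure1E//= !lebesgue_measure_itv/= !lte_fin.
  have e1 x : x - d < x + d by move: d0; lra_clear.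
  rewrite !e1 -!EFinB -EFinM lte_fin mulr_gt0//.
    by move: d0; move: p.1; lra_clear.
  by move: d0; move: p.2; lra_clear.
by apply: le_measure => //; rewrite inE//; exact: open_measurable_plane.
Qed.

Lemma compact_fun_bounded (K : set (R * R)) (f : R * R -> R) : compact K ->
  (forall p, K p -> {for p, continuous f}) -> exists2 M : R, 0 < M & forall p, K p -> `|f p| <= M.
Proof.
move=> cK cf.
have cw : {within K, continuous f} by apply: continuous_in_subspaceT => p; rewrite inE; exact: cf.
have /compact_bounded[M [_ hM]] := continuous_compact cw cK.
exists (`|M| + 1); first by rewrite ltr_wpDl.
by move=> p Kp; apply: hM; [rewrite ltr_pwDr// ler_norm|exists p].
Qed.

(** On the compact closure of [D] the density is bounded, and bounded below by a positive constant.
    The positive area is what clears the denominator of the Cheeger quotient. *)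
Lemma area_integrable Om D delta n (c : 'I_n -> R -> R * R) : conformal_domain Om delta ->
  regular_domain Om D c -> mu2.-integrable D (EFin \o (fun p => (delta p ^+ 2)^-1)) /\ 0 < area delta D.
Proof.
move=> [oO sO sd d0] [oD D0 cD DO _].
have cd p : Om p -> {for p, continuous (fun q => (delta q ^+ 2)^-1)}.
  move=> Op; have [dd _] : Ck 1 Om delta := sd 1%N.
  have cdel := differentiable_continuous (dd p Op).
  apply: cvgV; first by rewrite expf_neq0// gt_eqF// d0.
  exact: (@continuous_comp _ _ _ delta (fun x => x ^+ 2) p cdel (@exprn_continuous _ 2 _)).
have mD : measurable D by exact: open_measurable_plane.
have [A A0 DA] := compact_sub_box cD.
have Dfin : (mu2 D < +oo)%E.
  apply: le_lt_trans (box_fin A); apply: le_measure; rewrite ?inE//; first exact: measurable_box.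
  by move=> p /subset_closure/DA.
have mf : measurable_fun D (fun q => (delta q ^+ 2)^-1).
  apply: (measurability _ (measurable_realfun.RGenOpens.measurableE R)).
  move=> _ [_ [a [b ->] <-]]; apply: open_measurable_plane.
  rewrite openE => p [Dp fp]; apply: filterI; first exact: open_nbhs_nbhs.
  apply: (cd p (DO _ (subset_closure Dp))).
  by apply: open_nbhs_nbhs; split => //; exact: interval_open.
have iD : mu2.-integrable D (EFin \o (fun p => (delta p ^+ 2)^-1)).
  apply: measurable_bounded_integrable => //.
  have [M M0 hM] := compact_fun_bounded cD (fun p Kp => cd p (DO p Kp)).
  exists M; split; first exact: num_real.
  by move=> x /ltW Mx q /subset_closure Dq; exact: le_trans (hM q Dq) Mx.
split => //.
have cd2 p : closure D p -> {for p, continuous (fun q => delta q ^+ 2)}.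
  move=> /DO Op; have [dd _] : Ck 1 Om delta := sd 1%N.
  have cdel := differentiable_continuous (dd p Op).
  exact: (@continuous_comp _ _ _ delta (fun x => x ^+ 2) p cdel (@exprn_continuous _ 2 _)).
have [M M0 hM] := compact_fun_bounded cD cd2.
have ic : mu2.-integrable D (EFin \o cst M^-1).
  apply: measurable_bounded_integrable => //.
  by exists `|M^-1|; split; [exact: num_real|move=> x /ltW Mx q _].
have muD : mu2 D \is a fin_num by rewrite ge0_fin_numE.
apply: (@lt_le_trans _ _ (M^-1 * fine (mu2 D))).
  by rewrite mulr_gt0 ?invr_gt0// fine_gt0// Dfin measure_open_gt0.
rewrite -(Rintegral_cst mu2 mD); apply: le_Rintegral => //.
move=> p Dp /=; have Op : Om p by apply: DO; exact: subset_closure.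
rewrite lef_pV2 ?posrE ?exprn_gt0 ?d0//.
by apply: le_trans (ler_norm _) (hM p _); exact: subset_closure.
Qed.

Lemma cheeger_bound Om delta (P Px Py Q Qx Qy : R * R -> R) (m : R) : conformal_domain Om delta ->
  (forall p, Om p -> C1at p P Px Py) -> (forall p, Om p -> C1at p Q Qx Qy) ->
  (forall p, Om p -> enorm (P p) (Q p) <= (delta p)^-1) ->
  0 <= m ->
  (forall p, Om p -> 2 * m * (delta p ^+ 2)^-1 <= Px p + Qy p) ->
  (m%:E <= (2^-1)%:E * cheeger Om delta)%E.
Proof.
move=> hM dP dQ hb m0 hdiv; have [oO sO sd d0] := hM.
suff h : ((2 * m)%:E <= cheeger Om delta)%E.
  have -> : m%:E = ((2^-1)%:E * (2 * m)%:E)%E by rewrite -EFinM mulKf.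
  by apply: lee_wpmul2l => //; rewrite lee_fin.
apply: le_ereal_inf_tmp => _ [D [n [c [hD ->]]]]; rewrite lee_fin.
have [iA A0] := area_integrable hM hD.
rewrite ler_pdivlMr//.
have [oD _ cD DO bD] := hD.
have DOm p : D p -> Om p by move=> /subset_closure/DO.
have mD : measurable D by exact: open_measurable_plane.
have cdiv p : Om p -> {for p, continuous (fun q => Px q + Qy q)}.
  move=> Op; have [_ _ _ c1 _] := dP p Op; have [_ _ _ _ c2] := dQ p Op.
  exact: cvgD.
have iV : mu2.-integrable D (EFin \o (fun p => Px p + Qy p)).
  have [A _ DA] := compact_sub_box cD.
  apply: measurable_bounded_integrable => //.
  - apply: le_lt_trans (box_fin A); apply: le_measure; rewrite ?inE//; first exact: measurable_box.
    by move=> p /subset_closure/DA.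
  - apply: (measurability _ (measurable_realfun.RGenOpens.measurableE R)).
    move=> _ [_ [a [b ->] <-]]; apply: open_measurable_plane.
    rewrite openE => p [Dp fp]; apply: filterI; first exact: open_nbhs_nbhs.
    apply: (cdiv p (DOm _ Dp)).
    by apply: open_nbhs_nbhs; split => //; exact: interval_open.
  - have [M M0 hMM] := compact_fun_bounded cD (fun p Kp => cdiv p (DO p Kp)).
    exists M; split; first exact: num_real.
    by move=> x /ltW Mx q /subset_closure Dq; exact: le_trans (hMM q Dq) Mx.
have -> : 2 * m * area delta D = Rintegral mu2 D (fun p => 2 * m * (delta p ^+ 2)^-1).
  by rewrite RintegralZl.
apply: (@le_trans _ _ (Rintegral mu2 D (fun p => Px p + Qy p))).
  apply: le_Rintegral => //; last by move=> p /DOm; exact: hdiv.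
  have := @integrableZl _ _ R mu2 D mD (2 * m) _ iA.
  by congr (_ .-integrable _ _); apply/funext => p /=; rewrite EFinM.
apply: le_trans (ler_norm _) _; apply: le_trans (green_ineq oO hD dP dQ) _.
have [bc _ bK] := bD.
apply: ler_sum => i _.
have [sc _ _ _] := bc i; have [dc cdc] : Ck 1 setT (c i) := sc 1%N.
have Oc t : Om (c i t).
  apply: DO; have : (closure D `\` D) (c i t) by rewrite bK; exists i => //; exists t.
  by case.
have cc : continuous (c i) by move=> t; apply/differentiable_continuous/dc.
have cC (F : R * R -> R) : (forall p, Om p -> {for p, continuous F}) -> continuous (fun t => F (c i t)).
  by move=> cF t; apply: (@continuous_comp _ _ _ (c i) F); [exact: cc|exact: cF].
have cD' : continuous ('D_1 (c i)) by move=> t; exact: cdc.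
have csp : continuous (fun t => enorm ('D_1 (c i) t).1 ('D_1 (c i) t).2).
  move=> t; apply: (@continuous_enorm _ _ (fun t => ('D_1 (c i) t).1) (fun t => ('D_1 (c i) t).2)).
    by apply: (@continuous_comp _ _ _ ('D_1 (c i)) fst); [exact: cD'|exact: cvg_fst].
  by apply: (@continuous_comp _ _ _ ('D_1 (c i)) snd); [exact: cD'|exact: cvg_snd].
apply: le_Rintegral => //.
- apply: integrable_itv => t; apply: cvgM; last exact: csp.
  apply: (cC (fun p => enorm (P p) (Q p))) => p Op.
  by apply: continuous_enorm; [case: (dP p Op)|case: (dQ p Op)].
- apply: integrable_itv => t; apply: cvgM; first exact: csp.
  apply: (cC (fun p => (delta p)^-1)) => p Op.
  apply: cvgV; first by rewrite gt_eqF// d0.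
  by have [dd _] : Ck 1 Om delta := sd 1%N; exact: differentiable_continuous (dd p Op).
move=> t _; rewrite mulrC ler_wpM2l ?sqrtr_ge0//; exact: hb.
Qed.

(** On the segment from the origin to [p], opposite signs at the ends would force a zero, against
    the lower bound [m]. *)
Lemma const_sign Om (h : R * R -> R) (m : R) : open Om -> star_shaped0 Om -> Ck 1 Om h -> 0 < m ->
  (forall p, Om p -> m <= `|h p|) ->
  (forall p, Om p -> m <= h p) \/ (forall p, Om p -> m <= - h p).
Proof.
move=> oO sO Ch m0 hm; have [dh _] := Ch.
have ch q : Om q -> {for q, continuous h} by move=> /dh; exact: differentiable_continuous.
have key (k : R * R -> R) : (forall p, Om p -> {for p, continuous k}) -> (forall p, Om p -> m <= `|k p|) ->
    0 < k (0, 0) -> forall p, Om p -> m <= k p.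
  move=> ck km k0 p Op; have := km p Op; rewrite ler_normr => /orP[//|kp].
  exfalso.

  (* The factor [t ^+ 0] only gives [f] the shape required by [within_ray]. *)
  pose f (t : R) := t ^+ 0 * k (ray t p).
  have cw : {within `[0, 1], continuous f} by exact: (within_ray sO ck Op).
  have : Num.min (f 0) (f 1) <= 0 <= Num.max (f 0) (f 1).
    rewrite /f !mul1r /ray !mul0r !mul1r -surjective_pairing ge_min le_max (ltW k0)/=.
    by rewrite andbT; apply/orP; right; move: kp m0; lra_clear.
  move=> /(IVT ler01 cw)[t t01]; rewrite /f expr0 mul1r => E.
  have /km : Om (ray t p) by exact: (ray_in sO).
  by rewrite E normr0 leNgt m0.
have O0 := sO.1.
have := hm _ O0; rewrite ler_normr => /orP[h0|h0]; [left|right].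
  by apply: key => //; exact: lt_le_trans h0.
apply: (key (fun p => - h p)) => //.
- by move=> p Op; apply: cvgN; exact: ch.
- by move=> p Op; rewrite normrN; exact: hm.
- exact: lt_le_trans h0.
Qed.

Lemma no_large_divergence Om delta h (P Px Py Q Qx Qy : R * R -> R) : conformal_domain Om delta ->
  smooth Om h -> ((2^-1)%:E * cheeger Om delta < inf_abs Om h)%E ->
  (forall p, Om p -> C1at p P Px Py) -> (forall p, Om p -> C1at p Q Qx Qy) ->
  (forall p, Om p -> enorm (P p) (Q p) <= (delta p)^-1) ->
  (forall p, Om p -> Px p + Qy p = 2 * h p * (delta p ^+ 2)^-1) -> False.
Proof.
move=> hM sh; have [oO sO sd d0] := hM; have O0 := sO.1.
(* Nonnegativity of the Cheeger constant is the case of the zero field and [m = 0]; it makes the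
   infimum of the absolute value of [h] positive, as [const_sign] requires. *)
have c0 : (0%:E <= (2^-1)%:E * cheeger Om delta)%E.
  apply: (@cheeger_bound Om delta (cst 0) (cst 0) (cst 0) (cst 0) (cst 0) (cst 0)) => //.
  - by move=> p _; exact: C1at_cst.
  - by move=> p _; exact: C1at_cst.
  - by move=> p /d0 dp; rewrite /enorm expr0n addr0 sqrtr0 invr_ge0 ltW.
  - by move=> p _; rewrite /= mulr0 mul0r addr0.
have infub p : Om p -> (inf_abs Om h <= (`|h p|)%:E)%E.
  by move=> Op; apply: ereal_inf_lbound; exists p.
move=> hlt dP dQ hb hdiv.
have i0 : (0%:E < inf_abs Om h)%E by exact: le_lt_trans hlt.
have ifin : inf_abs Om h \is a fin_num.
  by rewrite ge0_fin_numE ?(ltW i0)// (le_lt_trans (infub _ O0))// ltry.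
pose m := fine (inf_abs Om h).
have mE : m%:E = inf_abs Om h by rewrite fineK.
have m0 : 0 < m by rewrite -lte_fin mE.
have mh p : Om p -> m <= `|h p| by move=> /infub; rewrite -mE lee_fin.
have dp0 p : Om p -> 0 < (delta p ^+ 2)^-1 by move=> /d0 dp; rewrite invr_gt0 exprn_gt0.
suff : (m%:E <= (2^-1)%:E * cheeger Om delta)%E by rewrite mE leNgt hlt.
have [hp|hn] := const_sign oO sO (sh 1%N) m0 mh.
  apply: (cheeger_bound hM dP dQ hb (ltW m0)) => p Op.
  by rewrite hdiv// ler_pM2r ?dp0// ler_pM2l// hp.
apply: (cheeger_bound hM (fun p Op => C1atN (dP p Op)) (fun p Op => C1atN (dQ p Op)) _ (ltW m0)).
  by move=> p Op; rewrite /enorm !sqrrN; exact: hb.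
by move=> p Op; rewrite -opprD hdiv// -mulNr -mulrN ler_pM2r ?dp0// ler_pM2l// hn.
Qed.

End cheeger.

(** * Entire graphs *)

Section graphs.
Context {R : realType}.
Implicit Types (Om U : set (R * R)) (delta tau u h F G : R * R -> R) (p v : R * R).

(** Hiding the partial derivatives lets the regularity of a compound expression be proved without
    writing them. *)
Definition C1on U F := exists Fx Fy : R * R -> R, forall p, U p -> C1at p F Fx Fy.

Lemma Ck1_C1on U F : Ck 1 U F -> C1on U F.
Proof. by move=> CF; exists ('D_(1, 0) F), ('D_(0, 1) F) => p; exact: Ck1_C1at. Qed.

Lemma C1onD U F G : C1on U F -> C1on U G -> C1on U (fun q => F q + G q).
Proof. by move=> [? [? hF]] [? [? hG]]; eexists; eexists => p Up; exact: C1atD (hF p Up) (hG p Up). Qed.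

Lemma C1onB U F G : C1on U F -> C1on U G -> C1on U (fun q => F q - G q).
Proof. by move=> [? [? hF]] [? [? hG]]; eexists; eexists => p Up; exact: C1atB (hF p Up) (hG p Up). Qed.

Lemma C1onM U F G : C1on U F -> C1on U G -> C1on U (fun q => F q * G q).
Proof. by move=> [? [? hF]] [? [? hG]]; eexists; eexists => p Up; exact: C1atM (hF p Up) (hG p Up). Qed.

Lemma C1on_inv U F : (forall p, U p -> F p != 0) -> C1on U F -> C1on U (fun q => (F q)^-1).
Proof. by move=> F0 [? [? hF]]; eexists; eexists => p Up; exact: C1at_inv (F0 p Up) (hF p Up). Qed.

Lemma C1on_sqrt U F : (forall p, U p -> 0 < F p) -> C1on U F -> C1on U (fun q => Num.sqrt (F q)).
Proof. by move=> F0 [? [? hF]]; eexists; eexists => p Up; exact: C1at_sqrt (F0 p Up) (hF p Up). Qed.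

Lemma C1on_cst U (k : R) : C1on U (fun=> k).
Proof. by eexists; eexists => p _; exact: C1at_cst. Qed.

Lemma C1on_fst U : C1on U fst.
Proof. by eexists; eexists => p _; exact: C1at_fst. Qed.

Lemma C1on_snd U : C1on U snd.
Proof. by eexists; eexists => p _; exact: C1at_snd. Qed.

Lemma no_entire_graph Om delta h tau u : conformal_domain Om delta -> smooth Om h ->
  ((2^-1)%:E * cheeger Om delta < inf_abs Om h)%E -> smooth Om tau -> Ck 2 Om u ->
  (forall p, Om p -> graph_mean_curvature delta tau u p = h p) -> False.
Proof.
move=> hM sh hlt st [du d2u] hmc; have [oO sO sd d0] := hM.
have [Cx [Cy hC]] := calabi_C1 hM st.
set C := calabi_potential delta tau in hC.
have C1C : C1on Om C by exists Cx, Cy => p Op; case: (hC p Op).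
pose alpha q := 'D_(1, 0) u q + q.2 * C q.
pose beta q := 'D_(0, 1) u q - q.1 * C q.
pose W q := 1 + delta q ^+ 2 * (alpha q ^+ 2 + beta q ^+ 2).
have C1a : C1on Om alpha.
  by apply: C1onD; [apply: Ck1_C1on; exact: d2u|apply: C1onM => //; exact: C1on_snd].
have C1b : C1on Om beta.
  by apply: C1onB; [apply: Ck1_C1on; exact: d2u|apply: C1onM => //; exact: C1on_fst].
have W0 p : 0 < W p by rewrite ltr_pwDl// mulr_ge0 ?addr_ge0 ?sqr_ge0.
have C1d : C1on Om delta by apply: Ck1_C1on; exact: (sd 1%N).
have C1W : C1on Om W.
  apply: C1onD; first exact: C1on_cst.
  apply: C1onM; first exact: (C1onM C1d C1d).
  by apply: C1onD; [exact: (C1onM C1a C1a)|exact: (C1onM C1b C1b)].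
have w0 p : 0 < Num.sqrt (W p) by rewrite sqrtr_gt0.
have C1w : C1on Om (fun q => (Num.sqrt (W q))^-1).
  apply: C1on_inv; first by move=> p _; rewrite gt_eqF.
  by apply: C1on_sqrt.
have [Px [Py dP]] := C1onM C1a C1w; have [Qx [Qy dQ]] := C1onM C1b C1w.
apply: (no_large_divergence hM sh hlt dP dQ) => p Op.
  have dp := d0 p Op.
  rewrite ![_ * (Num.sqrt _)^-1]mulrC enormZ ger0_norm ?invr_ge0 ?(ltW (w0 p))//.
  rewrite ler_pdivrMl// ler_pdivlMr//.
  rewrite -(@ler_pXn2r _ 2) ?nnegrE ?sqrtr_ge0//; last by rewrite mulr_ge0 ?enorm_ge0// ltW.
  rewrite sqr_sqrtr ?(ltW (W0 p))// exprMn enorm_sq /W mulrC.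
  by rewrite lerDr.
have := hmc p Op; rewrite /graph_mean_curvature.
have [_ [_ Ex] _ _ _] := dP p Op; have [_ _ [_ Ey] _ _] := dQ p Op.
rewrite -/C; move: Ex Ey; rewrite /alpha /beta /W => -> -> <-.
by field; rewrite gt_eqF// d0.
Qed.

(** The regularity of [u] is phrased by directional derivatives and C^1 first partials, a form that
    the height of a lifted section satisfies as well as a C^2 graph. *)
Lemma no_spacelike_section Om delta tau u : conformal_domain Om delta -> smooth Om tau ->
  ((2^-1)%:E * cheeger Om delta < inf_abs Om tau)%E ->
  (forall p v, Om p -> is_derive p v u (v.1 * 'D_(1, 0) u p + v.2 * 'D_(0, 1) u p)) ->
  C1on Om ('D_(1, 0) u) -> C1on Om ('D_(0, 1) u) ->
  (forall p v, Om p -> v != 0 -> 0 < (v.1 ^+ 2 + v.2 ^+ 2) / delta p ^+ 2 -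
    ('D_v u p - calabi_potential delta tau p * (p.2 * v.1 - p.1 * v.2)) ^+ 2) -> False.
Proof.
move=> hM st hlt du [uxx [uxy dux]] [uyx [uyy duy]] hsp; have [oO sO sd d0] := hM.
have [Cx [Cy hC]] := calabi_C1 hM st.
set C := calabi_potential delta tau in hC hsp.
have dC p : Om p -> C1at p C Cx Cy by move=> Op; case: (hC p Op).
have dP p (Op : Om p) := C1atD (duy p Op) (C1atM (C1at_fst p) (dC p Op)).
have dQ p (Op : Om p) := C1atB (C1atM (C1at_snd p) (dC p Op)) (dux p Op).
apply: (no_large_divergence hM st hlt dP dQ) => p Op /=.
  have dp := d0 p Op.
  pose a := 'D_(1, 0) u p - p.2 * C p; pose b := 'D_(0, 1) u p + p.1 * C p.
  have -> : p.2 * C p - 'D_(1, 0) u p = - a by rewrite opprB.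
  rewrite -/b enorm_swap /enorm sqrrN.
  have [/eqP|ab0] := eqVneq (a, b) (0, 0).
    rewrite xpair_eqE => /andP[/eqP -> /eqP ->].
    by rewrite expr0n addr0 sqrtr0 invr_ge0 ltW.
  (* Testing the metric on the vector [(a, b)] itself turns the squared term into (a^2 + b^2)^2, and
     dividing by a^2 + b^2 gives a^2 + b^2 < 1 / delta^2. The field is [(b, - a)]. *)
  have := hsp p (a, b) Op ab0; have [_ ->] := du p (a, b) Op; rewrite /=.
  have -> : a * 'D_(1, 0) u p + b * 'D_(0, 1) u p - C p * (p.2 * a - p.1 * b) = a ^+ 2 + b ^+ 2.
    by rewrite /a /b; ring.
  have n0 : 0 < a ^+ 2 + b ^+ 2.
    rewrite lt_neqAle addr_ge0 ?sqr_ge0// andbT eq_sym paddr_eq0 ?sqr_ge0// !sqrf_eq0.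
    by move: ab0; rewrite xpair_eqE.
  rewrite subr_gt0 expr2 ltr_pM2l// => /ltW h.
  apply: (@enorm_le _ a b); first by rewrite invr_ge0 ltW.
  by rewrite exprVn.
have E : uxy p = uyx p.
  apply: (@schwarz _ u ('D_(1, 0) u) ('D_(0, 1) u)).
  - have : nbhs p Om by apply: open_nbhs_nbhs.
    by apply: filterS => q Oq; split; apply: derivableP;
      [case: (du q (1, 0) Oq)|case: (du q (0, 1) Oq)].
  - have : nbhs p Om by apply: open_nbhs_nbhs.
    apply: filterS => q Oq; split; first by case: (dux q Oq).
    by case: (duy q Oq).
  - by case: (dux p Op).
  - by case: (duy p Op).
have [_ hr] := hC p Op.
rewrite -mulrA -hr E; ring.
Qed.

Lemma is_derive_pair (V W : normedModType R) (f : V -> W) (g : V -> R) (t v : V) (d : W) (e : R) :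
  is_derive t v f d -> is_derive t v g e -> is_derive t v (fun s => (f s, g s)) (d, e).
Proof.
move=> [df <-] [dg <-].
have h : h^-1 *: ((f (h *: v + t), g (h *: v + t)) - (f t, g t)) @[h --> (0:R)^'] --> ('D_v f t, 'D_v g t).
  exact: (cvg_pair df dg).
by split; [apply/cvg_ex; exists ('D_v f t, 'D_v g t)|exact: cvg_lim h].
Qed.

Lemma no_spacelike_graph Om delta tau u : conformal_domain Om delta -> smooth Om tau ->
  ((2^-1)%:E * cheeger Om delta < inf_abs Om tau)%E ->
  ~ entire_spacelike_graph Om delta tau u.
Proof.
move=> hM st hlt [[du d2u] hsp]; apply: (no_spacelike_section hM st hlt (u := u)).
- move=> p v Op; split; first exact/diff_derivable/du.
  exact: deriveE2 (du p Op).
- by apply: Ck1_C1on; exact: d2u.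
- by apply: Ck1_C1on; exact: d2u.
move=> p v Op v0; have := hsp p Op v v0.
have -> : 'D_v (fun q : R * R => (q.1, q.2, u q)) p = (v.1, v.2, 'D_v u p).
  have /is_derive_pair /(_ (derivableP (diff_derivable (du p Op)))) : is_derive p v (fun q : R * R => (q.1, q.2)) (v.1, v.2).
    apply: is_derive_pair; first exact: is_derive_fst (is_derive_id _ _).
    exact: is_derive_snd (is_derive_id _ _).
  by case.
by rewrite /bundle_metric /= -surjective_pairing !mulN1r mulNr.
Qed.

End graphs.

(** * Local inversion *)

Section inverse.
Context {R : realType}.
Implicit Types (F : R * R -> R) (p q y w : R * R).

Lemma norm_fst p : `|p.1| <= `|p|. Proof. by rewrite prod_normE le_max lexx. Qed.
Lemma norm_snd p : `|p.2| <= `|p|. Proof. by rewrite prod_normE le_max lexx orbT. Qed.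
Lemma norm_pair_le p (e : R) : `|p.1| <= e -> `|p.2| <= e -> `|p| <= e.
Proof. by rewrite prod_normE ge_max => -> ->. Qed.

(** The product condition says that [s] lies between [a] and [b] without ordering them. *)
Lemma mvt_line (f df : R -> R) (a b : R) :
  (forall s : R, `|s - b| <= `|a - b| -> (a - s) * (s - b) >= 0 -> is_derive s 1 f (df s)) ->
  exists2 s, `|s - b| <= `|a - b| /\ (a - s) * (s - b) >= 0 & f a - f b = df s * (a - b).
Proof.
have key (x y : R) : x <= y ->
    (forall s : R, s \in `[x, y] -> is_derive s 1 f (df s)) ->
    exists2 s, s \in `[x, y] & f y - f x = df s * (y - x).
  move=> xy d; have [|s sI E] := MVT_segment xy (fun s hs => d s (subset_itv_oo_cc hs)).
    by apply: derivable_within_continuous => s /d[].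
  by exists s.
move=> hd; have [ab|/ltW ba] := leP a b.
  have hI s : s \in `[a, b] -> `|s - b| <= `|a - b| /\ (a - s) * (s - b) >= 0.
    rewrite in_itv/= => /andP[h1 h2]; rewrite !ler0_norm ?subr_le0//; split.
      by move: h1; lra_clear.
    by rewrite mulr_le0// subr_le0.
  have [s sI E] := key a b ab (fun s sI => hd s (hI s sI).1 (hI s sI).2).
  exists s; first exact: hI.
  by rewrite -opprB E -mulrN opprB.
have hI s : s \in `[b, a] -> `|s - b| <= `|a - b| /\ (a - s) * (s - b) >= 0.
  rewrite in_itv/= => /andP[h1 h2]; rewrite !ger0_norm ?subr_ge0//; split.
    by move: h2; lra_clear.
  by rewrite mulr_ge0// subr_ge0.
have [s sI E] := key b a ba (fun s sI => hd s (hI s sI).1 (hI s sI).2).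
by exists s => //; exact: hI.
Qed.

Lemma between_ball (c a b s r : R) : `|c - a| < r -> `|c - b| < r -> (a - s) * (s - b) >= 0 ->
  `|c - s| < r.
Proof.
rewrite !ltr_norml => /andP[a1 a2] /andP[b1 b2] h; apply/andP; split.
  rewrite ltNge; apply/negP => h1.
  have : (a - s) * (s - b) < 0.
    by rewrite nmulr_rlt0; move: a1 b1 h1; lra_clear.
  by rewrite ltNge h.
rewrite ltNge; apply/negP => h1.
have : (a - s) * (s - b) < 0.
  by rewrite pmulr_rlt0; move: a2 b2 h1; lra_clear.
by rewrite ltNge h.
Qed.

(* xi and et lie on the two sides of the axis-parallel path from q to p. *)
Lemma mvt_plane F Fx Fy p0 (rho : R) p q : (forall z, ball p0 rho z -> C1at z F Fx Fy) ->
  ball p0 rho p -> ball p0 rho q ->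
  exists xi et, [/\ ball p0 rho xi, ball p0 rho et, `|xi - q| <= `|p - q|, `|et - q| <= `|p - q|
    & F p - F q = Fx xi * (p.1 - q.1) + Fy et * (p.2 - q.2)].
Proof.
move=> dF [p1 p2] [q1 q2].
have [s [s1 s2] E1] : exists2 s, `|s - q.1| <= `|p.1 - q.1| /\ (p.1 - s) * (s - q.1) >= 0 &
    F (p.1, p.2) - F (q.1, p.2) = Fx (s, p.2) * (p.1 - q.1).
  apply: (@mvt_line (fun s => F (s, p.2)) (fun s => Fx (s, p.2))) => s s1 s2.
  apply: is_derive_pairr; have [|_ h _ _ _] := dF (s, p.2); last exact: h.
  by split => //; exact: between_ball p1 q1 s2.
have [t [t1 t2] E2] : exists2 t, `|t - q.2| <= `|p.2 - q.2| /\ (p.2 - t) * (t - q.2) >= 0 &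
    F (q.1, p.2) - F (q.1, q.2) = Fy (q.1, t) * (p.2 - q.2).
  apply: (@mvt_line (fun t => F (q.1, t)) (fun t => Fy (q.1, t))) => t t1 t2.
  apply: is_derive_pairl; have [|_ _ h _ _] := dF (q.1, t); last exact: h.
  by split => //; exact: between_ball p2 q2 t2.
exists (s, p.2), (q.1, t); split.
- by split => //; exact: between_ball p1 q1 s2.
- by split => //; exact: between_ball p2 q2 t2.
- by apply: norm_pair_le; [exact: le_trans s1 (norm_fst (p - q))|exact: (norm_snd (p - q))].
- apply: norm_pair_le; last exact: le_trans t1 (norm_snd (p - q)).
  by rewrite /= subrr normr0.
by rewrite -E1 -E2 addrA subrK -!surjective_pairing.
Qed.

Section local_inverse.
Variables (F1 F2 a b c d : R * R -> R) (U : set (R * R)) (p0 : R * R).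
Hypotheses (oU : open U) (Up0 : U p0).
Hypotheses (dF1 : forall p, U p -> C1at p F1 a b) (dF2 : forall p, U p -> C1at p F2 c d).

Definition jac p := a p * d p - b p * c p.

Hypothesis j0 : jac p0 != 0.

Let D0 := jac p0.
(** [(B1, B2)] is the inverse of the differential of [(F1, F2)] at [p0] by Cramer's rule, and [beta]
    bounds its norm. *)
Let B1 w := (d p0 * w.1 - b p0 * w.2) / D0.
Let B2 w := (a p0 * w.2 - c p0 * w.1) / D0.
Let beta := (`|a p0| + `|b p0| + `|c p0| + `|d p0|) / `|D0|.
(* (G1, G2) is F composed with the inverse of its differential at p0, so that
   p |-> p - G p is a contraction near p0. *)
Let G1 p := B1 (F1 p, F2 p).
Let G2 p := B2 (F1 p, F2 p).
Let g11 p := B1 (a p, c p).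
Let g12 p := B1 (b p, d p).
Let g21 p := B2 (a p, c p).
Let g22 p := B2 (b p, d p).

Let dG1 p : U p -> C1at p G1 g11 g12.
Proof.
move=> Up; have h1 := C1atM (C1at_cst p (d p0 / D0)) (dF1 Up).
have h2 := C1atM (C1at_cst p (b p0 / D0)) (dF2 Up).
have := C1atB h1 h2; apply: eq_C1at => q; rewrite /G1 /g11 /g12 /B1 /=; ring.
Qed.

Let dG2 p : U p -> C1at p G2 g21 g22.
Proof.
move=> Up; have h1 := C1atM (C1at_cst p (c p0 / D0)) (dF1 Up).
have h2 := C1atM (C1at_cst p (a p0 / D0)) (dF2 Up).
have := C1atB h2 h1; apply: eq_C1at => q; rewrite /G2 /g21 /g22 /B2 /=; ring.
Qed.

Let B_le w : `|B1 w| <= beta * `|w| /\ `|B2 w| <= beta * `|w|.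
Proof.
have w1 := norm_fst w; have w2 := norm_snd w.
rewrite /B1 /B2 /beta !normrM normfV ![_ / `|D0| * _]mulrAC.
have D00 : 0 <= `|D0|^-1 by rewrite invr_ge0.
have h (x y z t : R) : `|x * w.1 - y * w.2| <= (`|x| + `|y| + `|z| + `|t|) * `|w|.
  apply: le_trans (ler_normB _ _) _; rewrite !normrM.
  apply: (@le_trans _ _ ((`|x| + `|y|) * `|w|)).
    by rewrite mulrDl; apply: lerD; apply: ler_wpM2l.
  by apply: ler_wpM2r => //; rewrite -addrA lerDl addr_ge0.
split; apply: ler_wpM2r => //.
  have -> : `|a p0| + `|b p0| + `|c p0| + `|d p0| = `|d p0| + `|b p0| + `|a p0| + `|c p0| by ring.
  exact: h.
rewrite distrC.
have -> : `|a p0| + `|b p0| + `|c p0| + `|d p0| = `|c p0| + `|a p0| + `|b p0| + `|d p0| by ring.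
exact: h.
Qed.

Let B_inj w : B1 w = 0 -> B2 w = 0 -> w.1 = 0 /\ w.2 = 0.
Proof.
have D00 : D0 != 0 := j0.
move=> h1 h2; split.
  have -> : w.1 = a p0 * B1 w + b p0 * B2 w by rewrite /B1 /B2 /D0 /jac; field.
  by rewrite h1 h2 !mulr0 addr0.
have -> : w.2 = c p0 * B1 w + d p0 * B2 w by rewrite /B1 /B2 /D0 /jac; field.
by rewrite h1 h2 !mulr0 addr0.
Qed.

Let BB w w' : (B1 w - B1 w' = B1 (w - w')) * (B2 w - B2 w' = B2 (w - w')).
Proof. by split; rewrite /B1 /B2 /=; ring. Qed.

(** With entries within 1/4 of those of the identity, each row of the differential of p - G p sums
    to at most 1/2, which is the contraction factor for the max norm. *)
Let near_id : exists2 rho : R, 0 < rho & forall p, ball p0 rho p ->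
  [/\ U p, `|g11 p - 1| <= 4^-1, `|g12 p| <= 4^-1, `|g21 p| <= 4^-1 & `|g22 p - 1| <= 4^-1].
Proof.
have D00 : D0 != 0 := j0.
have [_ _ _ c11 c12] := dG1 Up0; have [_ _ _ c21 c22] := dG2 Up0.
have e11 : g11 p0 = 1 by rewrite /g11 /B1 /= /D0 /jac; field.
have e12 : g12 p0 = 0 by rewrite /g12 /B1 /=; ring.
have e21 : g21 p0 = 0 by rewrite /g21 /B2 /=; ring.
have e22 : g22 p0 = 1 by rewrite /g22 /B2 /= /D0 /jac; field.
have q4 : 0 < 4^-1 :> R by rewrite invr_gt0.
have l11 : g11 p @[p --> p0] --> (1 : R) by rewrite -[X in _ --> X]e11; exact: c11.
have l12 : g12 p @[p --> p0] --> (0 : R) by rewrite -[X in _ --> X]e12; exact: c12.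
have l21 : g21 p @[p --> p0] --> (0 : R) by rewrite -[X in _ --> X]e21; exact: c21.
have l22 : g22 p @[p --> p0] --> (1 : R) by rewrite -[X in _ --> X]e22; exact: c22.
suff : \forall p \near p0, [/\ U p, `|g11 p - 1| <= 4^-1, `|g12 p| <= 4^-1, `|g21 p| <= 4^-1 & `|g22 p - 1| <= 4^-1].
  by move=> /nbhs_ballP[rho /= rho0 h]; exists rho => // p /h.
near=> p; split; near: p.
- exact: open_nbhs_nbhs.
- by apply: (@cvgr_distC_le _ _ _ _ _ g11 1 l11).
- by apply: (@cvgr0_norm_le _ _ _ _ _ g12 l12).
- by apply: (@cvgr0_norm_le _ _ _ _ _ g21 l21).
- by apply: (@cvgr_distC_le _ _ _ _ _ g22 1 l22).
Unshelve. all: by end_near. Qed.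

(** The inverse of the differential of [(F1, F2)] at [p], applied to [w]. *)
Let nu p w : R * R := ((d p * w.1 - b p * w.2) / jac p, (a p * w.2 - c p * w.1) / jac p).

Lemma local_inverse : exists V (r : R) (g : R * R -> R * R), [/\ open V, V p0, V `<=` U & 0 < r] /\
  [/\ forall p, V p -> jac p != 0,
    forall p q, V p -> V q -> F1 p = F1 q -> F2 p = F2 q -> p = q,
    forall y, ball (F1 p0, F2 p0) r y -> [/\ V (g y), F1 (g y) = y.1 & F2 (g y) = y.2],
    g (F1 p0, F2 p0) = p0 &
    forall y, ball (F1 p0, F2 p0) r y -> {for y, continuous g} /\
      forall w, is_derive y w g (nu (g y) w)].
Proof.
have D00 : D0 != 0 := j0.
have [rho rho0 hrho] := near_id.
pose V := ball p0 rho; pose y0 := (F1 p0, F2 p0).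
have VU p : V p -> U p by move=> /hrho[].
have Vp0 : V p0 by exact: ballxx.
have beta0 : 0 <= beta by rewrite divr_ge0// !addr_ge0.
(* For [y] within [r] of [y0] the vector B (y - y0) is at most rho / 4, so the map [T] below sends
   the square of radius rho / 2 into itself: half of rho / 2 plus rho / 4. *)
pose r := rho / (4 * (beta + 1)).
have r0 : 0 < r by rewrite divr_gt0// mulr_gt0// ltr_wpDl.
have ctr p q : V p -> V q -> `|(p.1 - q.1) - (G1 p - G1 q)| <= 2^-1 * `|p - q| /\
    `|(p.2 - q.2) - (G2 p - G2 q)| <= 2^-1 * `|p - q|.
  move=> Vp Vq.
  have n1 := norm_fst (p - q); have n2 := norm_snd (p - q).
  have bd (x y u v : R) : `|x| <= 4^-1 -> `|y| <= 4^-1 -> `|u| <= `|p - q| -> `|v| <= `|p - q| ->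
      `|x * u + y * v| <= 2^-1 * `|p - q|.
    move=> hx hy hu hv; apply: le_trans (ler_normD _ _) _; rewrite !normrM.
    have -> : 2^-1 * `|p - q| = 4^-1 * `|p - q| + 4^-1 * `|p - q| by field.
    by apply: lerD; apply: ler_pM.
  split.
    have [xi [et [xiV etV _ _ ->]]] := mvt_plane (fun z zV => dG1 (VU z zV)) Vp Vq.
    have [_ h11 _ _ _] := hrho xi xiV; have [_ _ h12 _ _] := hrho et etV.
    have -> : p.1 - q.1 - (g11 xi * (p.1 - q.1) + g12 et * (p.2 - q.2)) =
      (1 - g11 xi) * (p.1 - q.1) + (- g12 et) * (p.2 - q.2) by ring.
    by apply: bd => //; [rewrite distrC|rewrite normrN].
  have [xi [et [xiV etV _ _ ->]]] := mvt_plane (fun z zV => dG2 (VU z zV)) Vp Vq.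
  have [_ _ _ h21 _] := hrho xi xiV; have [_ _ _ _ h22] := hrho et etV.
  have -> : p.2 - q.2 - (g21 xi * (p.1 - q.1) + g22 et * (p.2 - q.2)) =
    (- g21 xi) * (p.1 - q.1) + (1 - g22 et) * (p.2 - q.2) by ring.
  by apply: bd => //; [rewrite normrN|rewrite distrC].
have lip p q : V p -> V q -> `|p - q| <= 2 * beta * `|(F1 p, F2 p) - (F1 q, F2 q)|.
  move=> Vp Vq; have [c1 c2] := ctr p q Vp Vq.
  have [b1 b2] := B_le ((F1 p, F2 p) - (F1 q, F2 q)).
  have key (u v : R) : `|u - v| <= 2^-1 * `|p - q| ->
      `|v| <= beta * `|(F1 p, F2 p) - (F1 q, F2 q)| ->
      `|u| <= 2^-1 * `|p - q| + beta * `|(F1 p, F2 p) - (F1 q, F2 q)|.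
    by move=> h1 h2; rewrite -(subrK v u); apply: le_trans (ler_normD _ _) _; exact: lerD.
  have : `|p - q| <= 2^-1 * `|p - q| + beta * `|(F1 p, F2 p) - (F1 q, F2 q)|.
    apply: norm_pair_le; apply: key.
    - exact: c1.
    - by rewrite /G1 BB.
    - exact: c2.
    - by rewrite /G2 BB.
  rewrite -mulrA; move: (beta * _) `|p - q| => x z => h; lra'.
have inj p q : V p -> V q -> F1 p = F1 q -> F2 p = F2 q -> p = q.
  move=> Vp Vq e1 e2; have := lip p q Vp Vq.
  by rewrite e1 e2 subrr normr0 mulr0 normr_le0 subr_eq0 => /eqP.
have ex y : ball y0 r y -> exists q, [/\ V q, F1 q = y.1 & F2 q = y.2].
  move=> yr; pose d0 := rho / 2.
  have d00 : 0 < d0 by rewrite divr_gt0.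
  pose K : set (R * R) := `[p0.1 - d0, p0.1 + d0] `*` `[p0.2 - d0, p0.2 + d0].
  have KP q : K q <-> `|q.1 - p0.1| <= d0 /\ `|q.2 - p0.2| <= d0.
    rewrite /K /setX /= !in_itv/= !ler_distl; split => -[]; by split.
  have cK : compact K by apply: compact_setX; exact: segment_compact.
  have KV q : K q -> V q.
    move=> /KP[h1 h2]; split; rewrite /ball/= distrC.
      by apply: le_lt_trans h1 _; rewrite /d0 ltr_pdivrMr// ltr_pMr// ltr1n.
    by apply: le_lt_trans h2 _; rewrite /d0 ltr_pdivrMr// ltr_pMr// ltr1n.
  have Kp0 : K p0 by apply/KP; rewrite !subrr normr0 ltW.
  (* A fixed point of [T] is a preimage of [y]. It is found by minimizing the displacement [eta] on
     the compact square: [T] at least halves [eta], so the minimum is 0. *)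
  pose T q := (q.1 - G1 q + B1 y, q.2 - G2 q + B2 y).
  pose eta q := `|(B1 y - G1 q, B2 y - G2 q)|.
  have ybd : beta * `|y - y0| <= rho / 4.
    have : `|y - y0| <= r.
      by apply: norm_pair_le; case: yr => h1 h2; rewrite distrC ltW.
    move=> h; apply: le_trans (ler_wpM2l beta0 h) _.
    have E : (beta + 1) * r = rho / 4.
      have : beta + 1 != 0 by rewrite gt_eqF// ltr_wpDl.
      by rewrite /r; move: (beta) => x x0; field.
    by rewrite -E ler_wpM2r ?(ltW r0)// lerDl.
  have TK q : K q -> K (T q).
    move=> Kq; have [c1 c2] := ctr q p0 (KV q Kq) Vp0.
    have [b1 b2] := B_le (y - y0).
    have nq : 2^-1 * `|q - p0| <= rho / 4.
      have : `|q - p0| <= d0 by case/KP: Kq => h1 h2; exact: norm_pair_le.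
      by move: `|_|; rewrite /d0 => x h; lra'.
    have dE : d0 = rho / 4 + rho / 4 by rewrite /d0; field.
    apply/KP; rewrite dE; split.
      have -> : (T q).1 - p0.1 = (q.1 - p0.1 - (G1 q - G1 p0)) + B1 (y - y0).
        by rewrite /T /G1 -BB -/y0 /=; ring.
      by apply: le_trans (ler_normD _ _) _; apply: lerD; [exact: le_trans c1 nq|exact: le_trans b1 ybd].
    have -> : (T q).2 - p0.2 = (q.2 - p0.2 - (G2 q - G2 p0)) + B2 (y - y0).
      by rewrite /T /G2 -BB -/y0 /=; ring.
    by apply: le_trans (ler_normD _ _) _; apply: lerD; [exact: le_trans c2 nq|exact: le_trans b2 ybd].
  have ceta : {within K, continuous eta}.
    apply: continuous_in_subspaceT => q; rewrite inE => /KV/VU Uq.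
    have [cG1 _ _ _ _] := dG1 Uq; have [cG2 _ _ _ _] := dG2 Uq.
    apply: (@cvg_norm _ _ _ _ _ (fun q => (B1 y - G1 q, B2 y - G2 q))).
    apply: (@continuous_at_pair _ _ _ (fun q => B1 y - G1 q) (fun q => B2 y - G2 q)).
      by apply: cvgB; [exact: cvg_cst|exact: cG1].
    by apply: cvgB; [exact: cvg_cst|exact: cG2].
  have [q Kq qmin] := compact_EVT_min (ex_intro _ p0 Kp0) cK ceta.
  rewrite inE in Kq.
  have Tq : T q - q = (B1 y - G1 q, B2 y - G2 q).
    by rewrite /T; congr pair; rewrite /=; ring.
  have etaT : eta (T q) <= 2^-1 * eta q.
    have [c1 c2] := ctr (T q) q (KV _ (TK q Kq)) (KV q Kq).
    rewrite -[eta q]/(`|(B1 y - G1 q, B2 y - G2 q)|) -Tq.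
    apply: norm_pair_le.
      by rewrite /= (_ : _ - _ = (T q).1 - q.1 - (G1 (T q) - G1 q)); [exact: c1|rewrite /T /=; ring].
    by rewrite /= (_ : _ - _ = (T q).2 - q.2 - (G2 (T q) - G2 q)); [exact: c2|rewrite /T /=; ring].
  have eta0 : eta q = 0.
    apply/eqP; rewrite eq_le normr_ge0 andbT.
    have : eta q <= 2^-1 * eta q by apply: le_trans etaT; apply: qmin; rewrite inE; exact: TK.
    by move: (eta q) => x h; lra'.
  have [h1 h2] : B1 y - G1 q = 0 /\ B2 y - G2 q = 0.
    by move/eqP : eta0; rewrite normr_eq0 => /eqP[].
  exists q; split; first exact: KV.
    move: h1 h2; rewrite /G1 /G2 !BB => h1 h2; have [e1 _] := B_inj h1 h2.
    by move/eqP: e1; rewrite /= subr_eq0 => /eqP.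
  move: h1 h2; rewrite /G1 /G2 !BB => h1 h2; have [_ e2] := B_inj h1 h2.
  by move/eqP: e2; rewrite /= subr_eq0 => /eqP.
pose g y := xget p0 [set q | [/\ V q, F1 q = y.1 & F2 q = y.2]].
have hg y : ball y0 r y -> [/\ V (g y), F1 (g y) = y.1 & F2 (g y) = y.2].
  by move=> /ex exy; exact: (xgetPex p0 exy).
(* The determinant of the normalized differential is at least 9/16 - 1/16. *)
have jV p : V p -> jac p != 0.
  move=> Vp; have [_ h11 h12 h21 h22] := hrho p Vp.
  have E : jac p / D0 = g11 p * g22 p - g12 p * g21 p.
    by rewrite /g11 /g22 /g12 /g21 /B1 /B2 /= {1}/jac; move: D00; rewrite /D0 /jac => D00'; field.
  apply/eqP => jp; move: E; rewrite jp mul0r => E.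
  have k1 : 3 / 4 <= g11 p by move: h11; rewrite ler_distl; move=> *; lra'.
  have k2 : 3 / 4 <= g22 p by move: h22; rewrite ler_distl; move=> *; lra'.
  have k3 : `|g12 p * g21 p| <= 4^-1 * 4^-1 by rewrite normrM ler_pM.
  have k4 : 3 / 4 * (3 / 4) <= g11 p * g22 p by rewrite ler_pM.
  have k5 := le_trans (ler_norm _) k3.
  by move: E k4 k5; move: (g11 p * g22 p) (g12 p * g21 p) => x z E h1 h2; lra'.
exists V, r, g; split; split => //.
- exact: ball_open.
- by have [v e1 e2] := hg y0 (ballxx _ r0); apply: inj.
move=> y yr.
have oB : open (ball y0 r) by exact: ball_open.
have glip y1 y2 : ball y0 r y1 -> ball y0 r y2 -> `|g y1 - g y2| <= 2 * beta * `|y1 - y2|.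
  move=> h1 h2; have [v1 e1 e2] := hg y1 h1; have [v2 e3 e4] := hg y2 h2.
  by have := lip _ _ v1 v2; rewrite e1 e2 e3 e4 -!surjective_pairing.
have cg : {for y, continuous g}.
  apply/cvgrPdist_lt => e e0.
  have n1 : \forall y' \near y, ball y0 r y' by exact: open_nbhs_nbhs.
  have n2 : \forall y' \near y, `|y - y'| < e / (2 * beta + 1).
    by apply: (@cvgr_dist_lt _ _ _ _ _ id y cvg_id); rewrite divr_gt0// ltr_wpDl// mulr_ge0.
  near=> y'.
  have y'r : ball y0 r y' by near: y'.
  have : `|y - y'| < e / (2 * beta + 1) by near: y'.
  rewrite ltr_pdivlMr; last by rewrite ltr_wpDl// mulr_ge0.
  move=> h; apply: le_lt_trans (glip y y' yr y'r) _; apply: le_lt_trans h.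
  by rewrite mulrC ler_wpM2l// lerDl.
split => // w.
have [Vq q1 q2] := hg y yr; set q := g y in Vq q1 q2 cg *.
pose m0 := ((a q, b q), (c q, d q)).
pose det (m : (R * R) * (R * R)) := m.1.1 * m.2.2 - m.1.2 * m.2.1.
(* The difference quotient of [g] is exactly the Cramer solution for a matrix of partial derivatives
   taken at four intermediate points. These tend to [q], and [N1], [N2] are continuous at the
   invertible matrix [m0]. *)
pose N1 (m : (R * R) * (R * R)) := (m.2.2 * w.1 - m.1.2 * w.2) / det m.
pose N2 (m : (R * R) * (R * R)) := (m.1.1 * w.2 - m.2.1 * w.1) / det m.
have det0 : det m0 != 0 by exact: jV.
have c11 : {for m0, continuous (fun m : (R * R) * (R * R) => m.1.1)}.
  by apply: (@continuous_comp _ _ _ fst fst); [exact: cvg_fst|exact: cvg_fst].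
have c12 : {for m0, continuous (fun m : (R * R) * (R * R) => m.1.2)}.
  by apply: (@continuous_comp _ _ _ fst snd); [exact: cvg_fst|exact: cvg_snd].
have c21 : {for m0, continuous (fun m : (R * R) * (R * R) => m.2.1)}.
  by apply: (@continuous_comp _ _ _ snd fst); [exact: cvg_snd|exact: cvg_fst].
have c22 : {for m0, continuous (fun m : (R * R) * (R * R) => m.2.2)}.
  by apply: (@continuous_comp _ _ _ snd snd); [exact: cvg_snd|exact: cvg_snd].
have cdet : {for m0, continuous det} by apply: cvgB; apply: cvgM.
have cN1 : {for m0, continuous N1}.
  apply: cvgM; last exact: cvgV.
  by apply: cvgB; apply: cvgM => //; exact: cvg_cst.
have cN2 : {for m0, continuous N2}.
  apply: cvgM; last exact: cvgV.
  by apply: cvgB; apply: cvgM => //; exact: cvg_cst.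
suff h : h^-1 *: (g (h *: w + y) - g y) @[h --> (0:R)^'] --> nu q w.
  by split; [apply/cvg_ex; exists (nu q w)|exact: cvg_lim h].
apply/cvgrPdist_lt => e e0.
have [e1 /= e10 he1] : exists2 e1 : R, 0 < e1 & forall m, ball m0 e1 m ->
    [/\ det m != 0, `|N1 m0 - N1 m| < e & `|N2 m0 - N2 m| < e].
  suff : \forall m \near m0, [/\ det m != 0, `|N1 m0 - N1 m| < e & `|N2 m0 - N2 m| < e].
    by move=> /nbhs_ballP[e1 /= e10 h]; exists e1 => // m /h.
  near=> m; split; near: m.
  - exact: (@cvgr_neq0 _ _ _ _ _ det _ cdet).
  - exact: (@cvgr_dist_lt _ _ _ _ _ N1 _ cN1).
  - exact: (@cvgr_dist_lt _ _ _ _ _ N2 _ cN2).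
have [de /= de0 hde] : exists2 de : R, 0 < de & forall x, ball q de x ->
    [/\ `|a q - a x| < e1, `|b q - b x| < e1, `|c q - c x| < e1 & `|d q - d x| < e1].
  have [_ _ _ ca cb] := dF1 (VU _ Vq); have [_ _ _ cc cd] := dF2 (VU _ Vq).
  suff : \forall x \near q, [/\ `|a q - a x| < e1, `|b q - b x| < e1, `|c q - c x| < e1 & `|d q - d x| < e1].
    by move=> /nbhs_ballP[e2 /= e20 h]; exists e2 => // m /h.
  near=> x; split; near: x.
  - exact: (@cvgr_dist_lt _ _ _ _ _ a _ ca).
  - exact: (@cvgr_dist_lt _ _ _ _ _ b _ cb).
  - exact: (@cvgr_dist_lt _ _ _ _ _ c _ cc).
  - exact: (@cvgr_dist_lt _ _ _ _ _ d _ cd).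
have lh : h *: w + y @[h --> (0:R)^'] --> y.
  have -> : y = 0 *: w + y by rewrite scale0r add0r.
  apply: cvgD; last by rewrite scale0r add0r; exact: cvg_cst.
  by apply: cvgZr_tmp; exact: nbhs_dnbhs.
have nr : \forall h \near (0:R)^', ball y0 r (h *: w + y).
  have ny : nbhs y (ball y0 r) by exact: open_nbhs_nbhs.
  exact: (lh _ ny).
have nq : \forall h \near (0:R)^', `|q - g (h *: w + y)| < de.
  have cgl : g (h *: w + y) @[h --> (0:R)^'] --> q.
    exact: (@cvg_comp _ _ _ (fun h : R => h *: w + y) g _ _ _ lh cg).
  exact: (@cvgr_dist_lt _ _ _ _ _ _ _ cgl).
near=> h.
have h0 : h != 0 by near: h; exact: nbhs_dnbhs_neq.
have hr : ball y0 r (h *: w + y) by near: h.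
have hq : `|q - g (h *: w + y)| < de by near: h.
have [Vh g1 g2] := hg _ hr; set qh := g (h *: w + y) in Vh g1 g2 hq *.
have inb x : `|x - q| <= `|qh - q| -> ball q de x.
  move=> hx; rewrite -ball_normE /= distrC; apply: le_lt_trans hx _.
  by rewrite distrC.
have [x1 [x2 [_ _ hx1 hx2 E1]]] := mvt_plane (fun z zV => dF1 (VU z zV)) Vh Vq.
have [x3 [x4 [_ _ hx3 hx4 E2]]] := mvt_plane (fun z zV => dF2 (VU z zV)) Vh Vq.
pose m := ((a x1, b x2), (c x3, d x4)).
have [dm n1 n2] : [/\ det m != 0, `|N1 m0 - N1 m| < e & `|N2 m0 - N2 m| < e].
  apply: he1; have [i1 _ _ _] := hde _ (inb _ hx1); have [_ i2 _ _] := hde _ (inb _ hx2).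
  by have [_ _ i3 _] := hde _ (inb _ hx3); have [_ _ _ i4] := hde _ (inb _ hx4).
have W1 : h * w.1 = a x1 * (qh.1 - q.1) + b x2 * (qh.2 - q.2).
  by rewrite -E1 g1 q1 /= addrK.
have W2 : h * w.2 = c x3 * (qh.1 - q.1) + d x4 * (qh.2 - q.2).
  by rewrite -E2 g2 q2 /= addrK.
have K1 : h^-1 * (qh.1 - q.1) = N1 m.
  apply: (mulfI h0); rewrite mulVKf//; apply: (mulIf dm).
  rewrite /N1 -!mulrA mulVf// mulr1 /det /m /=.
  have -> : h * (d x4 * w.1 - b x2 * w.2) = d x4 * (h * w.1) - b x2 * (h * w.2) by ring.
  by rewrite W1 W2; ring.
have K2 : h^-1 * (qh.2 - q.2) = N2 m.
  apply: (mulfI h0); rewrite mulVKf//; apply: (mulIf dm).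
  rewrite /N2 -!mulrA mulVf// mulr1 /det /m /=.
  have -> : h * (a x1 * w.2 - c x3 * w.1) = a x1 * (h * w.2) - c x3 * (h * w.1) by ring.
  by rewrite W1 W2; ring.
have -> : h^-1 *: (qh - q) = (N1 m, N2 m) by rewrite -K1 -K2.
rewrite prod_normE gt_max; apply/andP; split; [exact: n1|exact: n2].
Unshelve. all: by end_near. Qed.

End local_inverse.

End inverse.

(** * A spacelike surface is locally a graph *)

Section chart.
Context {R : realType}.
Implicit Types (Om : set (R * R)) (delta tau u : R * R -> R).

Lemma differentiable_fst (W1 W2 : normedModType R) (p : W1 * W2) :
  differentiable (fst : W1 * W2 -> W1) p.
Proof. by apply: linear_differentiable => x; exact: cvg_fst. Qed.

Lemma differentiable_snd (W1 W2 : normedModType R) (p : W1 * W2) :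
  differentiable (snd : W1 * W2 -> W2) p.
Proof. by apply: linear_differentiable => x; exact: cvg_snd. Qed.

Lemma Ck1_fst (V W1 W2 : normedModType R) (U : set V) (G : V -> W1 * W2) :
  open U -> Ck 1 U G -> Ck 1 U (fun p => (G p).1).
Proof.
move=> oU [dG cG]; split=> [p Up|v p Up].
  by apply: (@differentiable_comp _ _ _ _ G fst); [exact: dG|exact: differentiable_fst].
apply: (@near_continuous _ _ _ (fun q => ('D_v G q).1)).
  have : nbhs p U by apply: open_nbhs_nbhs.
  apply: filterS => q Uq.
  by have [_ ->] := is_derive_fst (derivableP (@diff_derivable _ _ _ _ _ v (dG q Uq))).
by apply: (@continuous_comp _ _ _ ('D_v G) fst); [exact: cG|exact: cvg_fst].
Qed.

Lemma Ck1_snd (V W1 W2 : normedModType R) (U : set V) (G : V -> W1 * W2) :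
  open U -> Ck 1 U G -> Ck 1 U (fun p => (G p).2).
Proof.
move=> oU [dG cG]; split=> [p Up|v p Up].
  by apply: (@differentiable_comp _ _ _ _ G snd); [exact: dG|exact: differentiable_snd].
apply: (@near_continuous _ _ _ (fun q => ('D_v G q).2)).
  have : nbhs p U by apply: open_nbhs_nbhs.
  apply: filterS => q Uq.
  by have [_ ->] := is_derive_snd (derivableP (@diff_derivable _ _ _ _ _ v (dG q Uq))).
by apply: (@continuous_comp _ _ _ ('D_v G) snd); [exact: cG|exact: cvg_snd].
Qed.

Lemma Ck1B (V W : normedModType R) (U : set V) (f g : V -> W) :
  open U -> Ck 1 U f -> Ck 1 U g -> Ck 1 U (fun p => f p - g p).
Proof.
move=> oU [df cf] [dg cg]; split=> [p Up|v p Up].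
  by apply: (@differentiableB _ _ _ f g); [exact: df|exact: dg].
apply: (@near_continuous _ _ _ (fun q => 'D_v f q - 'D_v g q)).
  have : nbhs p U by apply: open_nbhs_nbhs.
  apply: filterS => q Uq.
  by rewrite (@deriveB _ _ _ f g) //; apply: diff_derivable; [exact: df|exact: dg].
by apply: cvgB; [exact: cf|exact: cg].
Qed.

Lemma is_derive_chain (V W X : normedModType R) (g : V -> W) (A : W -> X) (y v : V) (d : W) :
  is_derive y v g d -> differentiable A (g y) ->
  is_derive y v (fun z => A (g z)) ('d A (g y) d).
Proof.
move=> /is_derive_slice hg dA; apply/is_derive_slice.
set k := fun h : R => g (h *: v + y) in hg *.
have kE : k 0 = g y by rewrite /k scale0r add0r.
have dk : differentiable k 0 by apply/derivable1_diffP; case: hg.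
have dA' : differentiable A (k 0) by rewrite kE.
split; first by apply/derivable1_diffP; apply: (@differentiable_comp _ _ _ _ k A).
rewrite (_ : (fun h : R => _) = A \o k) // deriveE; last exact: differentiable_comp.
rewrite diff_comp//= kE; congr ('d A (g y) _).
by case: hg => _ <-; rewrite deriveE.
Qed.

Lemma bundle_metricE delta tau (q w : R * R * R) :
  bundle_metric (-1) delta tau q w = (w.1.1 ^+ 2 + w.1.2 ^+ 2) / delta q.1 ^+ 2 -
    (w.2 - calabi_potential delta tau q.1 * (q.1.2 * w.1.1 - q.1.1 * w.1.2)) ^+ 2.
Proof.
by case: q w => [[x y] z] [[dx dy] dz]; rewrite /bundle_metric/= !mulN1r mulNr.
Qed.

(** Near [p], [u] has C^1 first partials and a spacelike graph. The partials are existential, which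
    makes the notion visibly local. *)
Definition spacelike_at delta tau u (p : R * R) :=
  exists u1 u2 u1x u1y u2x u2y : R * R -> R, nbhs p [set q : R * R |
    [/\ forall v : R * R, is_derive q v u (v.1 * u1 q + v.2 * u2 q),
        C1at q u1 u1x u1y, C1at q u2 u2x u2y
      & forall v : R * R, v != 0 -> 0 < (v.1 ^+ 2 + v.2 ^+ 2) / delta q ^+ 2 -
          (v.1 * u1 q + v.2 * u2 q - calabi_potential delta tau q * (q.2 * v.1 - q.1 * v.2)) ^+ 2]].

Lemma near_spacelike_at delta tau u w p : nbhs p [set q : R * R | u q = w q] ->
  spacelike_at delta tau w p -> spacelike_at delta tau u p.
Proof.
move=> /nbhs_interior uw [u1 [u2 [u1x [u1y [u2x [u2y h]]]]]].
exists u1, u2, u1x, u1y, u2x, u2y; move: uw h; apply: filterS2 => q uq [dq c1 c2 pos].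
split => // v; apply: near_eq_is_derive (dq v).
by move: uq; apply: filterS => z.
Qed.

Lemma spacelike_atE delta tau u p (u1 := 'D_(1, 0) u) (u2 := 'D_(0, 1) u) :
  spacelike_at delta tau u p ->
  [/\ forall v : R * R, is_derive p v u (v.1 * u1 p + v.2 * u2 p),
      C1at p u1 ('D_(1, 0) u1) ('D_(0, 1) u1), C1at p u2 ('D_(1, 0) u2) ('D_(0, 1) u2) &
      forall v : R * R, v != 0 -> 0 < (v.1 ^+ 2 + v.2 ^+ 2) / delta p ^+ 2 -
        ('D_v u p - calabi_potential delta tau p * (p.2 * v.1 - p.1 * v.2)) ^+ 2].
Proof.
rewrite {}/u1 {}/u2 => -[u1 [u2 [u1x [u1y [u2x [u2y h]]]]]].
have dE q (x y : R) : (forall v : R * R, is_derive q v u (v.1 * x + v.2 * y)) ->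
    'D_(1, 0) u q = x /\ 'D_(0, 1) u q = y.
  by move=> d; have [_ ->] := d (1, 0); have [_ ->] := d (0, 1); rewrite !mul1r !mul0r addr0 add0r.
have C1E (w w1 w1x w1y : R * R -> R) :
    nbhs p [set q : R * R | w q = w1 q /\ C1at q w1 w1x w1y] -> C1at p w ('D_(1, 0) w) ('D_(0, 1) w).
  move=> hw; have [_ hp] := nbhs_singleton hw; apply: near_C1at hp.
  move/nbhs_interior : hw; apply: filterS => q hq; have [-> [_ d1 d2 _ _]] := nbhs_singleton hq.
  have e : \forall z \near q, w z = w1 z by move: hq; apply: filterS => z [].
  by split => //; rewrite (near_eq_derive _ e); [case: d1|case: d2].
have [du _ _ pos] := nbhs_singleton h; have [e1 e2] := dE _ _ _ du; split.
- by rewrite e1 e2.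
- by apply: (@C1E _ u1 u1x u1y); move: h; apply: filterS => q [/dE[E _] c1 _ _]; split.
- by apply: (@C1E _ u2 u2x u2y); move: h; apply: filterS => q [/dE[_ E] _ c2 _]; split.
by move=> v v0; have [_ ->] := du v; exact: pos.
Qed.

Lemma no_spacelike_everywhere Om delta tau u : conformal_domain Om delta -> smooth Om tau ->
  ((2^-1)%:E * cheeger Om delta < inf_abs Om tau)%E ->
  (forall p, Om p -> spacelike_at delta tau u p) -> False.
Proof.
move=> hM st hlt hu; apply: (no_spacelike_section hM st hlt (u := u)).
- by move=> p v /hu/spacelike_atE[].
- by eexists; eexists => p /hu/spacelike_atE[_ c1 _ _]; exact: c1.
- by eexists; eexists => p /hu/spacelike_atE[_ _ c2 _]; exact: c2.
by move=> p v /hu/spacelike_atE[_ _ _ pos]; exact: pos.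
Qed.

(** If the determinant vanishes, the vectors (- b, a) and (- d, c) are in the kernel, hence zero;
    then so is the matrix, and (1, 0) is in the kernel. *)
Lemma det_neq0 (a b c d : R) :
  (forall v : R * R, v.1 * a + v.2 * b = 0 -> v.1 * c + v.2 * d = 0 -> v = 0) ->
  a * d - b * c != 0.
Proof.
move=> kill; apply/eqP => j.
have [ab E] : - b = 0 /\ a = 0.
  suff : (- b, a) = 0 by case.
  by apply: kill => /=; [ring|rewrite -j; ring].
have [cd E'] : - d = 0 /\ c = 0.
  suff : (- d, c) = 0 by case.
  by apply: kill => /=; [rewrite -[RHS]oppr0 -j; ring|ring].
have : (1, 0) = 0 :> R * R.
  by apply: kill => /=; rewrite ?E ?E' mulr0 mul0r addr0.
by case=> /eqP; rewrite oner_eq0.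
Qed.

Lemma cramer2 (a b c d x y w1 w2 : R) (j := a * d - b * c)
    (n1 := (d * w1 - b * w2) / j) (n2 := (a * w2 - c * w1) / j) : j != 0 ->
  [/\ n1 * a + n2 * b = w1, n1 * c + n2 * d = w2 &
    n1 * x + n2 * y = w1 * ((d * x - c * y) * j^-1) + w2 * ((a * y - b * x) * j^-1)].
Proof. by rewrite /n1 /n2 /j => j0; split; field. Qed.

(** Local inversion of the projected chart: the inverse [g] turns the third coordinate into a height
    function over the base. *)
Lemma chart_section delta tau U (Psi : R * R -> R * R * R) p0 :
  open U -> Ck 2 U Psi -> spacelike_param delta tau U Psi -> U p0 ->
  exists V (r : R) (g : R * R -> R * R), [/\ open V, V p0, V `<=` U, 0 < r & g (Psi p0).1 = p0] /\
  [/\ forall p q, V p -> V q -> (Psi p).1 = (Psi q).1 -> p = q,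
    forall y, ball (Psi p0).1 r y -> [/\ V (g y), (Psi (g y)).1 = y & {for y, continuous g}] &
    forall y, ball (Psi p0).1 r y -> spacelike_at delta tau (fun z => (Psi (g z)).2) y].
Proof.
move=> oU [dPsi C1Psi] sp Up0.
pose F1 p := (Psi p).1.1; pose F2 p := (Psi p).1.2; pose Z p := (Psi p).2.
pose a p := ('D_(1, 0) Psi p).1.1; pose b p := ('D_(0, 1) Psi p).1.1.
pose c p := ('D_(1, 0) Psi p).1.2; pose d p := ('D_(0, 1) Psi p).1.2.
pose zx p := ('D_(1, 0) Psi p).2; pose zy p := ('D_(0, 1) Psi p).2.
have Ck11 v : Ck 1 U (fun p => ('D_v Psi p).1.1) by do 2! apply: Ck1_fst => //; exact: C1Psi.
have Ck12 v : Ck 1 U (fun p => ('D_v Psi p).1.2).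
  by apply: Ck1_snd => //; apply: Ck1_fst => //; exact: C1Psi.
have Ck13 v : Ck 1 U (fun p => ('D_v Psi p).2) by apply: Ck1_snd => //; exact: C1Psi.
have dv p v : U p -> 'D_v Psi p = v.1 *: 'D_(1, 0) Psi p + v.2 *: 'D_(0, 1) Psi p.
  move=> Up; have dp := dPsi p Up; rewrite !deriveE//.
  rewrite [X in 'd Psi p X = _](_ : v = v.1 *: (1, 0) + v.2 *: (0, 1)).
    by rewrite linearD !linearZ.
  by case: v => x y /=; congr pair; rewrite /= /GRing.scale/=; ring.
have dF1 p : U p -> C1at p F1 a b.
  move=> Up; have D v := is_derive_fst (is_derive_fst (derivableP (@diff_derivable _ _ _ _ _ v (dPsi p Up)))).
  split; [|exact: (D (1, 0))|exact: (D (0, 1))| |].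
  - apply: (@continuous_comp _ _ _ (fun p => (Psi p).1) fst); last exact: cvg_fst.
    by apply: (@continuous_comp _ _ _ Psi fst); [exact/differentiable_continuous/dPsi|exact: cvg_fst].
  - by have [/(_ p Up)/differentiable_continuous] := Ck11 (1, 0).
  - by have [/(_ p Up)/differentiable_continuous] := Ck11 (0, 1).
have dF2 p : U p -> C1at p F2 c d.
  move=> Up; have D v := is_derive_snd (is_derive_fst (derivableP (@diff_derivable _ _ _ _ _ v (dPsi p Up)))).
  split; [|exact: (D (1, 0))|exact: (D (0, 1))| |].
  - apply: (@continuous_comp _ _ _ (fun p => (Psi p).1) snd); last exact: cvg_snd.
    by apply: (@continuous_comp _ _ _ Psi fst); [exact/differentiable_continuous/dPsi|exact: cvg_fst].
  - by have [/(_ p Up)/differentiable_continuous] := Ck12 (1, 0).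
  - by have [/(_ p Up)/differentiable_continuous] := Ck12 (0, 1).
have hD p v : U p -> 'D_v Psi p =
    (v.1 * a p + v.2 * b p, v.1 * c p + v.2 * d p, v.1 * zx p + v.2 * zy p).
  by move=> Up; rewrite dv// [LHS]surjective_pairing [X in (X, _)]surjective_pairing.
have Ca : Ck 1 U a := Ck11 (1, 0). have Cb : Ck 1 U b := Ck11 (0, 1).
have Cc : Ck 1 U c := Ck12 (1, 0). have Cd : Ck 1 U d := Ck12 (0, 1).
have Cx : Ck 1 U zx := Ck13 (1, 0). have Cy : Ck 1 U zy := Ck13 (0, 1).
clear Ck11 Ck12 Ck13 dv; clearbody a b c d zx zy.
(* A vector with zero horizontal part is vertical, where the metric is minus a square; on a
   spacelike surface it must be 0. *)
have kill p v : U p -> v.1 * a p + v.2 * b p = 0 -> v.1 * c p + v.2 * d p = 0 -> v = 0.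
  move=> Up e1 e2; apply/eqP/negPn/negP => v0.
  have := sp p Up v v0; rewrite bundle_metricE hD//=.
  rewrite e1 e2 !expr0n addr0 mul0r sub0r oppr_gt0 => h.
  by have := le_lt_trans (sqr_ge0 _) h; rewrite ltxx.
have j0 p : U p -> jac a b c d p != 0.
  by move=> Up; apply: det_neq0 => v; exact: kill.
have [V [r [g [[oV Vp0 VU r0] [_ inj hg gp0 dg]]]]] := local_inverse oU Up0 dF1 dF2 (j0 p0 Up0).
exists V, r, g; split; first by split => //; rewrite (surjective_pairing (Psi p0).1).
split.
- by move=> p q Vp Vq e; apply: inj => //; rewrite /F1 /F2 e.
- move=> y; rewrite (surjective_pairing (Psi p0).1) => yr.
  have [Vg e1 e2] := hg y yr; have [cg _] := dg y yr; split => //.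
  by rewrite (surjective_pairing (Psi _).1); move: e1 e2; rewrite /F1 /F2 => -> ->; rewrite -surjective_pairing.
move=> y; rewrite (surjective_pairing (Psi p0).1) => yr.
(* [A1] and [A2], composed with [g], are the partial derivatives of the height, by Cramer's rule. *)
pose A1 p := (d p * zx p - c p * zy p) * (jac a b c d p)^-1.
pose A2 p := (a p * zy p - b p * zx p) * (jac a b c d p)^-1.
have Cj : Ck 1 U (fun p => (jac a b c d p)^-1).
  exact: (Ck1V oU j0 (Ck1B oU (Ck1M oU Ca Cd) (Ck1M oU Cb Cc))).
have CA1 : Ck 1 U A1 by exact: (Ck1M oU (Ck1B oU (Ck1M oU Cd Cx) (Ck1M oU Cc Cy)) Cj).
have CA2 : Ck 1 U A2 by exact: (Ck1M oU (Ck1B oU (Ck1M oU Ca Cy) (Ck1M oU Cb Cx)) Cj).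
pose nu (w y : R * R) : R * R := ((d (g y) * w.1 - b (g y) * w.2) / jac a b c d (g y),
  (a (g y) * w.2 - c (g y) * w.1) / jac a b c d (g y)).
have nbr : nbhs y (ball (F1 p0, F2 p0) r) by apply: open_nbhs_nbhs; split => //; exact: ball_open.
have C1g (A : R * R -> R) q : Ck 1 U A -> ball (F1 p0, F2 p0) r q -> C1at q (fun q => A (g q))
   (fun q => (nu (1, 0) q).1 * 'D_(1, 0) A (g q) + (nu (1, 0) q).2 * 'D_(0, 1) A (g q))
   (fun q => (nu (0, 1) q).1 * 'D_(1, 0) A (g q) + (nu (0, 1) q).2 * 'D_(0, 1) A (g q)).
  move=> [dA cA] qr; have [cg dgw] := dg q qr; have [Vg _ _] := hg q qr.
  have Ug := VU _ Vg.
  have comp (B : R * R -> R) : {for g q, continuous B} -> {for q, continuous (fun q => B (g q))}.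
    by move=> cB; apply: (@continuous_comp _ _ _ g B).
  have cj : {for q, continuous (fun q => (jac a b c d (g q))^-1)}.
    apply: cvgV; first exact: j0.
    by apply: cvgB; apply: cvgM; apply: comp; first [by case: (dF1 _ Ug)|by case: (dF2 _ Ug)].
  have ca := comp _ (let: And5 _ _ _ x _ := dF1 _ Ug in x).
  have cb := comp _ (let: And5 _ _ _ _ x := dF1 _ Ug in x).
  have cc := comp _ (let: And5 _ _ _ x _ := dF2 _ Ug in x).
  have cd := comp _ (let: And5 _ _ _ _ x := dF2 _ Ug in x).
  have cn1 w : {for q, continuous (fun q => (nu w q).1)}.
    exact: cvgM (cvgB (cvgM cd (cvg_cst _)) (cvgM cb (cvg_cst _))) cj.
  have cn2 w : {for q, continuous (fun q => (nu w q).2)}.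
    exact: cvgM (cvgB (cvgM ca (cvg_cst _)) (cvgM cc (cvg_cst _))) cj.
  split.
  - exact/comp/differentiable_continuous/dA.
  - have := is_derive_chain (dgw (1, 0)) (dA _ Ug); rewrite -deriveE; last exact: dA.
    by rewrite deriveE2; last exact: dA.
  - have := is_derive_chain (dgw (0, 1)) (dA _ Ug); rewrite -deriveE; last exact: dA.
    by rewrite deriveE2; last exact: dA.
  - exact: cvgD (cvgM (cn1 _) (comp _ (cA (1, 0) _ Ug))) (cvgM (cn2 _) (comp _ (cA (0, 1) _ Ug))).
  - exact: cvgD (cvgM (cn1 _) (comp _ (cA (1, 0) _ Ug))) (cvgM (cn2 _) (comp _ (cA (0, 1) _ Ug))).
exists (fun q => A1 (g q)), (fun q => A2 (g q)),
  (fun q => (nu (1, 0) q).1 * 'D_(1, 0) A1 (g q) + (nu (1, 0) q).2 * 'D_(0, 1) A1 (g q)),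
  (fun q => (nu (0, 1) q).1 * 'D_(1, 0) A1 (g q) + (nu (0, 1) q).2 * 'D_(0, 1) A1 (g q)),
  (fun q => (nu (1, 0) q).1 * 'D_(1, 0) A2 (g q) + (nu (1, 0) q).2 * 'D_(0, 1) A2 (g q)),
  (fun q => (nu (0, 1) q).1 * 'D_(1, 0) A2 (g q) + (nu (0, 1) q).2 * 'D_(0, 1) A2 (g q)).
move: nbr; apply: filterS => q qr.
have [Vg e1 e2] := hg q qr; have [cg dgw] := dg q qr; have Ug := VU _ Vg.
have jg := j0 _ Ug.
(* The chart sends [nu v q] to the tangent vector of the graph lying over [v]. *)
have E v : ('d Psi (g q) (nu v q)) = (v.1, v.2, v.1 * A1 (g q) + v.2 * A2 (g q)).
  rewrite -deriveE; last exact: dPsi.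
  rewrite hD//; congr (_, _, _).
  - by have [k _ _] := cramer2 0 0 v.1 v.2 jg; exact: k.
  - by have [_ k _] := cramer2 0 0 v.1 v.2 jg; exact: k.
  - by have [_ _ k] := cramer2 (zx (g q)) (zy (g q)) v.1 v.2 jg; exact: k.
split.
- move=> v; have := is_derive_snd (is_derive_chain (dgw v) (dPsi _ Ug)).
  by rewrite -/(nu v q) E.
- exact: C1g CA1 qr.
- exact: C1g CA2 qr.
move=> v v0; have n0 : nu v q != 0.
  apply/eqP => n0; have := E v; rewrite n0 linear0 => -[h1 h2 _].
  by move: v0; rewrite (surjective_pairing v) -h1 -h2 eqxx.
have := sp _ Ug _ n0; rewrite deriveE; last exact: dPsi.
rewrite E bundle_metricE /=.
by have -> : (Psi (g q)).1 = q by rewrite (surjective_pairing (Psi _).1); move: e1 e2; rewrite /F1 /F2 => -> ->; rewrite -surjective_pairing.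
Qed.

End chart.

(** * Lifting of segments to a complete spacelike surface *)

Section swing.
Context {R : realType}.

(* A smooth map from R onto [0, 1], so that paths defined on the whole of R can
   run inside a segment. *)
Definition swing (t : R) : R := sin (pi / 2 * t) ^+ 2.

Lemma swing0 : swing 0 = 0. Proof. by rewrite /swing mulr0 sin0 expr0n. Qed.
Lemma swing1 : swing 1 = 1. Proof. by rewrite /swing mulr1 sin_pihalf expr1n. Qed.

Lemma swing_itv t : 0 <= swing t <= 1.
Proof.
apply/andP; split; first exact: sqr_ge0.
by rewrite -(cos2Dsin2 (pi / 2 * t)) /swing lerDr sqr_ge0.
Qed.

Definition dswing (t : R) : R := pi * (sin (pi / 2 * t) * cos (pi / 2 * t)).

Lemma is_derive_swing (t : R) : is_derive t 1 swing (dswing t).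
Proof.
rewrite /swing; apply: is_derive_eq; rewrite /dswing /GRing.scale/=.
by field.
Qed.

Lemma continuous_dswing : continuous dswing.
Proof.
move=> t; have cm : {for t, continuous (fun t : R => pi / 2 * t)}.
  by apply: cvgM; [exact: cvg_cst|exact: cvg_id].
apply: cvgM; first exact: cvg_cst.
apply: cvgM.
  by apply: (@continuous_comp _ _ _ (fun t : R => pi / 2 * t) sin) => //; exact: continuous_sin.
by apply: (@continuous_comp _ _ _ (fun t : R => pi / 2 * t) cos) => //; exact: continuous_cos.
Qed.

Lemma continuous_swing : continuous swing.
Proof. by move=> t; apply/differentiable_continuous/derivable1_diffP; case: (is_derive_swing t). Qed.

Lemma dswing_le t : `|dswing t| <= pi.
Proof.
rewrite /dswing normrM ger0_norm ?pi_ge0// -[leRHS]mulr1 ler_wpM2l ?pi_ge0//.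
rewrite normrM -[leRHS]mulr1; apply: ler_pM => //.
  by rewrite ler_norml sin_geN1 sin_le1.
by rewrite ler_norml cos_geN1 cos_le1.
Qed.

End swing.

(** * Sections of the projection and their uniqueness *)

Section sections.
Context {R : realType}.
Variables (Om : set (R * R)) (delta tau : R * R -> R).
Variables (S : topologicalType) (f : S -> R * R * R).
Hypothesis hS : spacelike_surface Om delta tau f.

Definition proj s := (f s).1.

Lemma local_section s : exists N (r : R) (G : R * R -> S),
  [/\ open N, N s, 0 < r & G (proj s) = s] /\
  [/\ forall x y, N x -> N y -> proj x = proj y -> x = y,
    forall y, ball (proj s) r y -> [/\ N (G y), proj (G y) = y & {for y, continuous G}] &
    forall y, ball (proj s) r y -> spacelike_at delta tau (fun z => (f (G z)).2) y].
Proof.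
have [[_ _ _ _ par] sp] := hS; have [U [phi [lp [p0 Up0 <-]]]] := par s.
have [oU cphi _ ophi [C2 _]] := lp.
have [V [r [g [[oV Vp0 VU r0 gp0] [inj hg hu]]]]] := chart_section oU C2 (sp _ _ lp) Up0.
exists (phi @` V), r, (phi \o g); split.
  by split => //; [exact: ophi|rewrite /= gp0].
split=> //.
- by move=> _ _ [p Vp <-] [q Vq <-] e; rewrite (inj p q).
move=> y yr; have [Vg e cg] := hg y yr; split => //; first by exists (g y).
by apply: continuous_comp => //; apply: cphi; exact: VU.
Qed.

(** Continuity is read off in a chart: [f \o phi] is differentiable, and [phi] maps open subsets of
    its domain to open sets. *)
Lemma proj_continuous : continuous proj.
Proof.
move=> s.
have [[_ _ _ _ par] sp] := hS; have [U [phi [lp [p0 Up0 <-]]]] := par s.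
have [oU cphi inj ophi [[dPsi _] _]] := lp.
move=> A Af; rewrite /nbhs/=.
have : nbhs p0 ((proj \o phi) @^-1` A).
  have : {for p0, continuous (proj \o phi)}.
    apply: (@continuous_comp _ _ _ (f \o phi) fst); last exact: cvg_fst.
    exact/differentiable_continuous/dPsi.
  by apply.
move=> h; have : nbhs p0 (((proj \o phi) @^-1` A) `&` U) by apply: filterI => //; exact: open_nbhs_nbhs.
rewrite nbhsE => -[V [oV Vp0] VA].
have oV' : open (phi @` V) by apply: ophi => // p /VA[].
apply: (@filterS _ (nbhs (phi p0)) _ (phi @` V)); first by move=> _ [p /VA[? _] <-].
by apply: open_nbhs_nbhs; split => //; exists p0.
Qed.

(** The set where the lifts agree is open by local injectivity of the projection, closed because [S]
    is Hausdorff, and the line is connected. *)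
Lemma lift_unique (alpha beta : R -> S) t0 : continuous alpha -> continuous beta ->
  (forall t, proj (alpha t) = proj (beta t)) -> alpha t0 = beta t0 -> forall t, alpha t = beta t.
Proof.
move=> ca cb e e0.
suff E : [set t | alpha t = beta t] = setT by move=> t; have : [set: R] t by []; rewrite -E.
have [[hS' _ _ _ _] _] := hS.
have /connected_intervalP cT : is_interval [set: R] by [].
apply: cT; first by exists t0.
- exists [set t | alpha t = beta t]; last by rewrite setTI.
  rewrite openE => t /= et.
  have [N [r [G [[oN Ns r0 _] [inj _ _]]]]] := local_section (alpha t).
  have na : nbhs t (alpha @^-1` N) by apply: (ca t); exact: open_nbhs_nbhs.
  have nb : nbhs t (beta @^-1` N) by apply: (cb t); apply: open_nbhs_nbhs; rewrite -et.
  by move: na nb; apply: filterS2 => x /= ha hb; exact: inj.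
exists [set t | alpha t = beta t]; last by rewrite setTI.
rewrite -[X in closed X]setCK; apply: open_closedC.
rewrite openE => t /= /eqP et.
move: hS'; rewrite open_hausdorff => /(_ _ _ et)[[A B] /= [tA tB] [oA oB /eqP AB]].
rewrite !inE in tA tB.
have na : nbhs t (alpha @^-1` A) by apply: (ca t); exact: open_nbhs_nbhs.
have nb : nbhs t (beta @^-1` B) by apply: (cb t); exact: open_nbhs_nbhs.
move: na nb; apply: filterS2 => x /= ha hb E.
have : (A `&` B) (alpha x) by split => //; rewrite E.
by rewrite AB.
Qed.

Definition is_section (W : set (R * R)) (sigma : R * R -> S) :=
  forall p, W p -> {for p, continuous sigma} /\ proj (sigma p) = p.

Definition convex2 (W : set (R * R)) :=
  forall p q (t : R), W p -> W q -> 0 <= t <= 1 -> W (p + t *: (q - p)).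

Lemma continuous_segment (p q : R * R) (h : R -> R) : continuous h ->
  continuous (fun t => p + h t *: (q - p)).
Proof. by move=> ch t; apply: cvgD; [exact: cvg_cst|apply: cvgZr_tmp; exact: ch]. Qed.

(** The segment from [p] to [q] lies in both convex sets, and the two sections restrict to lifts of
    it; [swing] keeps the path inside for all real parameters. *)
Lemma section_unique W1 W2 sigma1 sigma2 p : is_section W1 sigma1 -> is_section W2 sigma2 ->
  convex2 W1 -> convex2 W2 -> W1 p -> W2 p -> sigma1 p = sigma2 p ->
  forall q, W1 q -> W2 q -> sigma1 q = sigma2 q.
Proof.
move=> s1 s2 c1 c2 p1 p2 e q q1 q2.
pose ga (t : R) := p + swing t *: (q - p).
have g1 t : W1 (ga t) by apply: c1 => //; exact: swing_itv.
have g2 t : W2 (ga t) by apply: c2 => //; exact: swing_itv.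
have cg : continuous ga by apply: continuous_segment; exact: continuous_swing.
have : forall t, sigma1 (ga t) = sigma2 (ga t).
  apply: (@lift_unique _ _ 0).
  - by move=> t; apply: (@continuous_comp _ _ _ ga sigma1); [exact: cg|exact: (s1 _ (g1 t)).1].
  - by move=> t; apply: (@continuous_comp _ _ _ ga sigma2); [exact: cg|exact: (s2 _ (g2 t)).1].
  - by move=> t; rewrite (s1 _ (g1 t)).2 (s2 _ (g2 t)).2.
  - by rewrite /ga swing0 scale0r addr0.
by move=> /(_ 1); rewrite /ga swing1 scale1r addrC subrK.
Qed.

(** Near [p] the section takes values in a set where the projection is injective, so it coincides
    with the local section. *)
Lemma section_spacelike W sigma p : is_section W sigma -> open W -> W p ->
  spacelike_at delta tau (fun z => (f (sigma z)).2) p.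
Proof.
move=> hs oW Wp; have [cs ps] := hs p Wp.
have [N [r [G [[oN Ns r0 _] [inj hG hu]]]]] := local_section (sigma p).
rewrite ps in hG hu.
apply: near_spacelike_at (hu p (ballxx _ r0)).
have nN : nbhs p (sigma @^-1` N) by apply: cs; exact: open_nbhs_nbhs.
have nW : nbhs p W by exact: open_nbhs_nbhs.
have nB : nbhs p (ball p r) by exact: nbhsx_ballx.
move: nN nW nB; apply: filterS3 => q /= Nq Wq Bq.
have [NG pG _] := hG q Bq; have [_ pq] := hs q Wq.
by rewrite (inj _ _ Nq NG) // pG pq.
Qed.

Lemma ball_convex2 (p : R * R) r : convex2 (ball p r).
Proof.
move=> q1 q2 t; rewrite -!ball_normE /= => h1 h2 /andP[t0 t1].
have -> : p - (q1 + t *: (q2 - q1)) = (1 - t) *: (p - q1) + t *: (p - q2).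
  by case: p q1 q2 {h1 h2} => ? ? [? ?] [? ?]; congr pair; rewrite /= /GRing.scale/=; ring.
apply: le_lt_trans (ler_normD _ _) _; rewrite !normrZ !ger0_norm ?subr_ge0//.
have [t00|tp] := eqVneq t 0.
  by rewrite t00 subr0 mul1r mul0r addr0.
have tp' : 0 < t by rewrite lt_neqAle eq_sym tp.
have : t * `|p - q2| < t * r by rewrite ltr_pM2l.
have : (1 - t) * `|p - q1| <= (1 - t) * r by rewrite ler_wpM2l ?subr_ge0// ltW.
move: (t * `|_|) ((1 - t) * `|_|); rewrite mulrBl mul1r; move: (t * r) => x y z h3 h4.
lra'.
Qed.

End sections.

(** * Length of a lifted segment *)

Section distance.
Context {R : realType}.
Variables (Om : set (R * R)) (delta tau : R * R -> R).
Variables (S : topologicalType) (f : S -> R * R * R).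
Hypotheses (hM : conformal_domain Om delta) (st : smooth Om tau).
Hypothesis hS : spacelike_surface Om delta tau f.
Notation proj := (proj f).

Lemma is_derive_line (V W : normedModType R) (g : V -> W) (x v : V) (t : R) (d : W) :
  is_derive (t *: v + x) v g d -> is_derive t 1 (fun h : R => g (h *: v + x)) d.
Proof.
move=> /is_derive_slice h; apply/is_derive_slice; move: h.
congr is_derive; apply/funext => h.
by rewrite scalerDl addrA -[h *: 1]/(h * 1) mulr1.
Qed.

Lemma is_derive1_Ck1 (W : normedModType R) (g dg : R -> W) :
  (forall t : R, is_derive t 1 g (dg t)) -> continuous dg -> Ck 1 setT g.
Proof.
move=> d cd; have dF t : differentiable g t by apply/derivable1_diffP; case: (d t).
split=> [t _|v t _]; first exact: dF.
have -> : 'D_v g = (fun t => v *: dg t).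
  apply/funext => s; rewrite deriveE//; have [_ <-] := d s; rewrite deriveE//.
  by rewrite -linearZ; congr ('d g s _); rewrite /GRing.scale/= mulr1.
by apply: cvgZl_tmp; exact: cd.
Qed.

(** The Lorentzian metric subtracts a square, so the lift is no longer than its projection measured
    in [M]. The constant is generous: [pi] bounds the derivative of [swing], and 2 covers the
    passage from the max norm to the Euclidean one. *)
Lemma segment_dist W sigma p q (m : R) : is_section f W sigma -> open W -> 0 < m ->
  (forall t, 0 <= t <= 1 -> W (p + t *: (q - p)) /\ m <= delta (p + t *: (q - p))) ->
  (surface_dist delta tau f (sigma p) (sigma q) <= (pi * (2 * `|q - p| / m))%:E)%E.
Proof.
move=> hs oW m0 hseg; have [oO sO sd d0] := hM; have [[_ _ _ fOm _] _] := hS.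
have [Cx [Cy hC]] := calabi_C1 hM st.
set w := q - p in hseg *.
pose ga (t : R) := p + swing t *: w.
have Wg t : W (ga t) by have [] := hseg _ (swing_itv t).
have mg t : m <= delta (ga t) by have [] := hseg _ (swing_itv t).
have cg : continuous ga by apply: continuous_segment; exact: continuous_swing.
have Og z : W z -> Om z by move=> Wz; have [_ <-] := hs z Wz; exact: fOm.
pose u z := (f (sigma z)).2.
pose u1 := 'D_(1, 0) u; pose u2 := 'D_(0, 1) u.
have hu z (Wz : W z) := spacelike_atE (section_spacelike hS hs oW Wz).
have cu1 z : W z -> {for z, continuous u1} by move=> /hu[_ [? _ _ _ _] _ _].
have cu2 z : W z -> {for z, continuous u2} by move=> /hu[_ _ [? _ _ _ _] _].
pose C := calabi_potential delta tau.
have cC z : W z -> {for z, continuous C} by move=> /Og/hC[[]].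
pose c t := sigma (ga t).
have pc t : (f (c t)).1 = ga t by have [] := hs _ (Wg t).
have fc t : f (c t) = (ga t, u (ga t)) by rewrite [LHS]surjective_pairing pc.
pose U t := w.1 * u1 (ga t) + w.2 * u2 (ga t).
pose D t : R * R * R := (dswing t * w.1, dswing t * w.2, dswing t * U t).
have dga (t : R) : is_derive t 1 ga (dswing t *: w).
  have h (x y : R) : is_derive t 1 (fun t => x + swing t * y) (dswing t * y).
    have ds := is_derive_swing t; apply: is_derive_eq.
    by rewrite /GRing.scale/=; ring.
  exact: (is_derive_pair (h p.1 w.1) (h p.2 w.2)).
have du (t : R) : is_derive t 1 (fun t => u (ga t)) (dswing t * U t).
  have -> : (fun t => u (ga t)) = (fun t => u (swing t *: w + p)).
    by apply/funext => x; rewrite /ga addrC.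
  rewrite mulrC; apply: (is_derive_comp1 (g := fun h => u (h *: w + p)) (is_derive_swing t)).
  apply: is_derive_line; rewrite addrC -/(ga t).
  by have [d _ _ _] := hu _ (Wg t); exact: d.
have df (t : R) : is_derive t 1 (f \o c) (D t).
  rewrite (_ : f \o c = (fun t => (ga t, u (ga t)))); last by apply/funext.
  exact: (is_derive_pair (dga t) (du t)).
have cU : continuous U.
  move=> t; apply: cvgD; apply: cvgM; try exact: cvg_cst.
    by apply: (@continuous_comp _ _ _ ga u1); [exact: cg|exact: cu1].
  by apply: (@continuous_comp _ _ _ ga u2); [exact: cg|exact: cu2].
have cD : continuous D.
  move=> t; apply: (@continuous_at_pair _ _ _ (fun t => dswing t *: w) (fun t => dswing t * U t)).
    by apply: cvgZr_tmp; exact: continuous_dswing.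
  by apply: cvgM; [exact: continuous_dswing|exact: cU].
have path : surface_path f (sigma p) (sigma q) c.
  split.
  - by move=> t; apply: (@continuous_comp _ _ _ ga sigma); [exact: cg|exact: (hs _ (Wg t)).1].
  - exact: is_derive1_Ck1 df cD.
  - by rewrite /c /ga swing0 scale0r addr0.
  - by rewrite /c /ga swing1 scale1r /w addrC subrK.
pose Q z := (w.1 ^+ 2 + w.2 ^+ 2) / delta z ^+ 2 -
  (w.1 * u1 z + w.2 * u2 z - C z * (z.2 * w.1 - z.1 * w.2)) ^+ 2.
have speedE t : bundle_metric (-1) delta tau (f (c t)) ('D_1 (f \o c) t) = dswing t ^+ 2 * Q (ga t).
  have [_ ->] := df t; rewrite bundle_metricE pc.
  have key (x i y w1 w2 z1 z2 r : R) :
      ((x * w1) ^+ 2 + (x * w2) ^+ 2) * i - (x * r - y * (z2 * (x * w1) - z1 * (x * w2))) ^+ 2 =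
      x ^+ 2 * ((w1 ^+ 2 + w2 ^+ 2) * i - (r - y * (z2 * w1 - z1 * w2)) ^+ 2) by ring.
  exact: key.
have cQ z : W z -> {for z, continuous Q}.
  move=> Wz; have cd : {for z, continuous delta} by apply: (sd 0); exact: Og.
  apply: cvgB.
    apply: cvgM; first exact: cvg_cst.
    by apply: cvgV; [rewrite expf_neq0// gt_eqF// d0//; exact: Og|exact: cvgM].
  have cB : {for z, continuous (fun z => w.1 * u1 z + w.2 * u2 z - C z * (z.2 * w.1 - z.1 * w.2))}.
    apply: cvgB.
      by apply: cvgD; apply: cvgM; [exact: cvg_cst|exact: cu1|exact: cvg_cst|exact: cu2].
    apply: cvgM; first exact: cC.
    by apply: cvgB; apply: cvgM; [exact: cvg_snd|exact: cvg_cst|exact: cvg_fst|exact: cvg_cst].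
  exact: (cvgM cB cB).
have csp : continuous (fun t => Num.sqrt (dswing t ^+ 2 * Q (ga t))).
  move=> t; apply: (@continuous_comp _ _ _ (fun t => dswing t ^+ 2 * Q (ga t)) Num.sqrt);
    last exact: sqrt_continuous.
  apply: cvgM; first by apply: cvgM; exact: continuous_dswing.
  by apply: (@continuous_comp _ _ _ ga Q); [exact: cg|exact: cQ].
apply: le_trans (_ : (surface_path_length delta tau f c)%:E <= _)%E.
  by apply: ereal_inf_lbound; exists c.
rewrite lee_fin /surface_path_length.
rewrite (_ : (fun t => _) = (fun t => Num.sqrt (dswing t ^+ 2 * Q (ga t)))); last first.
  by apply/funext => t; rewrite speedE.
apply: le_trans (ler_norm _) _; apply: Rintegral01_le.
  by apply: integrable_within; exact: continuous_subspaceT.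
move=> t _; rewrite ger0_norm ?sqrtr_ge0// sqrtrM ?sqr_ge0// sqrtr_sqr.
apply: ler_pM => //; first exact: dswing_le.
have n0 : 0 <= 2 * `|w| / m by rewrite divr_ge0 ?mulr_ge0// ltW.
rewrite -(ger0_norm n0) -sqrtr_sqr ler_wsqrtr//.
apply: (@le_trans _ _ ((w.1 ^+ 2 + w.2 ^+ 2) / delta (ga t) ^+ 2)); first by rewrite gerBl sqr_ge0.
rewrite expr_div_n; apply: ler_pM.
- by rewrite addr_ge0// sqr_ge0.
- by rewrite invr_ge0 sqr_ge0.
- have h (x : R) : `|x| <= `|w| -> x ^+ 2 <= `|w| ^+ 2 by rewrite -real_normK ?num_real// ler_sqr ?nnegrE.
  apply: le_trans (lerD (h _ (norm_fst w)) (h _ (norm_snd w))) _.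
  by rewrite exprMn; move: (sqr_ge0 `|w|); move: (`|w| ^+ 2) => x x0; lra'.
- rewrite lef_pV2 ?posrE ?exprn_gt0//; last exact: lt_le_trans (mg t).
  by rewrite ler_sqr ?nnegrE; [exact: mg|exact: ltW|exact/ltW/(lt_le_trans m0 (mg t))].
Qed.

End distance.

Lemma ltr_dist_pos (R : realType) (x y e : R) : 0 < x < e -> 0 < y < e -> `|x - y| < e.
Proof.
move=> /andP[x0 xe] /andP[y0 ye]; rewrite ltr_norml; apply/andP; split; lra'.
Qed.

Lemma ler_dist_between (R : realType) (x y z d : R) :
  `|z - x| < d -> x < y -> y <= z + d -> `|y - z| <= d.
Proof.
move=> h xy yz; rewrite ler_norml; apply/andP; split; last by lra'.
by move: h; rewrite ltr_norml => /andP[_ h]; lra'.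
Qed.

(** * Continuation of lifts and the global section *)

Section lifting.
Context {R : realType}.
Variables (Om : set (R * R)) (delta tau : R * R -> R).
Variables (S : topologicalType) (f : S -> R * R * R).
Hypotheses (hM : conformal_domain Om delta) (st : smooth Om tau).
Hypotheses (hS : spacelike_surface Om delta tau f) (hC : complete_surface delta tau f).

Lemma section_glue W1 W2 sigma1 sigma2 : open W1 -> open W2 ->
  is_section f W1 sigma1 -> is_section f W2 sigma2 ->
  (forall q, W1 q -> W2 q -> sigma1 q = sigma2 q) ->
  exists2 sigma, is_section f (W1 `|` W2) sigma & forall q, W1 q -> sigma q = sigma1 q.
Proof.
move=> o1 o2 s1 s2 e.
pose sigma q := if `[< W1 q >] then sigma1 q else sigma2 q.
have E1 q : W1 q -> sigma q = sigma1 q by move=> h; rewrite /sigma asboolT.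
have E2 q : W2 q -> sigma q = sigma2 q.
  by move=> h; rewrite /sigma; case: asboolP => // h1; exact: e.
exists sigma => // p [Wp|Wp].
  rewrite E1//; have [cs ps] := s1 p Wp; split => //.
  apply: near_continuous cs; have : nbhs p W1 by exact: open_nbhs_nbhs.
  by apply: filterS => q; exact: E1.
rewrite E2//; have [cs ps] := s2 p Wp; split => //.
apply: near_continuous cs; have : nbhs p W2 by exact: open_nbhs_nbhs.
by apply: filterS => q; exact: E2.
Qed.

(** An open convex thickening of the initial part of a segment, as [section_unique] requires; for
    [T = 0] it is a ball. *)
Definition tube (a b : R * R) (T e : R) : set (R * R) :=
  [set q | exists2 t : R, 0 <= t <= T & `|q - (a + t *: (b - a))| < e].

Lemma open_tube a b T e : open (tube a b T e).
Proof.
rewrite (_ : tube a b T e = \bigcup_(t in [set t | 0 <= t <= T]) ball (a + t *: (b - a)) e).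
  by apply: bigcup_open => t _; exact: ball_open.
apply/seteqP; split=> q; first by case=> t h1 h2; exists t => //; rewrite -ball_normE /= distrC.
by case=> t h1; rewrite -ball_normE /= distrC; exists t.
Qed.

Lemma convex_tube a b T e : convex2 (tube a b T e).
Proof.
move=> p q r [t /andP[t0 tT] hp] [s /andP[s0 sT] hq] /andP[r0 r1].
exists (t + r * (s - t)).
  have -> : t + r * (s - t) = (1 - r) * t + r * s by ring.
  have r1' : 0 <= 1 - r by rewrite subr_ge0.
  rewrite addr_ge0 ?mulr_ge0//=.
  have -> : T = (1 - r) * T + r * T by ring.
  by apply: lerD; apply: ler_wpM2l.
have := @ball_convex2 R 0 e (p - (a + t *: (b - a))) (q - (a + s *: (b - a))) r.
rewrite -!ball_normE /= !sub0r !normrN => /(_ hp hq); rewrite r0 r1 => /(_ isT).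
congr (`|_| < e).
by case: a b p q {hp hq} => ? ? [? ?] [? ?] [? ?]; congr pair; rewrite /= /GRing.scale/=; ring.
Qed.

Lemma sub_tube a b T T' e e' : T' <= T -> e' <= e -> tube a b T' e' `<=` tube a b T e.
Proof.
move=> TT ee q [t /andP[t0 tT] hq]; exists t; first by rewrite t0 (le_trans tT).
exact: lt_le_trans ee.
Qed.

Lemma tube_axis a b T e t : 0 < e -> 0 <= t <= T -> tube a b T e (a + t *: (b - a)).
Proof. by move=> e0 h; exists t => //; rewrite subrr normr0. Qed.

(** A section over a neighbourhood, rather than a lifted path, so that lifts of nearby segments can
    be compared on overlaps. *)
Definition liftable (a b : R * R) s (T : R) := exists (e : R) (sigma : R * R -> S),
  [/\ 0 < e, is_section f (tube a b T e) sigma & sigma a = s].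

(* The lifts at times t_n increasing to T form a Cauchy sequence for the induced
   distance, as the induced metric is at most delta^-2 (dx^2 + dy^2). *)
Lemma lift_extend (a b : R * R) s (T : R) : 0 <= T <= 1 ->
  (forall t : R, 0 <= t <= 1 -> Om (a + t *: (b - a))) ->
  (forall t : R, 0 <= t -> (t < T \/ t = 0) -> liftable a b s t) ->
  exists2 d : R, 0 < d & liftable a b s (T + d).
Proof.
move=> /andP[T0 T1] hOm hL; have [oO sO sd d0] := hM.
set w := b - a in hOm *.
pose ga (t : R) := a + t *: w.
have ga0 : ga 0 = a by rewrite /ga scale0r addr0.
have cga : continuous ga by apply: (@continuous_segment R a b id) => t; exact: cvg_id.
have [m m0 hm] : exists2 m : R, 0 < m & forall t : R, 0 <= t <= 1 -> m <= delta (ga t).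
  have cdg : {within `[(0:R), 1], continuous (fun t => delta (ga t))}.
    apply: continuous_in_subspaceT => t; rewrite inE /= in_itv/= => /hOm Ot.
    by apply: (@continuous_comp _ _ _ ga delta); [exact: cga|exact: (sd 0)].
  have [|t0 t01 tmin] := compact_EVT_min _ (@segment_compact R 0 1) cdg.
    by exists 0; rewrite /= in_itv/= lexx ler01.
  exists (delta (ga t0)); first by move: t01; rewrite inE /= in_itv/= => /hOm; exact: d0.
  by move=> t ht; apply: tmin; rewrite inE /= in_itv.
pose ha : nat -> R := @harmonic R.
(* [harmonic n] is 1 / (n + 1), so these times stay below [T] when [T] is positive and are all 0
   when [T] is 0: the two cases of the hypothesis on [t]. *)
pose tt (n : nat) : R := T * (1 - ha n).
have hn n : 0 < ha n <= 1.
  by rewrite /ha /ha invr_gt0 ltr0n /= invf_le1// ler1n.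
have tt0 n : 0 <= tt n.
  by have /andP[_ h] := hn n; rewrite /tt mulr_ge0// subr_ge0.
have ttT n : tt n < T \/ tt n = 0.
  have [E|Tp] := eqVneq T 0; first by right; rewrite /tt E mul0r.
  left; have /andP[h _] := hn n; rewrite /tt gtr_pMr ?gtrBl//.
  by rewrite lt_neqAle eq_sym Tp.
have ttT' n : tt n <= T by case: (ttT n) => [/ltW|->].
have tt1 n : 0 <= tt n <= 1 by rewrite tt0 (le_trans (ttT' n)).
have /choice[E hE] : forall n, exists E : R * (R * R -> S),
    [/\ 0 < E.1, is_section f (tube a b (tt n) E.1) E.2 & E.2 a = s].
  by move=> n; have [e [sigma h]] := hL _ (tt0 n) (ttT n); exists (e, sigma).
pose x n := (E n).2 (ga (tt n)).
have axis n (t : R) : 0 <= t <= tt n -> tube a b (tt n) (E n).1 (ga t).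
  by have [e0 _ _] := hE n; exact: tube_axis.
have ax0 n : tube a b (tt n) (E n).1 a by rewrite -[X in tube _ _ _ _ X]ga0; apply: axis; rewrite lexx tt0.
have px n : proj f (x n) = ga (tt n).
  by have [_ hs _] := hE n; have [] := hs (ga (tt n)); [apply: axis; rewrite tt0 lexx|].
(* All the sections start from [s], so an earlier point [x i] can be computed in any later section,
   where distances between two such points are estimated. *)
have xE i n : tt i <= tt n -> x i = (E n).2 (ga (tt i)).
  move=> le_in; have [_ hs1 e1] := hE i; have [_ hs2 e2] := hE n.
  apply: (section_unique hS hs1 hs2 _ _ (ax0 i) (ax0 n)).
  - exact: convex_tube.
  - exact: convex_tube.
  - by rewrite e1.
  - by apply: axis; rewrite tt0 lexx.
  - by apply: axis; rewrite tt0.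
have gaB (t t' : R) : ga t - ga t' = (t - t') *: w by rewrite /ga opprD addrACA subrr add0r scalerBl.
pose K := pi * (2 * `|w| / m).
have K0 : 0 <= K by rewrite mulr_ge0 ?pi_ge0// divr_ge0 ?mulr_ge0// ltW.
have dist i j k : tt i <= tt k -> tt j <= tt k ->
    (surface_dist delta tau f (x i) (x j) <= (K * `|tt j - tt i|)%:E)%E.
  move=> ik jk; rewrite (xE _ _ ik) (xE _ _ jk); have [_ hs _] := hE k.
  have /le_trans : (surface_dist delta tau f ((E k).2 (ga (tt i))) ((E k).2 (ga (tt j))) <=
      (pi * (2 * `|ga (tt j) - ga (tt i)| / m))%:E)%E.
    apply: (segment_dist hM st hS hs (@open_tube _ _ _ _) m0).
    move=> t /andP[t0 t1]; rewrite gaB.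
    have -> : ga (tt i) + t *: ((tt j - tt i) *: w) = ga ((1 - t) * tt i + t * tt j).
      by rewrite /ga -addrA scalerA -scalerDl; congr (_ + _ *: _); ring.
    have h : 0 <= (1 - t) * tt i + t * tt j <= tt k.
      have t1' : 0 <= 1 - t by rewrite subr_ge0.
      rewrite addr_ge0/= ?(mulr_ge0 _ (tt0 _))//.
      have -> : tt k = (1 - t) * tt k + t * tt k by ring.
      by apply: lerD; apply: ler_wpM2l.
    split; first exact: axis.
    by apply: hm; have /andP[-> /= /le_trans ->] := h; last by case/andP: (tt1 k).
  apply; rewrite lee_fin gaB normrZ /K le_eqVlt; apply/orP; left; apply/eqP.
  move: `|w| `|_| => y z; ring.
have cauchy (e : R) : 0 < e -> exists N : nat, forall i j : nat, (N <= i)%N -> (N <= j)%N ->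
    (surface_dist delta tau f (x i) (x j) < e%:E)%E.
  move=> e0.
  have : \forall n \near \oo, `|0 - ha n| < e / (K + 1).
    by apply: (@cvgr_dist_lt _ _ _ _ _ ha _ cvg_harmonic); rewrite divr_gt0// ltr_wpDl.
  case=> N _ hN; exists N => i j Ni Nj.
  have hi n : (N <= n)%N -> ha n < e / (K + 1).
    move=> Nn; have := hN n Nn; rewrite /= sub0r normrN gtr0_norm//.
    by case/andP: (hn n).
  have ij : `|tt j - tt i| < e / (K + 1).
    have -> : tt j - tt i = T * (ha i - ha j) by rewrite /tt; ring.
    rewrite normrM ger0_norm//.
    apply: (@le_lt_trans _ _ `|ha i - ha j|); first by rewrite ler_piMl.
    have /andP[i0 _] := hn i; have /andP[j0 _] := hn j.
    by apply: ltr_dist_pos; rewrite ?i0 ?j0 hi.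
  have [k ik jk] : exists2 k, tt i <= tt k & tt j <= tt k.
    by have [h|/ltW h] := leP (tt i) (tt j); [exists j|exists i].
  apply: le_lt_trans (dist i j k ik jk) _; rewrite lte_fin.
  apply: (@le_lt_trans _ _ ((K + 1) * `|tt j - tt i|)); first by rewrite ler_wpM2r// lerDl.
  by rewrite mulrC -ltr_pdivlMr// ltr_wpDl.
have [l xl] := hC cauchy.
have ttc : tt n @[n --> \oo] --> T.
  rewrite -[X in _ --> X]mulr1; apply: cvgM; first exact: cvg_cst.
  rewrite -[X in _ --> X]subr0; apply: cvgB; [exact: cvg_cst|exact: cvg_harmonic].
have pl : proj f l = ga T.
  have h1 : proj f (x n) @[n --> \oo] --> proj f l.
    apply: (@cvg_comp _ _ _ x (proj f) _ _ _ xl);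
      exact: (@proj_continuous _ _ _ _ _ _ hS l).
  have h2 : proj f (x n) @[n --> \oo] --> ga T.
    rewrite (_ : (fun n => _) = (fun n => ga (tt n))); last by apply/funext.
    by apply: (@cvg_comp _ _ _ tt ga _ _ _ ttc); exact: cga.
  exact: cvg_unique h1 h2.
have [N [r [G [[oN Nl r0 Gl] [inj hG _]]]]] := local_section hS l.
rewrite pl in Gl hG.
have w0 : 0 < `|w| + 1 by rewrite ltr_wpDl.
(* Half of [r] is for moving along the axis by at most [d], the other half for the thickness of the
   new tube; the added 1 covers [w = 0]. *)
pose d := r / 2 / (`|w| + 1).
have dp : 0 < d by rewrite !divr_gt0.
have dw : d * `|w| < r / 2.
  rewrite /d mulrAC ltr_pdivrMr// ltr_pM2l ?divr_gt0//.
  by rewrite ltrDl.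
have [n [Nn nT]] : exists n, N (x n) /\ `|T - tt n| < d.
  have h1 : \forall n \near \oo, N (x n) by apply: xl; exact: open_nbhs_nbhs.
  have h2 : \forall n \near \oo, `|T - tt n| < d by exact: (@cvgr_dist_lt _ _ _ _ _ tt _ ttc).
  suff : \forall n \near \oo, N (x n) /\ `|T - tt n| < d.
    by case=> M _ hMM; exists M; exact: hMM (leqnn M).
  by move: h1 h2; apply: filterS2.
have inball (t : R) : `|t - T| <= d -> `|ga T - ga t| < r / 2.
  move=> h; rewrite gaB normrZ distrC; apply: le_lt_trans dw.
  by rewrite ler_wpM2r.
have r2 : r / 2 < r by rewrite ltr_pdivrMr// ltr_pMr// ltr1n.
have Bn : ball (ga T) r (ga (tt n)).
  by rewrite -ball_normE /=; apply: lt_trans r2; apply: inball; rewrite distrC ltW.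
have [e0 hs es] := hE n.
have hGs : is_section f (ball (ga T) r) G by move=> q /hG[].
have [NG pG _] := hG _ Bn.
have xG : x n = G (ga (tt n)) by apply: inj => //; rewrite px.
(* The section around the limit [l] passes through [x n], hence continues the section over the tube
   up to time [tt n]. *)
have agree q : tube a b (tt n) (E n).1 q -> ball (ga T) r q -> (E n).2 q = G q.
  apply: (section_unique hS hs hGs (@convex_tube _ _ _ _) (@ball_convex2 _ _ _) _ Bn xG).
  by apply: axis; rewrite tt0 lexx.
have oB : open (ball (ga T) r) by exact: ball_open.
have [sigma hsig sE] := section_glue (@open_tube _ _ _ _) oB hs hGs agree.
exists d => //; exists (Num.min (E n).1 (r / 2)), sigma; split.
- by rewrite lt_min e0 divr_gt0.
- move=> q [t /andP[t0 tTd]]; rewrite lt_min => /andP[q1 q2]; apply: hsig.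
  have [tn|nt] := leP t (tt n); first by left; exists t => //; rewrite t0.
  right; rewrite -ball_normE /=.
  have -> : ga T - q = (ga T - ga t) + (ga t - q) by rewrite addrA subrK.
  apply: le_lt_trans (ler_normD _ _) _.
  have -> : r = r / 2 + r / 2 by field.
  apply: ltrD; last by rewrite distrC.
  by apply: inball; exact: ler_dist_between nT nt tTd.
by rewrite sE.
Qed.

Lemma liftable_le (a b : R * R) s (T T' : R) : T' <= T -> liftable a b s T -> liftable a b s T'.
Proof.
move=> TT [e [sigma [e0 hs es]]]; exists e, sigma; split => // q hq; apply: hs.
exact: sub_tube hq.
Qed.

(** The supremum of the liftable times can be exceeded by [lift_extend], so it is not a barrier
    before time 1. *)
Lemma lift_segment (a b : R * R) s : proj f s = a ->
  (forall t : R, 0 <= t <= 1 -> Om (a + t *: (b - a))) -> liftable a b s 1.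
Proof.
move=> ps hOm.
have L0 : liftable a b s 0.
  have [N [r [G [[oN Nl r0 Gl] [inj hG _]]]]] := local_section hS s.
  rewrite ps in Gl hG; exists r, G; split => // q [t ht hq].
  have t0 : t = 0 by apply/eqP; rewrite eq_le andbC.
  move: hq; rewrite t0 scale0r addr0 distrC => hq.
  by have [] : [/\ N (G q), proj f (G q) = q & {for q, continuous G}] by apply: hG; rewrite -ball_normE.
pose A : set R := [set t | 0 <= t <= 1 /\ liftable a b s t].
have A0 : A 0 by split => //; rewrite lexx ler01.
have hA : has_sup A by split; [exists 0|exists 1 => t [/andP[]]].
have s0 : 0 <= sup A by apply: sup_upper_bound.
have s1 : sup A <= 1 by apply: ge_sup; [exists 0|move=> t [/andP[]]].
have [||d d0 Ld] := @lift_extend a b s (sup A) _ hOm.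
- by rewrite s0 s1.
- move=> t t0 [ts|->//]; have [x [_ Lx] tx] := sup_gt hA.1 ts.
  exact: liftable_le (ltW tx) Lx.
have [h|/ltW h] := leP (sup A + d) 1; last exact: liftable_le h Ld.
have : sup A + d <= sup A.
  by apply: sup_upper_bound => //; split => //; rewrite h addr_ge0// ltW.
by rewrite gerDl leNgt d0.
Qed.

Lemma no_complete_spacelike : ((2^-1)%:E * cheeger Om delta < inf_abs Om tau)%E -> False.
Proof.
move=> hlt; have [oO [_ sO] _ _] := hM; have [[_ _ [s1 _] fOm _] _] := hS.
have sO' p (t : R) : Om p -> 0 <= t <= 1 -> Om (t *: p) by exact: sO.
(* Some point of the surface lies over the origin: lift the segment from the projection of any point
   to 0, which stays in the star-shaped domain. *)
have [s0 ps0] : exists s0, proj f s0 = 0.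
  have [|e [sigma [e0 hs _]]] := @lift_segment (proj f s1) 0 s1 erefl.
    move=> t /andP[t0 t1].
    have -> : proj f s1 + t *: (0 - proj f s1) = (1 - t) *: proj f s1.
      by rewrite sub0r scalerN scalerBl scale1r.
    by apply: sO'; [exact: fOm|rewrite subr_ge0 t1 lerBlDr lerDl t0].
  exists (sigma 0); have [] := hs 0 => //.
  have := @tube_axis (proj f s1) 0 1 e 1 e0; rewrite scale1r addrC subrK.
  by apply; rewrite ler01 lexx.
have lift p : Om p -> liftable 0 p s0 1.
  by move=> Op; apply: lift_segment => // t t01; rewrite add0r subr0; exact: sO'.
have /choice[E hE] : forall p, exists E : R * (R * R -> S), Om p ->
    [/\ 0 < E.1, is_section f (tube 0 p 1 E.1) E.2 & E.2 0 = s0].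
  move=> p; have [/lift[e [sigma h]]|nOp] := pselect (Om p); first by exists (e, sigma).
  by exists (0, cst s0).
(* The value at [p] is the end of the lift, starting at [s0], of the segment from 0 to [p]. *)
pose sigma p := (E p).2 p.
have tube0 p : Om p -> tube 0 p 1 (E p).1 0.
  move=> Op; have [e0 _ _] := hE p Op.
  by exists 0; rewrite ?lexx ?ler01// scale0r addr0 subrr normr0.
have tube1 p q : `|q - p| < (E p).1 -> tube 0 p 1 (E p).1 q.
  by move=> h; exists 1; rewrite ?lexx ?ler01// subr0 scale1r add0r.
(* For [q] near [p] the two convex tubes both contain 0 and [q], and their sections agree at 0,
   hence at [q]; so [sigma] is locally a section over an open set. *)
have agree p : Om p -> nbhs p [set q : R * R | sigma q = (E p).2 q].
  move=> Op; have [e0 hs es] := hE p Op.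
  have n1 : nbhs p Om by exact: open_nbhs_nbhs.
  have n2 : nbhs p (ball p (E p).1) by exact: nbhsx_ballx.
  move: n1 n2; apply: filterS2 => q Oq; rewrite -ball_normE /= distrC => pq.
  have [e0' hs' es'] := hE q Oq.
  apply: (section_unique hS hs' hs (@convex_tube _ _ _ _) (@convex_tube _ _ _ _)
    (tube0 q Oq) (tube0 p Op)).
  - by rewrite es es'.
  - by apply: tube1; rewrite subrr normr0.
  - exact: tube1.
apply: (no_spacelike_everywhere (u := fun z => (f (sigma z)).2) hM st hlt) => p Op.
have [e0 hs es] := hE p Op.
apply: (near_spacelike_at (w := fun z => (f ((E p).2 z)).2)).
  by move: (agree p Op); apply: filterS => q /= ->.
apply: (section_spacelike hS hs (@open_tube _ _ _ _)).
by apply: tube1; rewrite subrr normr0.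
Qed.

End lifting.

Theorem theorem16 (R : realType) (Om : set (R * R)) (delta : R * R -> R)
    (hM : conformal_domain Om delta) :
  (forall H : R * R -> R, smooth Om H ->
     ((2^-1)%:E * cheeger Om delta < inf_abs Om H)%E ->
     forall tau : R * R -> R, smooth Om tau ->
       ~ exists u : R * R -> R, Ck 2 Om u /\
           forall p, Om p -> graph_mean_curvature delta tau u p = H p)
  /\
  (forall tau : R * R -> R, smooth Om tau ->
     ((2^-1)%:E * cheeger Om delta < inf_abs Om tau)%E ->
     (~ exists (S : topologicalType) (f : S -> R * R * R),
          spacelike_surface Om delta tau f /\ complete_surface delta tau f)
     /\
     ~ exists u : R * R -> R, entire_spacelike_graph Om delta tau u).
Proof.
split=> [H sH hlt tau st [u [C2u hu]]|tau st hlt].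
  exact: (no_entire_graph hM sH hlt st C2u hu).
split; first by move=> [S [f [hS hC]]]; exact: (no_complete_spacelike hM st hS hC hlt).
by move=> [u hu]; exact: (no_spacelike_graph hM st hlt hu).
Qed.
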